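(* Let $N,m,n,d\ge 1$ be integers. For $a=(a(i,j)_\lambda)\in\mathbb{C}^{Nmn}$, with $1\le i\le m$, $1\le j\le n$, $1\le\lambda\le N$, let $L_a(x)$ be the $m\times n$ matrix whose $(i,j)$ entry is the homogeneous polynomial of degree $d$ $$\sum_{\lambda=1}^{N}a(i,j)_\lambda\,x_\lambda^d .$$ Then, for almost all values of the parameters $a=(a(i,j)_\lambda)$, $L_a:(\mathbb{C}^N,0)\to M_{mn}$ is finitely $\mathcal{G}$-determined.
   Context: ''For almost all $a$'' means for all $a\in\mathbb{C}^{Nmn}$ outside a set of Lebesgue measure zero. $M_{mn}\cong\mathbb{C}^{mn}$ is the space of complex $m\times n$ matrices. $\mathcal{O}_N$ is the ring of germs at $0$ of analytic functions on $\mathbb{C}^N$. $M_{mn}(\mathcal{O}_N)\cong\mathcal{O}_N^{mn}$ is the set of holomorphic map germs $F:(\mathbb{C}^N,0)\to M_{mn}$. The group $\mathcal{G}$: let $\mathcal{R}$ be the group of germs of analytic diffeomorphisms of $(\mathbb{C}^N,0)$, $\mathcal{H}=GL_n(\mathcal{O}_N)\times GL_m(\mathcal{O}_N)$ and $\mathcal{G}=\mathcal{R}\ltimes\mathcal{H}$. Two germs $F_1,F_2\in M_{mn}(\mathcal{O}_N)$ are $\mathcal{G}$-equivalent if there exist $h\in\mathcal{R}$, $R\in GL_n(\mathcal{O}_N)$, $L\in GL_m(\mathcal{O}_N)$ with $F_1=L^{-1}(h^*F_2)R$, where $h^*F_2=F_2\circ h$. A germ $F\in M_{mn}(\mathcal{O}_N)$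 is $r$-$\mathcal{G}$-determined if every $G\in M_{mn}(\mathcal{O}_N)$ with $j^rG(0)=j^rF(0)$ ($r$-jets at $0$) is $\mathcal{G}$-equivalent to $F$; $F$ is finitely $\mathcal{G}$-determined if such an $r$ exists. *)

(* Defs.v *)
From mathcomp Require Import all_boot all_order all_algebra.
From mathcomp Require Import complex.
From mathcomp Require Import all_classical all_reals all_analysis.
(* The notations of mpoly clash with those of analysis. *)
From mathcomp Require mpoly.
Import (canonicals, coercions) mpoly.

Set Implicit Arguments.
Unset Strict Implicit.
Unset Printing Implicit Defensive.

Import Order.TTheory GRing.Theory Num.Theory.
Import numFieldNormedType.Exports.

Local Open Scope classical_set_scope.
Local Open Scope ring_scope.

(** Germs at 0 are represented by functions defined on the whole space, of which
    only the behaviour near 0 matters.  The field [K] is meant to be [R[i]]: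
    staying generic gives access to the topology of a [numFieldType]. *)

(* x^alpha. *)
Definition monomial (K : numFieldType) (N : nat) (x : 'rV[K]_N)
    (alpha : mpoly.multinom N) : K :=
  mpoly.mmap1 (x 0) alpha.

(* f(x) is, for x near 0, the sum of the absolutely convergent series of the
   c_alpha x^alpha.  [mpoly.bmultinom N k] is the finite type of the
   multi-indices alpha with |alpha| < k. *)
Definition has_power_series (K : numFieldType) (N : nat)
    (f : 'rV[K]_N -> K) (c : mpoly.multinom N -> K) : Prop :=
  \forall x \near (0 : 'rV[K]_N),
    cvgn (fun k : nat => (
      \sum_(alpha : mpoly.bmultinom N k) `|c alpha * monomial x alpha|) : K)
    /\ (fun k : nat => (
      \sum_(alpha : mpoly.bmultinom N k) c alpha * monomial x alpha) : K)
      @ \oo --> f x.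

Definition analytic_germ (K : numFieldType) (N : nat) (f : 'rV[K]_N -> K)
    : Prop :=
  exists c, has_power_series f c.

(* Used for M_{mn}(O_N) and, with p = 1, for maps from K^N to K^q. *)
Definition analytic_mx_germ (K : numFieldType) (N p q : nat)
    (F : 'rV[K]_N -> 'M[K]_(p, q)) : Prop :=
  forall i j, analytic_germ (fun x => F x i j).

(* The group of germs of analytic diffeomorphisms of (K^N, 0). *)
Definition diffeo_germ (K : numFieldType) (N : nat)
    (h : 'rV[K]_N -> 'rV[K]_N) : Prop :=
  [/\ analytic_mx_germ h, h 0 = 0 &
    exists g : 'rV[K]_N -> 'rV[K]_N,
      [/\ analytic_mx_germ g, g 0 = 0 &
        \forall x \near (0 : 'rV[K]_N), g (h x) = x /\ h (g x) = x]].

(* GL_p(O_N). *)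
Definition GL_germ (K : numFieldType) (N p : nat)
    (A : 'rV[K]_N -> 'M[K]_p) : Prop :=
  analytic_mx_germ A /\
  exists B : 'rV[K]_N -> 'M[K]_p,
    analytic_mx_germ B /\
    \forall x \near (0 : 'rV[K]_N),
      A x *m B x = 1%:M /\ B x *m A x = 1%:M.

Definition G_equivalent (K : numFieldType) (N m n : nat)
    (F1 F2 : 'rV[K]_N -> 'M[K]_(m, n)) : Prop :=
  exists (h : 'rV[K]_N -> 'rV[K]_N) (A : 'rV[K]_N -> 'M[K]_n)
         (L : 'rV[K]_N -> 'M[K]_m),
    [/\ diffeo_germ h, GL_germ A, GL_germ L &
      \forall x \near (0 : 'rV[K]_N),
        F1 x = invmx (L x) *m F2 (h x) *m A x].

(* The power series coefficients of an analytic germ are unique (they are the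
   partial derivatives at 0 divided by alpha!), so that this relation is the
   equality of the r-jets at 0 of two analytic germs. *)
Definition same_jet (K : numFieldType) (N m n r : nat)
    (F G : 'rV[K]_N -> 'M[K]_(m, n)) : Prop :=
  forall i j, exists c c' : mpoly.multinom N -> K,
    [/\ has_power_series (fun x => F x i j) c,
        has_power_series (fun x => G x i j) c' &
        forall alpha, (mpoly.mdeg alpha <= r)%N -> c alpha = c' alpha].

Definition determined (K : numFieldType) (N m n r : nat)
    (F : 'rV[K]_N -> 'M[K]_(m, n)) : Prop :=
  analytic_mx_germ F /\
  forall G : 'rV[K]_N -> 'M[K]_(m, n),
    analytic_mx_germ G -> same_jet r G F -> G_equivalent G F.

Definition finitely_determined (K : numFieldType) (N m n : nat)
    (F : 'rV[K]_N -> 'M[K]_(m, n)) : Prop :=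
  exists r : nat, determined r F.

(** Lebesgue null sets of R^J, through countable covers by closed boxes. *)
Definition real_null_set (R : realType) (J : finType) (Z : set (J -> R))
    : Prop :=
  forall eps : R, 0 < eps ->
    exists lo hi : nat -> J -> R,
      [/\ forall k j, lo k j <= hi k j,
          Z `<=` \bigcup_k [set v : J -> R | forall j, lo k j <= v j <= hi k j]
        & (\sum_(0 <= k <oo) (\prod_(j : J) (hi k j - lo k j))%:E <= eps%:E)%E].

(* C^I is identified with R^(I + I) through real and imaginary parts. *)
Definition complex_null_set (R : realType) (I : finType)
    (Z : set (I -> R[i])) : Prop :=
  real_null_set
    [set v : I + I -> R | Z (fun i => Complex (v (inl i)) (v (inr i)))].

Definition L_ (K : numFieldType) (N m n d : nat)
    (a : 'I_m * 'I_n * 'I_N -> K) (x : 'rV[K]_N) : 'M[K]_(m, n) :=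
  \matrix_(i < m, j < n) \sum_(l < N) a (i, j, l) * x 0 l ^+ d.

(* Main.v *)
Require Import Defs.
From HB Require Import structures.
From mathcomp Require Import all_boot all_order all_algebra ring zify.
From mathcomp Require Import complex ring_quotient fraction generic_quotient.
From mathcomp Require Import boolp classical_sets.
From mathcomp Require mpoly.

(** Write [L(y) = \sum_l y_l A_l] for the linear matrix with coefficients [a],
    so that the germ under study is [F(x) = L(x_1^d, ..., x_N^d)].

    _Genericity._ In the module of [m x n] matrices over [K[y]] consider the
    submodule generated by the [E L], the [L E] (for elementary matrices [E])
    and the [y_l A_l]. For generic [a], a power of each [y_lam] annihilates the
    quotient ([generic_annihilator]). Otherwise the annihilator is disjoint from
    the powers of [y_lam], so it lies in a prime ideal avoiding them, and over
    the residue field there is a point [t] with [t_lam <> 0], and a nonzero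
    matrix [P], such that [L(t) P = 0], [P L(t) = 0] and [t_l tr (P A_l) = 0]
    for all [l]. Such coefficients [a] are polynomial functions of [N m n - 1]
    parameters: once the point is normalized by [t_lam = 1], the matrices [L(t)]
    killed by [P] on both sides, together with [P] itself up to a scalar, make
    [m n - 1] parameters, and replace the [m n] entries of [A_lam]; for [l <>
    lam], either [t_l = 0], or [t_l] is a parameter but the equation [tr (P A_l)
    = 0] eliminates one entry of [A_l]. Hence the [N m n] coefficients are
    algebraically dependent ([algebraic_dependence]), and [a] is a zero of a
    fixed nonzero polynomial.

    _Determinacy._ Since [x_l^d A_l = (x_l / d) dF/dx_l], substituting [y_l =
    x_l^d] writes each [x_lam^K M], with [K = d k], as a tangent vector [be F +
    F al + \sum_l p_l dF/dx_l]. If [G] and [F] have the same jet of order [2 N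
    K], then [G = F + \sum_lam x_lam^(2 K) e_lam] with [e_lam(0) = 0]
    ([pseries_divide]). The multipliers [1 + be] and [1 + al] and the
    displacement [p] which carry [F] to [G] are sought as combinations, with
    unknown coefficients [v], of the tangent vectors multiplied once more by
    [x_mu^K]. Then both the linear part of the transformed germ and the
    quadratic remainder are combinations of the [x_mu^K x_nu^K], and identifying
    their coefficients gives an equation [v = c - Q(x, v)] with [Q] quadratic in
    [v]: a contraction for small [v] ([solve_equation]).

    _Analytic germs_ are handled as uniform limits of polynomials on polydiscs.
    This class is stable under products, composition and the iteration of a
    contraction, and it consists of sums of power series by the Cauchy estimates
    for polynomials, obtained by averaging over roots of unity ([ulim_pseries]).

    _Null sets._ A nonzero complex polynomial has a null set of zeros because,
    along each translate of a curve [(t, t^s, t^(s^2), ...)], it restricts to a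
    polynomial in [t] of fixed degree and leading coefficient: a fine grid then
    has few points close to a zero ([complex_null_zeros]). *)

Set Implicit Arguments.
Unset Strict Implicit.
Unset Printing Implicit Defensive.
Import GRing.Theory.
Local Open Scope ring_scope.

(** * Primes avoiding the powers of an element *)

Section PrimeQuotient.
Variables (B : comNzRingType) (p : prime_idealr B).

(** An integral domain carries an inverse function on its units, which classical
    choice provides here; the fraction field can then be formed. *)
Definition prime_quot : Type := {ideal_quot p}.
HB.instance Definition _ := GRing.ComNzRing.on prime_quot.

Definition prime_quot_unit : pred prime_quot :=
  fun x => `[< exists y : prime_quot, y * x = 1 >].
Definition prime_quot_inv (x : prime_quot) : prime_quot :=
  if pselect (exists y : prime_quot, y * x = 1) is left e
  then projT1 (cid e) else x.

Lemma prime_quot_mulVx : {in prime_quot_unit, left_inverse 1 prime_quot_inv *%R}.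
Proof.
move=> x /asboolP ex; rewrite /prime_quot_inv; case: pselect => // e.
by case: cid.
Qed.
Lemma prime_quot_unitP (x y : prime_quot) : y * x = 1 -> prime_quot_unit x.
Proof. by move=> yx1; apply/asboolP; exists y. Qed.
Lemma prime_quot_invout : {in [predC prime_quot_unit], prime_quot_inv =1 id}.
Proof.
move=> x /asboolPn nx; rewrite /prime_quot_inv; case: pselect => // e.
Qed.
HB.instance Definition _ := GRing.ComNzRing_hasMulInverse.Build prime_quot
  prime_quot_mulVx prime_quot_unitP prime_quot_invout.

Lemma prime_quot_mulf_eq0 (x y : prime_quot) :
  x * y = 0 -> (x == 0) || (y == 0).
Proof. exact: Quotient.rquot_IdomainAxiom. Qed.
HB.instance Definition _ := GRing.ComUnitRing_isIntegral.Build prime_quot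
  prime_quot_mulf_eq0.
End PrimeQuotient.

Section Krull.
Local Open Scope classical_set_scope.
Variables (B : comNzRingType).

Definition is_ideal (I : set B) :=
  [/\ I 0, (forall x y, I x -> I y -> I (x + y)) & forall b x, I x -> I (b * x)].

(** An ideal maximal among those that contain [I] and no power of [s] is prime:
    if it contained neither [x] nor [y] but [x * y], enlarging it by [x] or by
    [y] would catch powers of [s], and so would their product. Zorn's lemma is
    applied to sets [J] through [J `|` I], so that the empty chain causes no
    exception. *)
Lemma prime_avoiding_powers (I : set B) (s : B) :
    is_ideal I -> (forall k, ~ I (s ^+ k)) ->
  exists2 p : prime_idealr B, (forall x, I x -> x \in p) & s \notin p.
Proof.
move=> [I0 ID IM] Is.
pose avoids (J : set B) := is_ideal J /\ forall k, ~ J (s ^+ k).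
have [F FP Ftot|A [[[A0 AD AM] As] Amax]] := @Zorn_bigcup B (fun J => avoids (J `|` I)).
  have inF x y : (\bigcup_(X in F) X `|` I) x -> (\bigcup_(X in F) X `|` I) y ->
      (I x /\ I y) \/ exists2 X, F X & (X `|` I) x /\ (X `|` I) y.
    case=> [[X FX Xx]|Ix] [[Y FY Yy]|Iy]; last by left.
    - right; have [XY|YX] := Ftot _ _ FX FY; [exists Y|exists X] => //.
        by split; left => //; apply: XY.
      by split; left => //; apply: YX.
    - by right; exists X => //; split; [left|right].
    - by right; exists Y => //; split; [right|left].
  have upF x X : F X -> (X `|` I) x -> (\bigcup_(X in F) X `|` I) x.
    by move=> FX [Xx|]; [left; exists X|right].
  split; first split.
  - by right.
  - move=> x y xF yF; have [[Ix Iy]|[X FX [Xx Xy]]] := inF _ _ xF yF.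
      by right; apply: ID.
    by apply: (upF _ _ FX); have [[_ + _] _] := FP _ FX; apply.
  - move=> b x xF; have [[Ix Iy]|[X FX [Xx _]]] := inF _ _ xF xF.
      by right; apply: IM.
    by apply: (upF _ _ FX); have [[_ _ +] _] := FP _ FX; apply.
  - move=> k sF; have [[Ix Iy]|[X FX [Xx _]]] := inF _ _ sF sF.
      exact: Is Ix.
    by have [_ /(_ _ Xx)] := FP _ FX.
set J := A `|` I in A0 AD AM As.
(* adding x to the maximal ideal J catches a power of s *)
have catch x : ~ J x -> exists k u b, J u /\ s ^+ k = u + b * x.
  move=> Jx; apply: contrapT => noc.
  pose J' := [set y | exists u b, J u /\ y = u + b * x].
  have JJ' : J `<=` J' by move=> y Jy; exists y, 0; rewrite mul0r addr0.
  refine (Amax J' _ _).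
    split=> [y Ay|J'A]; first by apply: JJ'; left.
    by apply: Jx; left; apply: J'A; exists 0, 1; rewrite mul1r add0r; split.
  have -> : J' `|` I = J'.
    by apply/seteqP; split=> [y [//|Iy]|y]; [apply: JJ'; right|left].
  split; first split.
  - exact: JJ'.
  - move=> _ _ [u [b [Ju ->]]] [v [c [Jv ->]]].
    by exists (u + v), (b + c); split; [exact: AD|rewrite mulrDl addrACA].
  - move=> c _ [u [b [Ju ->]]].
    by exists (c * u), (c * b); split; [exact: AM|rewrite mulrDr mulrA].
  - by move=> k [u [b [Ju E]]]; apply: noc; exists k, u, b.
pose p : pred B := fun x => `[< J x >].
have pP x : reflect (J x) (x \in p) by apply: asboolP.
have pid : idealr_closed p.
  split; [exact/pP|by apply/negP => /pP; rewrite -(expr0 s); exact: As|].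
  by move=> a u v /pP Ju /pP Jv; apply/pP; apply: AD => //; apply: AM.
have npP x : ~ x \in p -> ~ J x by move=> np /pP.
have pprime : prime_idealr_closed p.
  move=> x y /pP Jxy; apply/orP; apply: contrapT => /not_orP.
  move=> [/npP /catch [k [u [b [Ju Ex]]]] /npP /catch [l [v [c [Jv Ey]]]]].
  apply: (As (k + l)%N); rewrite exprD Ex Ey.
  have -> : (u + b * x) * (v + c * y) = v * u + b * x * v + c * y * u + b * c * (x * y).
    by ring.
  apply: (AD); last exact: AM.
  apply: (AD); last exact: AM.
  by apply: (AD); exact: AM.
pose P : prime_idealr B := HB.pack p (isIdealr.Build B p pid)
  (isPrimeIdealrClosed.Build B p pprime).
exists P; first by move=> x Ix; apply/pP; right.
by apply/pP; rewrite -[s]expr1; exact: As.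
Qed.

(** The evaluation [ev] at the generic point of the closed set defined by a
    prime ideal: it vanishes on [I] but not at [s]. *)
Lemma residue_field_avoiding_powers (I : set B) (s : B) :
    is_ideal I -> (forall k, ~ I (s ^+ k)) ->
  exists (kappa : fieldType) (ev : {rmorphism B -> kappa}),
    (forall x, I x -> ev x = 0) /\ ev s != 0.
Proof.
move=> idI Is; have [p Ip ps] := prime_avoiding_powers idI Is.
pose pr (x : B) : prime_quot p := (\pi_{ideal_quot p} x)%qT.
have prB : zmod_morphism pr.
  by move=> x y; rewrite /pr Quotient.pi_add Quotient.pi_opp.
have prM : monoid_morphism pr.
  by split=> [|x y]; [rewrite /pr pi_oner|rewrite /pr Quotient.pi_mul].
pose prR : {rmorphism B -> prime_quot p} :=
  HB.pack pr (GRing.isZmodMorphism.Build _ _ pr prB)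
    (GRing.isMonoidMorphism.Build _ _ pr prM).
have pr0 x : (pr x == 0) = (x \in p).
  have <- : pr 0 = 0 by exact: (raddf0 prR).
  by rewrite /pr -Quotient.idealrBE subr0.
exists {fraction (prime_quot p)}, (@tofrac (prime_quot p) \o prR).
split=> [x /Ip xp|]; last by rewrite /= tofrac_eq0 pr0.
by apply/eqP; rewrite /= tofrac_eq0 pr0.
Qed.
End Krull.

(** * Algebraic dependence of polynomials *)

Module GenericTangent.
Import mpoly.

Section Dependence.
Variables (K : fieldType) (p q : nat) (Phi : 'I_q -> {mpoly K[p]}).

(** The exponents are bounded by [s], so that these products can be counted. *)
Let power s (al : {ffun 'I_q -> 'I_s}) : {mpoly K[p]} := \prod_i Phi i ^+ al i.

Lemma msize_power D s (al : {ffun 'I_q -> 'I_s}) :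
  (forall i, msize (Phi i) <= D)%N -> (msize (power al) <= q * (s * D.+1).+2 + 1)%N.
Proof.
move=> hD.
have hX i k : (msize (Phi i ^+ k) <= k * D.+1 + 1)%N.
  elim: k => [|k IH]; first by rewrite expr0 msize1.
  rewrite exprS (leq_trans (msizeM_le _ _)) // mulSn -addnA addSn ltnS.
  exact: leq_add.
have : (msize (power al) <= \sum_(i < q) (s * D.+1).+2 + 1)%N.
  rewrite /power; elim/big_rec2: _ => [|i y1 y2 _ Hy]; first by rewrite msize1.
  have := msizeM_le (Phi i ^+ al i) y2; have := hX i (al i).
  have : (al i * D.+1 <= s * D.+1)%N by rewrite leq_mul2r ltnW.
  by lia.
by rewrite sum_nat_const card_ord.
Qed.

(** Counting: the [s ^ q] products of exponents less than [s] have degree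
    [O(s)], hence live in a space of dimension [O(s ^ p)], and [p < q]. *)
Theorem algebraic_dependence : (p < q)%N ->
  exists2 delta : {mpoly K[q]}, delta != 0 & mmap (@mpolyC p K) Phi delta = 0.
Proof.
move=> pq.
pose D := \max_i msize (Phi i).
have hD i : (msize (Phi i) <= D)%N by apply: leq_bigmax.
(* the products have size at most b <= s * c, and s > c ^ p gives b ^ p < s ^ q *)
pose c := (q * D.+3 + 1)%N; pose s := (c ^ p).+1; pose b := (q * (s * D.+1).+2 + 1)%N.
have bs : (b <= s * c)%N by rewrite /b /c; nia.
have card_lt : (b ^ p < s ^ q)%N.
  apply: (@leq_ltn_trans ((s * c) ^ p)); first by case: (posnP p) => [->|?]; rewrite ?expn0 ?leq_exp2r.
  rewrite expnMn (@leq_trans (s ^ p.+1)) ?leq_exp2l ?ltnS //; last first.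
    by rewrite /s; have : (0 < c ^ p)%N by rewrite expn_gt0 /c addn1.
  by rewrite expnSr ltn_mul2l expn_gt0 /=.
pose rowT := {ffun 'I_q -> 'I_s}; pose colT := {ffun 'I_p -> 'I_b}.
pose mon (be : colT) := [multinom (be i : nat) | i < p].
pose M := \matrix_(i < #|rowT|, j < #|colT|) (power (enum_val i))@_(mon (enum_val j)).
have : kermx M != 0.
  rewrite kermx_eq0 /row_free; apply: contraTneq card_lt => rM.
  have := rank_leq_col M; rewrite rM !card_ffun !card_ord -leqNgt //.
case/rowV0Pn => w /sub_kermxP wM w0.
pose mon' (al : rowT) := [multinom (al i : nat) | i < q].
exists (\sum_i w 0 i *: 'X_[mon' (enum_val i)]).
  apply: contra_neq w0 => E; apply/rowP => i.
  have := congr1 (mcoeff (mon' (enum_val i))) E.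
  rewrite mcoeff0 raddf_sum /= (bigD1 i) //= mcoeffZ mcoeffX eqxx mulr1.
  rewrite big1 ?addr0 ?mxE // => j ji.
  rewrite mcoeffZ mcoeffX; case: eqP => [/mnmP Em|]; rewrite ?mulr0 //.
  case/eqP: ji; apply: enum_val_inj; apply/ffunP => k; apply: val_inj.
  by have := Em k; rewrite !mnmE.
rewrite raddf_sum /=.
have monE al : mmap1 Phi (mon' al) = power al.
  by apply: eq_bigr => i _; rewrite mnmE.
under eq_bigr => i _ do rewrite mmapZ mmapX monE.
apply/mpolyP => m; rewrite mcoeff0 raddf_sum /=.
have [lt_m|ge_m] := boolP [forall i, m i < b]%N; last first.
  rewrite big1 // => i _; rewrite mcoeffCM; apply/eqP; rewrite mulf_eq0; apply/orP.
  right; rewrite mcoeff_eq0; apply: msize_mdeg_ge.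
  apply: leq_trans (msize_power _ hD) _.
  have [j] : exists j, ~~ (m j < b)%N by apply/existsP; rewrite -negb_forall.
  rewrite -leqNgt => /leq_trans; apply.
  by rewrite mdegE (bigD1 j) //= leq_addr.
have /rowP /(_ (enum_rank [ffun i => Ordinal (forallP lt_m i)])) := wM.
rewrite !mxE => E; rewrite -[RHS]E; apply: eq_bigr => i _.
rewrite mcoeffCM !mxE; congr (_ * _@__); apply/mnmP => k.
by rewrite mnmE enum_rankK ffunE.
Qed.
End Dependence.

(** * Parametrization of the degenerate linear matrices *)

(** The rows [f] and the columns [g] carry a minor of maximal size; expressing
    the other rows and columns through them gives normalized factors [X] and [Y]
    with an identity block, and the free parameters of a matrix of rank [p]
    become the remaining entries of [X], [G] and [Y]. *)
Lemma rank_factorization (F : fieldType) n m (P : 'M[F]_(n, m)) :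
  exists p (f : {ffun 'I_p -> 'I_n}) (g : {ffun 'I_p -> 'I_m})
         (X : 'M[F]_(n, p)) (G : 'M[F]_p) (Y : 'M[F]_(p, m)),
    [/\ (p <= n)%N, injective f /\ injective g, P = X *m G *m Y,
        rowsub f X = 1%:M /\ colsub g Y = 1%:M & G \in unitmx].
Proof.
pose f := fullrankfun (col_base_full P).
have rfB : row_full (row_base P)^T by rewrite /row_full mxrank_tr; exact: (row_base_free P).
pose g := fullrankfun rfB.
pose U := rowsub f (col_base P); pose V := colsub g (row_base P).
have Uu : U \in unitmx by rewrite -row_full_unit fullrowsub_full.
have Vu : V \in unitmx.
  rewrite -unitmx_tr -row_full_unit; have := fullrowsub_full rfB.
  by congr row_full; apply/matrixP => i j; rewrite !mxE.
exists (\rank P), f, g, (col_base P *m invmx U), (U *m V), (invmx V *m row_base P).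
split.
- exact: rank_leq_row.
- by split; apply: fullrankfun_inj.
- have E (C : 'M[F]_(n, \rank P)) (D : 'M[F]_(\rank P, m)) :
      C *m invmx U *m (U *m V) *m (invmx V *m D) = C *m D.
    by rewrite !mulmxA mulmxKV // mulmxK.
  by rewrite E mulmx_base.
- by rewrite -mul_rowsub_mx mulmxV // -mulmx_colsub mulVmx.
- by rewrite unitmx_mul Uu.
Qed.

Section Parametrization.
Variables (N m n p : nat) (f : {ffun 'I_p -> 'I_n}) (g : {ffun 'I_p -> 'I_m}).
Variables (u0 v0 : 'I_p) (S : {set 'I_N}) (lam : 'I_N).

Local Notation Q := ('I_m * 'I_n * 'I_N)%type.
Local Notation i0 := (g v0).
Local Notation j0 := (f u0).
(** The coefficients [a] for which some [P = X G Y] and some point [t] with [t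
    lam = 1] satisfy [L(t) P = 0], [P L(t) = 0] and [t_l tr (P A_l) = 0], where
    [L(t) = \sum_l t_l A_l], are parametrized by functions [th] on the same
    index set as [a]. The entries [th (_, _, lam)] hold [X], [G] and [Y] outside
    of the identity blocks, and the block [par_L0] of [L(t)] outside of the rows
    [g] and the columns [f], which determines [L(t)]. For [l != lam], [th (_, _,
    l)] holds [A_l], except that, for [l] in the support [S] of [t], the slot of
    the entry [(i0, j0)], which the trace equation determines, holds [t_l]. As
    [P] matters only up to a scalar, [G u0 v0], held by [th pivot], can be
    normalized to [1]. *)
Definition pivot : Q := (i0, j0, lam).

Section Formulas.
Variables (R : comNzRingType) (th : Q -> R).

Definition par_X : 'M[R]_(n, p) :=
  \matrix_(j, u) if j \in codom f then (j == f u)%:R else th (g u, j, lam).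
Definition par_Y : 'M[R]_(p, m) :=
  \matrix_(u, i) if i \in codom g then (i == g u)%:R else th (i, f u, lam).
Definition par_G : 'M[R]_p := \matrix_(u, v) th (g v, f u, lam).
Definition par_P : 'M[R]_(n, m) := par_X *m par_G *m par_Y.
(** The projections [1 - X (rows f)] and [1 - (columns g) Y]: multiplying by
    them produces matrices killed by [X] on the right and by [Y] on the left. *)
Definition par_E : 'M[R]_n := 1%:M - par_X *m \matrix_(u, j) (j == f u)%:R.
Definition par_E' : 'M[R]_m := 1%:M - \matrix_(i, u) (i == g u)%:R *m par_Y.
Definition par_L0 : 'M[R]_(m, n) := \matrix_(i, j)
  if (i \in codom g) || (j \in codom f) then 0 else th (i, j, lam).
Definition par_L : 'M[R]_(m, n) := par_E' *m par_L0 *m par_E.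
Definition par_t l : R := if l \in S then th (i0, j0, l) else 0.
(** In the first case the entry solves [\sum_k P_k a (k, l) = 0], where [P_(i0,
    j0) = 1]. *)
Definition par_A l : 'M[R]_(m, n) := \matrix_(i, j)
  if (l \in S) && ((i, j) == (i0, j0))
  then - \sum_(k | k != (i0, j0)) par_P k.2 k.1 * th (k, l) else th (i, j, l).
(** The matrix [A_lam] is recovered from [L(t) = A_lam + \sum_(l | l != lam) t_l
    A_l]. *)
Definition par (q : Q) : R :=
  (if q.2 == lam then par_L - \sum_(l | l != lam) par_t l *: par_A l
   else par_A q.2) q.1.1 q.1.2.
End Formulas.

(** The parametrization is polynomial: it can be computed with indeterminates
    and then specialized to any field. *)
Lemma par_morph (R R' : comNzRingType) (phi : {rmorphism R -> R'}) (th : Q -> R) q :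
  par (phi \o th) q = phi (par th q).
Proof.
have mapX : par_X (phi \o th) = map_mx phi (par_X th).
  by apply/matrixP => i j; rewrite !mxE; case: ifP; rewrite ?rmorph_nat.
have mapY : par_Y (phi \o th) = map_mx phi (par_Y th).
  by apply/matrixP => i j; rewrite !mxE; case: ifP; rewrite ?rmorph_nat.
have mapG : par_G (phi \o th) = map_mx phi (par_G th).
  by apply/matrixP => i j; rewrite !mxE.
have mapP : par_P (phi \o th) = map_mx phi (par_P th).
  by rewrite /par_P mapX mapY mapG !map_mxM.
have mapL0 : par_L0 (phi \o th) = map_mx phi (par_L0 th).
  by apply/matrixP => i j; rewrite !mxE; case: ifP; rewrite ?rmorph0.
have mapE : par_E (phi \o th) = map_mx phi (par_E th).
  rewrite /par_E map_mxB map_mx1 map_mxM mapX; congr (_ - _ *m _).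
  by apply/matrixP => i j; rewrite !mxE rmorph_nat.
have mapE' : par_E' (phi \o th) = map_mx phi (par_E' th).
  rewrite /par_E' map_mxB map_mx1 map_mxM mapY; congr (_ - _ *m _).
  by apply/matrixP => i j; rewrite !mxE rmorph_nat.
have mapL : par_L (phi \o th) = map_mx phi (par_L th).
  by rewrite /par_L mapE mapE' mapL0 !map_mxM.
have mapt l : par_t (phi \o th) l = phi (par_t th l).
  by rewrite /par_t; case: ifP; rewrite ?rmorph0.
have mapA l : par_A (phi \o th) l = map_mx phi (par_A th l).
  apply/matrixP => i j; rewrite !mxE mapP; case: ifP => // _.
  rewrite rmorphN rmorph_sum; congr (- _); apply: eq_bigr => k _.
  by rewrite rmorphM mxE.
rewrite /par; case: eqP => _; last by rewrite mapA mxE.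
transitivity (map_mx phi (par_L th - \sum_(l | l != lam) par_t th l *: par_A th l)
  q.1.1 q.1.2); last by rewrite mxE.
rewrite mapL map_mxB; congr ((_ - _ : 'M_(_, _)) _ _).
apply/matrixP => i j; rewrite [RHS]mxE !summxE. rewrite raddf_sum; apply: eq_bigr => l _.
transitivity (phi (par_t th l * par_A th l i j)); last by rewrite [in RHS]mxE.
by rewrite mapt mapA (rmorphM phi) mxE [X in _ * X]mxE.
Qed.

Lemma par_surj (F : fieldType) (a : Q -> F) (t : 'I_N -> F)
    (X : 'M[F]_(n, p)) (G : 'M[F]_p) (Y : 'M[F]_(p, m)) :
    let A l := \matrix_(i < m, j < n) a (i, j, l) in
    let L := \sum_l t l *: A l in
    let P := X *m G *m Y in
    injective f -> injective g -> rowsub f X = 1%:M -> colsub g Y = 1%:M ->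
    L *m X = 0 -> Y *m L = 0 -> G u0 v0 = 1 ->
    t lam = 1 -> S = [set l | t l != 0] ->
    (forall l, t l * \sum_k P k.2 k.1 * a (k, l) = 0) ->
  exists2 th : Q -> F, th pivot = 1 & par th =1 a.
Proof.
move=> A L P finj ginj Xf Yg LX YL Guv tlam ES tPA.
have Xfu u u' : X (f u) u' = (u == u')%:R.
  by have /matrixP /(_ u u') := Xf; rewrite !mxE.
have Ygu u u' : Y u (g u') = (u == u')%:R.
  by have /matrixP /(_ u u') := Yg; rewrite !mxE.
have PG u v : P (f u) (g v) = G u v.
  have : mxsub f g P = G.
    by rewrite /P mxsub_mul -mul_rowsub_mx Xf Yg mulmx1 mul1mx.
  by move/matrixP => /(_ u v); rewrite mxE.
pose th (q : Q) : F := let: (i, j, l) := q in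
  if l == lam then
    if i \in codom g then
      if j \in codom f then P j i else \sum_u (i == g u)%:R * X j u
    else if j \in codom f then \sum_u (j == f u)%:R * Y u i else L i j
  else if (l \in S) && ((i, j) == (i0, j0)) then t l else a (i, j, l).
exists th; first by rewrite /th /pivot eqxx !codom_f PG.
have EX : par_X th = X.
  apply/matrixP => j u; rewrite mxE; case: ifP => [/codomP [u' ->]|jf].
    by rewrite Xfu (inj_eq finj).
  rewrite /th eqxx codom_f jf (bigD1 u) //= eqxx mul1r big1 ?addr0 // => u' ne.
  by rewrite (inj_eq ginj) eq_sym (negPf ne) mul0r.
have EY : par_Y th = Y.
  apply/matrixP => u i; rewrite mxE; case: ifP => [/codomP [u' ->]|ig].
    by rewrite Ygu (inj_eq ginj) eq_sym.
  rewrite /th eqxx codom_f ig (bigD1 u) //= eqxx mul1r big1 ?addr0 // => u' ne.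
  by rewrite (inj_eq finj) eq_sym (negPf ne) mul0r.
have EG : par_G th = G.
  by apply/matrixP => u v; rewrite mxE /th eqxx !codom_f PG.
have EP : par_P th = P by rewrite /par_P EX EY EG.
pose D : 'M[F]_n := \matrix_(j, k) ((j == k) && (j \notin codom f))%:R.
pose D' : 'M[F]_m := \matrix_(j, k) ((j == k) && (j \notin codom g))%:R.
have EL0 : par_L0 th = D' *m L *m D.
  apply/matrixP => i j.
  have -> : (D' *m L *m D) i j = (i \notin codom g)%:R * L i j * (j \notin codom f)%:R.
    rewrite mxE (bigD1 j) //= big1 => [|k kj]; last first.
      by rewrite [D _ _]mxE (negPf kj) mulr0.
    rewrite addr0 [D _ _]mxE eqxx /= mxE (bigD1 i) //= big1 => [|k ki]; last first.
      by rewrite [D' _ _]mxE eq_sym (negPf ki) mul0r.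
    by rewrite addr0 [D' _ _]mxE eqxx.
  rewrite mxE /th eqxx.
  by case: (i \in codom g); case: (j \in codom f);
     rewrite /= ?mul0r ?mulr0 ?mulr1 ?mul1r.
have DE : D *m par_E th = par_E th.
  apply/matrixP => i j; rewrite mxE (bigD1 i) //= big1 => [|k ki]; last first.
    by rewrite mxE eq_sym (negPf ki) mul0r.
  rewrite addr0 mxE eqxx /=; case: (boolP (i \in codom f)) => [|_]; last first.
    by rewrite mul1r.
  case/codomP => u ->; rewrite mul0r /par_E EX !mxE (bigD1 u) //= Xfu eqxx mul1r.
  rewrite big1 => [|u' ne]; first by rewrite mxE addr0 eq_sym subrr.
  by rewrite Xfu eq_sym (negPf ne) mul0r.
have DE' : par_E' th *m D' = par_E' th.
  apply/matrixP => i j; rewrite mxE (bigD1 j) //= big1 => [|k ki]; last first.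
    by rewrite [D' _ _]mxE (negPf ki) mulr0.
  rewrite addr0 [D' _ _]mxE eqxx /=; case: (boolP (j \in codom g)) => [|_].
    2: by rewrite mulr1.
  case/codomP => u ->; rewrite mulr0 /par_E' EY !mxE (bigD1 u) //= Ygu eqxx mulr1.
  rewrite big1 => [|u' ne]; first by rewrite mxE addr0 subrr.
  by rewrite Ygu (negPf ne) mulr0.
have EL : par_L th = L.
  rewrite /par_L EL0 !mulmxA DE' -mulmxA DE /par_E /par_E' EX EY.
  by rewrite mulmxBl mul1mx -mulmxA YL mulmx0 subr0 mulmxBr mulmx1 mulmxA LX mul0mx subr0.
have Et l : l != lam -> par_t th l = t l.
  move=> ll; rewrite /par_t /th (negPf ll) eqxx andbT; rewrite ES inE.
  by case: eqP => [->|].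
have EA l : l != lam -> par_A th l = A l.
  move=> ll; apply/matrixP => i j; rewrite !mxE EP.
  case: ifP => [/andP [lS /eqP [-> ->]]|ne]; last first.
    by rewrite /th (negPf ll) ne.
  have tl : t l != 0 by move: lS; rewrite ES inE.
  have /eqP := tPA l; rewrite mulf_eq0 (negPf tl) /= (bigD1 (i0, j0)) //= PG Guv mul1r.
  rewrite addr_eq0 => /eqP ->; congr (- _); apply: eq_bigr => -[k1 k2] ne'.
  by rewrite /th (negPf ll) (negPf ne') andbF.
move=> [[i j] l]; rewrite /par /=; case: eqP => [->|/eqP ll]; last first.
  by rewrite EA // mxE.
rewrite EL /L (bigD1 lam) //= tlam scale1r.
rewrite [X in _ + X - _](eq_bigr (fun l => par_t th l *: par_A th l)).
  by rewrite addrK mxE.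
by move=> k kl; rewrite Et // EA.
Qed.

(** One parameter is frozen at [1]: the [N m n] coefficients are polynomials in
    [N m n - 1] indeterminates, hence dependent. The relation holds for points
    over any extension field [kappa]; this is what residue fields of prime
    ideals require. *)
Lemma par_dependent (K : fieldType) :
  exists2 delta : {mpoly K[#|{: Q}|]}, delta != 0 &
    forall (kappa : fieldType) (io : {rmorphism K -> kappa}) (a : Q -> K)
           (th : Q -> kappa), th pivot = 1 -> par th =1 io \o a ->
      meval (fun i => a (enum_val i)) delta = 0.
Proof.
pose Q' := {q : Q | q != pivot}.
have cardQ' : (#|{: Q'}| < #|{: Q}|)%N.
  have -> : #|{: Q'}| = #|predC1 pivot| by rewrite card_sig.
  by rewrite cardC1 prednK //; apply/card_gt0P; exists pivot.
pose thX (q : Q) : {mpoly K[#|{: Q'}|]} :=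
  if insub q is Some q' then 'X_(enum_rank (q' : Q')) else 1.
have [delta d0 dPhi] := algebraic_dependence (fun i => par thX (enum_val i)) cardQ'.
exists delta => // kappa io a th thp Ea.
pose ev : {rmorphism _ -> kappa} := mmap io (fun k : 'I_#|{: Q'}| => th (val (enum_val k))).
have evth q : ev (thX q) = th q.
  rewrite /thX; case: insubP => [q' _ <-|].
    by rewrite /ev /= mmapX mmap1U enum_rankK.
  by rewrite negbK => /eqP ->; rewrite rmorph1 thp.
have evpar q : ev (par thX q) = io (a q).
  rewrite -par_morph -[RHS]Ea; congr (par _ q); apply/funext => q' /=.
  exact: evth.
apply/eqP; rewrite -(fmorph_eq0 io); apply/eqP.
have := congr1 ev dPhi; rewrite rmorph0 => <-.
rewrite /mmap mevalE !rmorph_sum; apply: eq_bigr => mu _.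
rewrite !rmorphM /=; congr (_ * _); first by rewrite /ev /= mmapC.
rewrite /mmap1 !rmorph_prod; apply: eq_bigr => i _.
by rewrite !rmorphXn /= evpar.
Qed.
End Parametrization.

(** * The tangent module of a generic linear matrix *)

Section Tangent.
Variables (K : fieldType) (N m n : nat).
Local Notation Q := ('I_m * 'I_n * 'I_N)%type.
Local Notation B := {mpoly K[N]}.

Section FixedMatrix.
Variable a : Q -> K.

Definition coef_mx l : 'M[B]_(m, n) := \matrix_(i, j) (a (i, j, l))%:MP.
Definition linear_mx : 'M[B]_(m, n) := \sum_l 'X_l *: coef_mx l.
(** The tangent space to the orbit of [linear_mx] under row and column
    operations and rescalings of the coordinates. *)
Definition tangent (M : 'M[B]_(m, n)) :=
  exists (be : 'M[B]_m) (al : 'M[B]_n) (psi : 'I_N -> B),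
    M = be *m linear_mx + linear_mx *m al + \sum_l (psi l * 'X_l) *: coef_mx l.

Lemma tangentD M1 M2 : tangent M1 -> tangent M2 -> tangent (M1 + M2).
Proof.
move=> [be [al [psi ->]]] [be' [al' [psi' ->]]].
exists (be + be'), (al + al'), (fun l => psi l + psi' l).
rewrite mulmxDl mulmxDr.
under [X in _ = _ + X]eq_bigr do rewrite mulrDl scalerDl.
by rewrite big_split /= addrACA; congr (_ + _); rewrite addrACA.
Qed.

Lemma tangentZ f M : tangent M -> tangent (f *: M).
Proof.
move=> [be [al [psi ->]]]; exists (f *: be), (f *: al), (fun l => f * psi l).
rewrite !scalerDr -scalemxAl -scalemxAr scaler_sumr; congr (_ + _).
by apply: eq_bigr => l _; rewrite scalerA mulrA.
Qed.

Lemma tangent0 : tangent 0.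
Proof.
exists 0, 0, (fun=> 0); rewrite mul0mx mulmx0 !add0r big1 // => l _.
by rewrite mul0r scale0r.
Qed.

Lemma tangent_sum (I : finType) (F : I -> 'M[B]_(m, n)) :
  (forall i, tangent (F i)) -> tangent (\sum_i F i).
Proof. by move=> tF; elim/big_ind: _ => //; [exact: tangent0|exact: tangentD]. Qed.

Definition gens : finType := (('I_m * 'I_m) + ('I_n * 'I_n) + 'I_N)%type.
Definition gen (x : gens) : 'M[B]_(m, n) :=
  match x with
  | inl (inl (i', i)) => delta_mx i' i *m linear_mx
  | inl (inr (j, j')) => linear_mx *m delta_mx j j'
  | inr l => 'X_l *: coef_mx l
  end.

Lemma tangent_gen x : tangent (gen x).
Proof.
case: x => [[[i' i]|[j j']]|l] /=.
- exists (delta_mx i' i), 0, (fun=> 0).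
  by rewrite mulmx0 addr0 big1 ?addr0 // => l _; rewrite mul0r scale0r.
- exists 0, (delta_mx j j'), (fun=> 0).
  by rewrite mul0mx add0r big1 ?addr0 // => l _; rewrite mul0r scale0r.
- exists 0, 0, (fun k => (k == l)%:R).
  rewrite mul0mx mulmx0 !add0r (bigD1 l) //= eqxx mul1r big1 ?addr0 // => k kl.
  by rewrite (negPf kl) mul0r scale0r.
Qed.

Definition gens_mx : 'M[B]_(#|gens|, m * n) :=
  \matrix_(k < #|gens|) mxvec (gen (enum_val k)).

(** By Cramer's rule, a maximal minor of the generators times any matrix is a
    combination of the generators. *)
Lemma tangent_minor (h : 'I_(m * n) -> 'I_#|gens|) M :
  tangent (\det (rowsub h gens_mx) *: M).
Proof.
set A := rowsub h gens_mx; pose c := mxvec M *m \adj A.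
suff -> : \det A *: M = \sum_k c 0 k *: gen (enum_val (h k)).
  by apply: tangent_sum => k; apply/tangentZ/tangent_gen.
apply: (can_inj mxvecK); rewrite linearZ linear_sum /=.
under eq_bigr => k _ do rewrite linearZ /=.
have -> : \det A *: mxvec M = c *m A.
  by rewrite -mulmxA mul_adj_mx mul_mx_scalar.
rewrite mulmx_sum_row; apply: eq_bigr => k _; congr (_ *: _).
by rewrite row_rowsub rowK.
Qed.

Definition annihilator : set B := fun f => forall M, tangent (f *: M).

Lemma annihilator_ideal : is_ideal annihilator.
Proof.
split=> [M|f f' If If' M|b f If M]; first by rewrite scale0r; exact: tangent0.
  by rewrite scalerDl; apply: tangentD.
by rewrite -scalerA; apply: tangentZ.
Qed.

End FixedMatrix.

Lemma sum_mxvec (F : fieldType) (u v : 'rV[F]_(m * n)) :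
  \sum_k u 0 k * v 0 k = \sum_i \sum_j vec_mx u i j * vec_mx v i j.
Proof.
rewrite pair_bigA /= (reindex _ (curry_mxvec_bij _ _)) /=.
by apply: eq_bigr => -[i j] _ /=; rewrite !mxE.
Qed.

(** The polynomial [delta] is the product of the relations of [par_dependent]
    over all the discrete data: the coordinate [lam], the support of [t], the
    rank of [P] and the positions of its pivots. *)
Lemma generic_annihilator : exists2 delta : {mpoly K[#|{: Q}|]}, delta != 0 &
  forall a : Q -> K, meval (fun i => a (enum_val i)) delta != 0 ->
  exists k, forall lam, annihilator a ('X_lam ^+ k).
Proof.
pose D (lam : 'I_N) (S : {set 'I_N}) (p : 'I_n.+1) f g u0 v0 :=
  projT1 (cid2 (@par_dependent N m n p f g u0 v0 S lam K)).
have D0 lam S p f g u0 v0 : @D lam S p f g u0 v0 != 0 by rewrite /D; case: cid2.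
exists (\prod_lam \prod_S \prod_(p < n.+1) \prod_f \prod_g \prod_u0 \prod_v0
  @D lam S p f g u0 v0).
  by do 7!(apply/prodf_neq0 => ? _).
move=> a; rewrite !rmorph_prod => /prodf_neq0 dlam.
suff /choice [k Ik] : forall lam, exists k, annihilator a ('X_lam ^+ k).
  exists (\sum_lam k lam)%N => lam M.
  by rewrite (bigD1 lam) //= exprD -scalerA; exact: Ik.
move=> lam; apply: contrapT => /forallNP noI.
have {dlam} := dlam lam isT; rewrite rmorph_prod => /prodf_neq0 dlam.
have [kappa [ev [evI evlam]]] :=
  residue_field_avoiding_powers (@annihilator_ideal a) noI.
(* t is a point, over kappa, where the generators do not span all matrices *)
pose io : {rmorphism K -> kappa} := ev \o @mpolyC N K.
pose t l := ev 'X_l.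
have evc l i j : ev (coef_mx a l i j) = io (a (i, j, l)) by rewrite mxE.
pose Gk := map_mx ev (gens_mx a).
have Gnf : ~~ row_full Gk.
  apply/negP => Gf; pose h := fullrankfun Gf.
  have /evI : annihilator a (\det (rowsub h (gens_mx a))).
    by move=> M; exact: tangent_minor.
  rewrite -det_map_mx map_mxsub; apply/eqP; rewrite -unitfE -unitmxE.
  by rewrite -row_full_unit; exact: fullrowsub_full.
(* P is a linear form that vanishes on the generators at t *)
have : kermx Gk^T != 0.
  by rewrite kermx_eq0 /row_free mxrank_tr.
case/rowV0Pn => w /sub_kermxP wG w0.
pose W := vec_mx w; pose P := W^T.
have P0 : P != 0 by rewrite /P trmx_eq0 /W vec_mx_eq0.
have gen0 x : \sum_i \sum_j P j i * ev (gen a x i j) = 0.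
  have /rowP /(_ (enum_rank x)) := wG.
  rewrite !mxE => E; rewrite -[RHS]E.
  transitivity (\sum_k w 0 k * (map_mx ev (mxvec (gen a x))) 0 k).
    rewrite sum_mxvec; apply: eq_bigr => i _; apply: eq_bigr => j _.
    by rewrite -map_vec_mx mxvecK [P j i]mxE; congr (_ * _); rewrite [RHS]mxE.
  by apply: eq_bigr => k _; rewrite !mxE enum_rankK.
pose A l : 'M[kappa]_(m, n) := \matrix_(i, j) io (a (i, j, l)).
pose L := \sum_l t l *: A l.
have evL i j : ev (linear_mx a i j) = L i j.
  rewrite !summxE rmorph_sum; apply: eq_bigr => l _.
  by rewrite [RHS]mxE [A l i j]mxE -evc -rmorphM [in LHS]mxE.
have LP : L *m P = 0.
  apply/matrixP => i i'; rewrite [RHS]mxE -[RHS](gen0 (inl (inl (i', i)))) /= mxE.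
  rewrite [RHS](bigD1 i') //= [X in _ + X]big1 ?addr0 => [|x xi].
    apply: eq_bigr => j _; rewrite mulrC; congr (_ * _).
    rewrite mxE (bigD1 i) //= mxE !eqxx mul1r big1 ?addr0 ?evL // => y yi.
    by rewrite mxE (negPf yi) andbF mul0r.
  rewrite big1 // => j _; rewrite [X in _ * ev X]mxE big1 ?rmorph0 ?mulr0 // => y _.
  by rewrite mxE (negPf xi) mul0r.
have PL : P *m L = 0.
  apply/matrixP => j' j; rewrite [RHS]mxE -[RHS](gen0 (inl (inr (j, j')))) /= mxE.
  apply: eq_bigr => i _.
  rewrite [RHS](bigD1 j') //= [X in _ + X]big1 ?addr0 => [|x xi].
    congr (_ * _); rewrite mxE (bigD1 j) //= mxE !eqxx mulr1 big1 ?addr0 ?evL // => y yi.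
    by rewrite mxE (negPf yi) mulr0.
  rewrite [X in _ * ev X]mxE big1 ?rmorph0 ?mulr0 // => y _.
  by rewrite [delta_mx _ _ _ _]mxE (negPf xi) andbF mulr0.
have tPA l : t l * \sum_i \sum_j P j i * io (a (i, j, l)) = 0.
  rewrite -[RHS](gen0 (inr l)) mulr_sumr; apply: eq_bigr => i _.
  rewrite mulr_sumr; apply: eq_bigr => j _.
  by rewrite mulrCA; congr (_ * _); rewrite mxE rmorphM evc.
have [p [f [g [X [G [Y [pn [finj ginj] EP [Xf Yg] Gu]]]]]]] := rank_factorization P.
have LX : L *m X = 0.
  have : L *m X *m G = 0.
    have := congr1 (mulmx L) EP; rewrite LP !mulmxA => /(congr1 (colsub g)).
    rewrite -mulmx_colsub Yg mulmx1 => <-.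
    by apply/matrixP => x y; rewrite !mxE.
  by move/(congr1 (mulmx^~ (invmx G))); rewrite mulmxK // mul0mx.
have YL : Y *m L = 0.
  have : G *m (Y *m L) = 0.
    have := congr1 (mulmx^~ L) EP; rewrite PL -!mulmxA => /(congr1 (rowsub f)).
    rewrite -mul_rowsub_mx Xf mul1mx => <-.
    by apply/matrixP => x y; rewrite !mxE.
  by move/(congr1 (mulmx (invmx G))); rewrite mulKmx // mulmx0.
have [u0 [v0 Guv]] : exists u0 v0, G u0 v0 != 0.
  apply: contrapT => nG; case/eqP: P0; rewrite EP.
  suff -> : G = 0 by rewrite mulmx0 mul0mx.
  apply/matrixP => u v; rewrite mxE; apply/eqP; apply: contrapT => /negP Guv.
  by apply: nG; exists u, v.
(* t and P only matter up to scalars: normalize t lam and G u0 v0 to 1 *)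
pose c := (G u0 v0)^-1; pose t' l := t l / t lam; pose S := [set l | t' l != 0].
have L' : \sum_l t' l *: A l = (t lam)^-1 *: L.
  by rewrite scaler_sumr; apply: eq_bigr => l _; rewrite scalerA mulrC.
have tl0 : t lam != 0 by [].
have [||||||th thp Eth] := @par_surj N m n p f g u0 v0 S lam kappa (io \o a) t'
  X (c *: G) Y finj ginj Xf Yg.
- by rewrite L' -scalemxAl LX scaler0.
- by rewrite L' -scalemxAr YL scaler0.
- by rewrite mxE mulVf.
- by rewrite /t' divff.
- by [].
- move=> l; rewrite -scalemxAr -scalemxAl -EP /t'.
  rewrite (_ : \sum_k _ = c * \sum_i \sum_j P j i * io (a (i, j, l))).
    by rewrite [c * _]mulrC mulrACA tPA mul0r.
  rewrite pair_bigA mulr_sumr; apply: eq_bigr => -[k1 k2] _ /=.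
  by rewrite mxE mulrA.
move: (dlam S isT); rewrite rmorph_prod => /prodf_neq0 /(_ (@Ordinal n.+1 p pn) isT).
rewrite rmorph_prod => /prodf_neq0 /(_ f isT).
rewrite rmorph_prod => /prodf_neq0 /(_ g isT).
rewrite rmorph_prod => /prodf_neq0 /(_ u0 isT).
rewrite rmorph_prod => /prodf_neq0 /(_ v0 isT) /=.
rewrite /D; case: cid2 => d _ dE /=; rewrite (dE kappa io a th thp) ?eqxx //.
Qed.
End Tangent.
End GenericTangent.

From mathcomp Require Import lra.
From mathcomp Require Import all_classical all_reals all_analysis.
Import (canonicals, coercions) mpoly.
Import Order.TTheory GRing.Theory Num.Theory.
Import numFieldNormedType.Exports.
Local Open Scope classical_set_scope.
Local Open Scope ring_scope.

(** * Uniform limits of polynomials on polydiscs *)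

Section ComplexNorm.
Variable R : realType.
Local Notation C := R[i].

(** The modulus with values in [R], where [`|z|] is a complex number. *)
Definition nc (z : C) : R := Num.sqrt (complex.Re z ^+ 2 + complex.Im z ^+ 2).

Lemma normC_nc (z : C) : `|z| = (nc z)%:C%C. Proof. exact: normc_def. Qed.
Lemma leC (x y : R) : (x%:C%C <= y%:C%C :> C) = (x <= y).
Proof. by rewrite lecE /= eqxx. Qed.
Lemma ltC (x y : R) : (x%:C%C < y%:C%C :> C) = (x < y).
Proof. by rewrite ltcE /= eqxx. Qed.
Lemma nc_ge0 z : 0 <= nc z. Proof. exact: sqrtr_ge0. Qed.
Lemma ncM x y : nc (x * y) = nc x * nc y.
Proof. by apply: complexI; rewrite rmorphM /= -!normC_nc normrM. Qed.
Lemma ncD x y : nc (x + y) <= nc x + nc y.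
Proof. by rewrite -leC rmorphD /= -!normC_nc ler_normD. Qed.
Lemma ncN x : nc (- x) = nc x.
Proof. by apply: complexI; rewrite -!normC_nc normrN. Qed.
Lemma ncB x y : nc (x - y) = nc (y - x).
Proof. by rewrite -ncN opprB. Qed.
Lemma nc0 : nc 0 = 0. Proof. by apply: complexI; rewrite -normC_nc normr0. Qed.
Lemma nc1 : nc 1 = 1. Proof. by apply: complexI; rewrite -normC_nc normr1. Qed.
Lemma ncR (x : R) : 0 <= x -> nc (x%:C%C) = x.
Proof. by move=> x0; rewrite /nc /= expr0n addr0 sqrtr_sqr ger0_norm. Qed.
Lemma nc_eq0 x : nc x = 0 -> x = 0.
Proof. by move=> E; apply/eqP; rewrite -normr_eq0 normC_nc E. Qed.
Lemma ncX x k : nc (x ^+ k) = nc x ^+ k.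
Proof. by elim: k => [|k IH]; rewrite ?expr0 ?nc1 // !exprS ncM IH. Qed.
Lemma nc_sum (I : Type) (r : seq I) (P : pred I) F :
  nc (\sum_(i <- r | P i) F i) <= \sum_(i <- r | P i) nc (F i).
Proof.
elim/big_rec2: _ => [|i y x _ IH]; first by rewrite nc0.
by apply: le_trans (ncD _ _) _; rewrite lerD2l.
Qed.
Lemma nc_prod (I : Type) (r : seq I) (P : pred I) F :
  nc (\prod_(i <- r | P i) F i) = \prod_(i <- r | P i) nc (F i).
Proof. by elim/big_rec2: _ => [|i y x _ IH]; rewrite ?nc1 // ncM IH. Qed.
Lemma nc_dist x y z : nc (x - z) <= nc (x - y) + nc (y - z).
Proof. by have := ncD (x - y) (y - z); rewrite addrA subrK. Qed.
Lemma nc_Re x : `|complex.Re x| <= nc x.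
Proof. by rewrite /nc -sqrtr_sqr ler_wsqrtr // lerDl sqr_ge0. Qed.
Lemma nc_Im x : `|complex.Im x| <= nc x.
Proof. by rewrite /nc -sqrtr_sqr ler_wsqrtr // lerDr sqr_ge0. Qed.
Lemma nc_ReIm x : nc x <= `|complex.Re x| + `|complex.Im x|.
Proof.
rewrite -ler_sqr ?nnegrE ?addr_ge0 ?nc_ge0 // /nc sqr_sqrtr ?addr_ge0 ?sqr_ge0 //.
rewrite -(real_normK (num_real (complex.Re x))) -(real_normK (num_real (complex.Im x))).
have := normr_ge0 (complex.Re x); have := normr_ge0 (complex.Im x); nra.
Qed.
Lemma nc_small_eq x y : (forall e : R, 0 < e -> nc (x - y) <= e) -> x = y.
Proof.
move=> H; apply/eqP; rewrite -subr_eq0; apply/eqP; apply: nc_eq0; apply/eqP.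
rewrite eq_le nc_ge0 andbT leNgt; apply/negP => xy.
by have := H (nc (x - y) / 2); lra.
Qed.

(** The bound [b] need not tend to [0]: a common point of the nested intervals
    around the [v n] is a limit with the same error bounds. *)
Lemma real_Cauchy_limit (v b : nat -> R) :
  (forall n m, (n <= m)%N -> `|v n - v m| <= b n) ->
  exists l, forall n, `|v n - l| <= b n.
Proof.
move=> vb.
have b0 n : 0 <= b n by apply: le_trans (vb n n (leqnn n)).
have le n m : v n - b n <= v m + b m.
  have := b0 n; have := b0 m; case: (leqP n m) => [/vb|/ltnW /vb];
  rewrite ler_norml => /andP []; lra.
pose S : set R := range (fun n => v n - b n).
have S0 : S (v 0%N - b 0%N) by exists 0%N.
have ubS m : ubound S (v m + b m) by move=> _ [n _ <-].
exists (sup S) => n; rewrite ler_norml.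
have h1 : v n - b n <= sup S.
  by apply: (@ub_le_sup _ S); [exists (v 0%N + b 0%N)|exists n].
have h2 : sup S <= v n + b n by apply: ge_sup; [exists (v 0%N - b 0%N)|].
by apply/andP; split; lra.
Qed.

Lemma complex_Cauchy_limit (u : nat -> C) (b : nat -> R) :
  (forall n m, (n <= m)%N -> nc (u n - u m) <= b n) ->
  exists l, forall n, nc (u n - l) <= 2 * b n.
Proof.
move=> ub.
have [|lr hr] := @real_Cauchy_limit (fun n => complex.Re (u n)) b.
  move=> n m nm; apply: le_trans (ub n m nm); rewrite -[_ - _]/(_ + _).
  have -> : complex.Re (u n) + - complex.Re (u m) = complex.Re (u n - u m).
    by case: (u n) (u m) => [x y] [z t].
  exact: nc_Re.
have [|li hi] := @real_Cauchy_limit (fun n => complex.Im (u n)) b.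
  move=> n m nm; apply: le_trans (ub n m nm).
  have -> : complex.Im (u n) - complex.Im (u m) = complex.Im (u n - u m).
    by case: (u n) (u m) => [x y] [z t].
  exact: nc_Im.
exists (Complex lr li) => n; apply: le_trans (nc_ReIm _) _.
have -> : complex.Re (u n - Complex lr li) = complex.Re (u n) - lr by case: (u n).
have -> : complex.Im (u n - Complex lr li) = complex.Im (u n) - li by case: (u n).
by have := hr n; have := hi n; lra.
Qed.

Lemma pow_half_small (c e : R) : 0 < e -> exists n, c * 2^-1 ^+ n <= e.
Proof.
move=> e0; pose n := Num.bound (`|c| / e); exists n.
have := @archi_boundP R (`|c| / e) (divr_ge0 (normr_ge0 _) (ltW e0)).
rewrite -/n ltr_pdivrMr // => cn.
rewrite exprVn ler_pdivrMr ?exprn_gt0 //; apply: le_trans (ler_norm c) _.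
apply: le_trans (ltW cn) _; rewrite mulrC ler_wpM2l ?(ltW e0) // -natrX ler_nat.
by rewrite ltnW // ltn_expl.
Qed.

End ComplexNorm.

Section PolynomialFunctions.
Variable R : realType.
Local Notation C := R[i].

Section OneType.
Variable J : Type.

(** Polynomial functions of arbitrarily many variables, given by their closure
    properties, so that bounds are proved by induction. *)
Inductive polyfun : ((J -> C) -> C) -> Prop :=
| polyfun_const c : polyfun (fun=> c)
| polyfun_var j : polyfun (fun v => v j)
| polyfunD f g : polyfun f -> polyfun g -> polyfun (fun v => f v + g v)
| polyfunM f g : polyfun f -> polyfun g -> polyfun (fun v => f v * g v).

Lemma polyfunN f : polyfun f -> polyfun (fun v => - f v).
Proof.
move=> pf; have -> : (fun v => - f v) = (fun v => -1 * f v).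
  by apply/funext => v; rewrite mulN1r.
by apply: polyfunM => //; exact: polyfun_const.
Qed.
Lemma polyfun_sum (I : Type) (r : seq I) (P : pred I) F :
  (forall i, polyfun (F i)) -> polyfun (fun v => \sum_(i <- r | P i) F i v).
Proof.
move=> pF; elim: r => [|i r IH].
  have -> : (fun v => \sum_(i <- [::] | P i) F i v) = (fun=> 0).
    by apply/funext => v; rewrite big_nil.
  exact: polyfun_const.
have -> : (fun v => \sum_(j <- i :: r | P j) F j v) =
   (fun v => (if P i then F i v else 0) + \sum_(j <- r | P j) F j v).
  by apply/funext => v; rewrite big_cons; case: (P i); rewrite ?add0r.
by apply: polyfunD => //; case: (P i) => //; exact: polyfun_const.
Qed.
Lemma polyfun_prod (I : Type) (r : seq I) (P : pred I) F :
  (forall i, polyfun (F i)) -> polyfun (fun v => \prod_(i <- r | P i) F i v).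
Proof.
move=> pF; elim: r => [|i r IH].
  have -> : (fun v => \prod_(i <- [::] | P i) F i v) = (fun=> 1).
    by apply/funext => v; rewrite big_nil.
  exact: polyfun_const.
have -> : (fun v => \prod_(j <- i :: r | P j) F j v) =
   (fun v => (if P i then F i v else 1) * \prod_(j <- r | P j) F j v).
  by apply/funext => v; rewrite big_cons; case: (P i); rewrite ?mul1r.
by apply: polyfunM => //; case: (P i) => //; exact: polyfun_const.
Qed.
Lemma polyfunX f k : polyfun f -> polyfun (fun v => f v ^+ k).
Proof.
move=> pf; elim: k => [|k IH].
  by under eq_fun do rewrite expr0; exact: polyfun_const.
by under eq_fun do rewrite exprS; exact: polyfunM.
Qed.

Definition polydisc (r : R) : set (J -> C) := [set x | forall j, nc (x j) <= r].

Lemma polyfun_bounded f r : polyfun f ->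
  exists2 M, 0 <= M & forall x, polydisc r x -> nc (f x) <= M.
Proof.
elim=> [c|j|{}f g _ [M M0 HM] _ [M' M'0 HM']|{}f g _ [M M0 HM] _ [M' M'0 HM']].
- by exists (nc c); rewrite ?nc_ge0.
- by exists `|r| => // x xr; apply: le_trans (xr j) (ler_norm _).
- exists (M + M'); rewrite ?addr_ge0 // => x xr; apply: le_trans (ncD _ _) _.
  by apply: lerD; [apply: HM|apply: HM'].
- exists (M * M'); rewrite ?mulr_ge0 // => x xr; rewrite ncM.
  by apply: ler_pM; rewrite ?nc_ge0 //; [apply: HM|apply: HM'].
Qed.

Lemma polyfun_lipschitz f r : polyfun f ->
  exists2 M, 0 <= M & forall x y d, polydisc r x -> polydisc r y -> 0 <= d ->
    (forall j, nc (x j - y j) <= d) -> nc (f x - f y) <= M * d.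
Proof.
elim=> [c|j|{}f g _ [M M0 HM] _ [M' M'0 HM']|{}f g pf [M M0 HM] pg [M' M'0 HM']].
- by exists 0 => // x y d _ _ _ _; rewrite subrr nc0 mul0r.
- by exists 1 => // x y d _ _ _ H; rewrite mul1r.
- exists (M + M'); rewrite ?addr_ge0 // => x y d xr yr d0 H.
  rewrite opprD addrACA mulrDl; apply: le_trans (ncD _ _) _.
  by apply: lerD; [apply: HM|apply: HM'].
- have [B B0 HB] := polyfun_bounded r pf; have [B' B'0 HB'] := polyfun_bounded r pg.
  exists (B * M' + B' * M); rewrite ?addr_ge0 ?mulr_ge0 // => x y d xr yr d0 H.
  have -> : f x * g x - f y * g y = f x * (g x - g y) + g y * (f x - f y) by ring.
  rewrite mulrDl; apply: le_trans (ncD _ _) _; rewrite !ncM -!mulrA.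
  apply: lerD; apply: ler_pM; rewrite ?nc_ge0 //;
    [exact: HB|exact: HM'|exact: HB'|exact: HM].
Qed.

End OneType.

Lemma polyfun_comp (J J' : Type) (f : (J' -> C) -> C) (h : J' -> (J -> C) -> C) :
  polyfun f -> (forall j, polyfun (h j)) -> polyfun (fun v => f (fun j => h j v)).
Proof.
move=> + ph; elim=> [c|j|{}f g _ IHf _ IHg|{}f g _ IHf _ IHg].
- exact: polyfun_const.
- exact: ph.
- exact: (polyfunD IHf IHg).
- exact: (polyfunM IHf IHg).
Qed.

End PolynomialFunctions.

Section UniformLimits.
Variable R : realType.
Local Notation C := R[i].
Variable J : Type.
Implicit Types (rho : R) (f g : (J -> C) -> C).

(** Functions holomorphic near the closed polydisc have this property, and it
    implies holomorphy inside; being defined without derivatives, it passes at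
    once to products, limits and compositions. *)
Definition ulim rho f := forall e : R, 0 < e ->
  exists2 P : (J -> C) -> C, polyfun P &
    forall x, polydisc rho x -> nc (f x - P x) <= e.

Lemma ulim_poly rho f : polyfun f -> ulim rho f.
Proof. by move=> pf e e0; exists f => // x _; rewrite subrr nc0 ltW. Qed.

Lemma ulim_lim rho f : (forall e : R, 0 < e -> exists2 g, ulim rho g &
   forall x, polydisc rho x -> nc (f x - g x) <= e) -> ulim rho f.
Proof.
move=> H e e0; have e2 : 0 < e / 2 by lra.
have [g ug Hg] := H _ e2; have [P pP HP] := ug _ e2.
exists P => // x xr; have := nc_dist (f x) (g x) (P x).
by have := Hg x xr; have := HP x xr; lra.
Qed.

Lemma ulim_ext rho f g : (forall x, polydisc rho x -> f x = g x) ->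
  ulim rho f -> ulim rho g.
Proof.
move=> E uf e /uf [P pP HP]; exists P => // x xr.
by rewrite -E //; exact: HP.
Qed.

Lemma ulim_mono rho rho' f : rho' <= rho -> ulim rho f -> ulim rho' f.
Proof.
move=> le uf e /uf [P pP HP]; exists P => // x xr; apply: HP => j.
exact: le_trans (xr j) le.
Qed.

Lemma ulim_bounded rho f : ulim rho f ->
  exists2 M, 0 <= M & forall x, polydisc rho x -> nc (f x) <= M.
Proof.
move=> /(_ 1 ltr01) [P pP HP]; have [M M0 HM] := polyfun_bounded rho pP.
exists (M + 1) => [|x xr]; first by lra.
have := ncD (f x - P x) (P x); rewrite subrK.
by have := HM x xr; have := HP x xr; lra.
Qed.

Lemma ulimD rho f g : ulim rho f -> ulim rho g -> ulim rho (fun x => f x + g x).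
Proof.
move=> uf ug e e0; have e2 : 0 < e / 2 by lra.
have [P pP HP] := uf _ e2; have [P' pP' HP'] := ug _ e2.
exists (fun x => P x + P' x) => [|x xr]; first exact: polyfunD.
rewrite opprD addrACA; apply: le_trans (ncD _ _) _.
by have := HP x xr; have := HP' x xr; lra.
Qed.

Lemma ulimM rho f g : ulim rho f -> ulim rho g -> ulim rho (fun x => f x * g x).
Proof.
move=> uf ug e e0.
have [M M0 HM] := ulim_bounded uf; have [M' M'0 HM'] := ulim_bounded ug.
pose d := Num.min 1 (e / (M + M' + 1)).
have d0 : 0 < d by rewrite lt_min ltr01 divr_gt0 //; lra.
have d1 : d <= 1 by rewrite ge_min lexx.
have dM : d * (M + M' + 1) <= e.
  by rewrite -ler_pdivlMr ?ge_min ?lexx ?orbT //; lra.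
have [P pP HP] := uf _ d0; have [P' pP' HP'] := ug _ d0.
exists (fun x => P x * P' x) => [|x xr]; first exact: polyfunM.
have -> : f x * g x - P x * P' x =
  f x * (g x - P' x) + (g x * (f x - P x) + - ((g x - P' x) * (f x - P x))) by ring.
have := ncD (f x * (g x - P' x)) (g x * (f x - P x) + - ((g x - P' x) * (f x - P x))).
have := ncD (g x * (f x - P x)) (- ((g x - P' x) * (f x - P x))).
rewrite ncN !ncM.
have := HM x xr; have := HM' x xr; have := HP x xr; have := HP' x xr.
have := nc_ge0 (f x); have := nc_ge0 (g x).
have := nc_ge0 (f x - P x); have := nc_ge0 (g x - P' x).
move: (nc (f x)) (nc (g x)) (nc (f x - P x)) (nc (g x - P' x)).
move=> F G A B A0 B0 F0 G0 Bd Ad GM FM h1 h2.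
have : F * B <= M * d by apply: ler_pM.
have : G * A <= M' * d by apply: ler_pM.
have : B * A <= d * 1 by apply: ler_pM => //; apply: le_trans Ad d1.
by lra.
Qed.

Lemma ulim_const rho c : ulim rho (fun=> c).
Proof. exact/ulim_poly/polyfun_const. Qed.
Lemma ulim_var rho j : ulim rho (fun x => x j).
Proof. exact/ulim_poly/polyfun_var. Qed.
Lemma ulimN rho f : ulim rho f -> ulim rho (fun x => - f x).
Proof.
move=> uf e /uf [P pP HP]; exists (fun x => - P x) => [|x /HP]; first exact: polyfunN.
by rewrite -opprD ncN.
Qed.
Lemma ulimB rho f g : ulim rho f -> ulim rho g -> ulim rho (fun x => f x - g x).
Proof. by move=> uf ug; apply: ulimD => //; apply: ulimN. Qed.

End UniformLimits.

Section UniformComposition.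
Variable R : realType.
Local Notation C := R[i].

Lemma ulim_poly_comp (J J' : Type) rho (f : (J' -> C) -> C) (h : J' -> (J -> C) -> C) :
  polyfun f -> (forall j, ulim rho (h j)) -> ulim rho (fun x => f (fun j => h j x)).
Proof.
move=> + uh; elim=> [c|j|{}f g _ IHf _ IHg|{}f g _ IHf _ IHg].
- exact: ulim_const.
- exact: uh.
- exact: (ulimD IHf IHg).
- exact: (ulimM IHf IHg).
Qed.

(** Approximate [f] by a polynomial, to which [ulim_poly_comp] applies. *)
Lemma ulim_comp (J J' : Type) rho sigma (f : (J' -> C) -> C) (h : J' -> (J -> C) -> C) :
  ulim sigma f -> (forall j, ulim rho (h j)) ->
  (forall x, polydisc rho x -> polydisc sigma (fun j => h j x)) ->
  ulim rho (fun x => f (fun j => h j x)).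
Proof.
move=> uf uh hr; apply: ulim_lim => e /uf [P pP HP].
exists (fun x => P (fun j => h j x)) => [|x xr]; first exact: ulim_poly_comp.
by apply: HP; apply: hr.
Qed.

Lemma ulim_sum (J : Type) rho (I : Type) (r : seq I) (P : pred I)
    (F : I -> (J -> C) -> C) :
  (forall i, ulim rho (F i)) -> ulim rho (fun v => \sum_(i <- r | P i) F i v).
Proof.
move=> uF; apply: (@ulim_poly_comp J I rho (fun w => \sum_(i <- r | P i) w i) F) => //.
by apply: polyfun_sum => i; exact: polyfun_var.
Qed.

(** Picard iteration depending on the parameter [x]: the iterates belong to
    [ulim rho] and converge uniformly at the rate [2^-n], so that their limit
    belongs to it too. *)
Theorem contraction_fixpoint (J M : Type) (rho sigma : R)
    (Phi : M -> (J -> C) -> (M -> C) -> C) :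
    0 <= sigma ->
    (forall x, polydisc rho x -> forall k, nc (Phi k x (fun=> 0)) <= sigma / 2) ->
    (forall x v w d, polydisc rho x -> polydisc sigma v -> polydisc sigma w ->
       0 <= d -> (forall k, nc (v k - w k) <= d) ->
       forall k, nc (Phi k x v - Phi k x w) <= d / 2) ->
    (forall u : M -> (J -> C) -> C, (forall k, ulim rho (u k)) ->
       (forall x, polydisc rho x -> polydisc sigma (fun k => u k x)) ->
       forall k, ulim rho (fun x => Phi k x (fun k' => u k' x))) ->
  exists u : M -> (J -> C) -> C,
    [/\ forall k, ulim rho (u k),
        forall x, polydisc rho x -> polydisc sigma (fun k => u k x) &
        forall x, polydisc rho x -> forall k, u k x = Phi k x (fun k' => u k' x)].
Proof.
move=> s0 H0 Hlip Hu.
pose u := fix u n : M -> (J -> C) -> C :=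
  if n is n'.+1 then fun k x => Phi k x (fun k' => u n' k' x) else fun _ _ => 0.
have zs : polydisc sigma (fun _ : M => 0 : C) by move=> k; rewrite nc0.
have us n x : polydisc rho x -> polydisc sigma (fun k => u n k x).
  move=> xr; elim: n => [|n IH] //= k.
  have := Hlip x _ _ sigma xr IH zs s0 _ k.
  have := H0 x xr k; set A := Phi k x (fun=> 0) => HA.
  set B := Phi k x _ => HB.
  have {}HB : nc (B - A) <= sigma / 2 by apply: HB => k'; rewrite subr0; exact: IH.
  by have := ncD (B - A) A; rewrite subrK; lra.
have uu n k : ulim rho (u n k).
  elim: n k => [|n IH] k /=; first exact: ulim_const.
  by apply: Hu => // x xr; exact: us.
have u1 n x : polydisc rho x -> forall k,
    nc (u n.+1 k x - u n k x) <= sigma * 2^-1 ^+ n.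
  move=> xr; elim: n => [|n IH] k.
    by rewrite subr0 mulr1; apply: us 1%N x xr k.
  have d0 : 0 <= sigma * 2^-1 ^+ n by rewrite mulr_ge0 // exprn_ge0.
  have := Hlip x _ _ _ xr (us n.+1 x xr) (us n x xr) d0 IH k.
  by rewrite exprS /=; lra.
have um n d x : polydisc rho x -> forall k,
    nc (u n k x - u (n + d)%N k x) <= 2 * sigma * (2^-1 ^+ n - 2^-1 ^+ (n + d)).
  move=> xr k; elim: d => [|d IH]; first by rewrite addn0 !subrr nc0 mulr0.
  rewrite addnS; have := u1 (n + d)%N x xr k; rewrite ncB => h1.
  have := nc_dist (u n k x) (u (n + d)%N k x) (u (n + d).+1 k x).
  by rewrite exprS; lra.
have lim k x : exists l, polydisc rho x ->
    forall n, nc (u n k x - l) <= 4 * sigma * 2^-1 ^+ n.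
  have [xr|nx] := pselect (polydisc rho x); last by exists 0.
  have [n m nm|l hl] := @complex_Cauchy_limit R (fun n => u n k x)
    (fun n => 2 * sigma * 2^-1 ^+ n).
    have := um n (m - n)%N x xr k; rewrite subnKC // => h.
    apply: le_trans h _; have : 0 <= 2^-1 ^+ m :> R by rewrite exprn_ge0.
    have := s0; nra.
  by exists l => _ n; have := hl n; lra.
have /choice [l hl] : forall kx : M * (J -> C), exists l, polydisc rho kx.2 ->
    forall n, nc (u n kx.1 kx.2 - l) <= 4 * sigma * 2^-1 ^+ n.
  by move=> [k x]; exact: lim.
have {}hl k x : polydisc rho x -> forall n,
  nc (u n k x - l (k, x)) <= 4 * sigma * 2^-1 ^+ n by move=> xr; exact: hl (k, x) xr.
have lsig x : polydisc rho x -> polydisc sigma (fun k => l (k, x)).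
  move=> xr k; rewrite leNgt; apply/negP => gt.
  have [|n hn] := @pow_half_small R (4 * sigma) ((nc (l (k, x)) - sigma) / 2).
    by lra.
  have := hl k x xr n; have := us n x xr k; have := ncD (l (k, x) - u n k x) (u n k x).
  by rewrite subrK (ncB (l _)); lra.
exists (fun k x => l (k, x)); split=> //.
  move=> k; apply: ulim_lim => e e0.
  have [n hn] := @pow_half_small R (4 * sigma) e e0.
  by exists (u n k) => // x xr; rewrite ncB; exact: le_trans (hl k x xr n) hn.
move=> x xr k; apply: nc_small_eq => e e0.
have [n hn] := @pow_half_small R (4 * sigma) (e / 2) (divr_gt0 e0 (ltr0n _ 2)).
have d0 : 0 <= 4 * sigma * 2^-1 ^+ n by rewrite !mulr_ge0 // exprn_ge0.
have h1 := Hlip x _ _ _ xr (us n x xr) (lsig x xr) d0 (fun k => hl k x xr n) k.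
have h2 := hl k x xr n.+1; rewrite exprS /= in h2.
have := nc_dist (l (k, x)) (u n.+1 k x) (Phi k x (fun k' => l (k', x))).
by rewrite (ncB (l (k, x)) (u n.+1 k x)) /=; lra.
Qed.

End UniformComposition.

(** * Cauchy estimates for polynomials *)

Section Cauchy.
Variable R : realType.
Local Notation C := R[i].
Variable N : nat.
Implicit Types (p : mpoly.mpoly N C) (rho : R).

Lemma polyfun_mpoly (P : ('I_N -> C) -> C) : polyfun P ->
  exists p : mpoly.mpoly N C, forall x, P x = mpoly.meval x p.
Proof.
elim=> [c|j|f g _ [p Ep] _ [q Eq]|f g _ [p Ep] _ [q Eq]].
- by exists (mpoly.mpolyC N c) => x; rewrite mpoly.mevalC.
- by exists (mpoly.mpolyX C (mpoly.mnm1 j)) => x; rewrite mpoly.mevalXU.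
- by exists (p + q) => x; rewrite rmorphD /= Ep Eq.
- by exists (p * q) => x; rewrite rmorphM /= Ep Eq.
Qed.

Lemma polyfun_mmap1 (m : mpoly.multinom N) : polyfun (fun x : 'I_N -> C => mpoly.mmap1 x m).
Proof. by apply: polyfun_prod => i; apply/polyfunX/polyfun_var. Qed.

Lemma polyfun_meval p : polyfun (fun x : 'I_N -> C => mpoly.meval x p).
Proof.
apply: polyfun_sum => m; apply: polyfunM; first exact: polyfun_const.
exact: polyfun_mmap1.
Qed.

(** The number [w] is a root of unity of order [2 ^ s.+1] exactly, and [w ^+ d]
    is another root than [1]. Roots of two-power order are convenient as [w ^+
    (2 ^ s) = -1] characterizes the primitive ones. *)
Lemma sum_unity_roots s (w : C) : w ^+ (2 ^ s) = -1 ->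
  forall d, (0 < d < 2 ^ s.+1)%N -> \sum_(k < 2 ^ s.+1) (w ^+ d) ^+ k = 0.
Proof.
move=> ws d /andP [d0 dlt].
have [//|m /= co_m dE] := @pfactor_coprime 2 d isT.
have es : (logn 2 d <= s)%N.
  rewrite -ltnS -(ltn_exp2l _ _ (isT : (1 < 2)%N)); apply: leq_ltn_trans dlt.
  by apply: dvdn_leq => //; rewrite {2}dE dvdn_mull.
have wd1 : w ^+ d != 1.
  apply/eqP => /(congr1 (fun z => z ^+ (2 ^ (s - logn 2 d)))).
  rewrite expr1n -exprM {1}dE -mulnA -expnD subnKC // mulnC exprM ws.
  rewrite -signr_odd; move: co_m; rewrite coprime2n => -> /eqP.
  by rewrite expr1 eq_sym -subr_eq0 opprK paddr_eq0 ?ler01 // oner_eq0.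
have := subrX1 (w ^+ d) (2 ^ s.+1).
rewrite -exprM mulnC expnSr !exprM ws sqrrN !expr1n subrr => /esym/eqP.
by rewrite mulf_eq0 subr_eq0 (negPf wd1) => /eqP.
Qed.

(** The discrete Cauchy formula: averaging [x^(-m) p(x)] over the points whose
    coordinates are [rho] times [T]-th roots of unity isolates the coefficient
    of [x^m], as soon as [T] exceeds the degree of [p]. *)
Theorem Cauchy_estimate p rho M : 0 < rho ->
  (forall x, polydisc rho x -> nc (mpoly.meval x p) <= M) ->
  forall m, nc (mpoly.mcoeff m p) * rho ^+ mpoly.mdeg m <= M.
Proof.
move=> rho0 HM m.
have M0 : 0 <= M.
  apply: le_trans (HM (fun=> 0) _); first exact: nc_ge0.
  by move=> j; rewrite nc0 ltW.
have [mp|] := boolP (m \in mpoly.msupp p); last first.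
  by rewrite -mpoly.mcoeff_eq0 => /eqP ->; rewrite nc0 mul0r.
pose s := mpoly.mmeasure mpoly.mdeg p; pose T := (2 ^ s.+1)%N.
have sT : (s < T)%N by apply: leq_trans (ltn_expl s.+1 (isT : (1 < 2)%N)).
pose w : C := (2 ^ s).-root (-1).
have ws : w ^+ (2 ^ s) = -1 by rewrite /w rootCK // expn_gt0.
have nw : nc w = 1.
  apply/eqP; rewrite -(@pexpr_eq1 _ _ (2 ^ s)) ?nc_ge0 ?expn_gt0 //.
  by rewrite -ncX ws ncN nc1.
have ltT (m' : mpoly.multinom N) i : m' \in mpoly.msupp p -> (m' i < T)%N.
  move=> /mpoly.msize_mdeg_lt; rewrite -/s => lt_s.
  apply: leq_ltn_trans (ltn_trans lt_s sT).
  by rewrite mpoly.mdegE (bigD1 i) //= leq_addr.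
have rootsum (m' : mpoly.multinom N) i : m' \in mpoly.msupp p ->
    \sum_(k < T) w ^+ (k * (T - m i)) * (rho%:C%C * w ^+ k) ^+ m' i =
    (m' i == m i)%:R * (T%:R * rho%:C%C ^+ m' i).
  move=> m'p; have hm := ltT m i mp; have hm' := ltT m' i m'p.
  have -> : \sum_(k < T) w ^+ (k * (T - m i)) * (rho%:C%C * w ^+ k) ^+ m' i =
     rho%:C%C ^+ m' i * \sum_(k < T) (w ^+ (m' i + (T - m i))) ^+ k.
    rewrite mulr_sumr; apply: eq_bigr => k _.
    rewrite exprMn mulrCA -!exprM -exprD; congr (_ * w ^+ _); nia.
  have wT : w ^+ T = 1 by rewrite /T expnSr exprM ws sqrrN expr1n.
  case: eqP => [->|ne].
    rewrite addnBA ?(ltnW hm) // addnC addnK wT mul1r mulrC.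
    by under eq_bigr do rewrite expr1n; rewrite sumr_const card_ord.
  rewrite mul0r; have [lt|le] := ltnP (m' i) (m i).
    by rewrite sum_unity_roots ?mulr0 //; rewrite -/T; lia.
  have -> : (m' i + (T - m i) = (m' i - m i) + T)%N by lia.
  by rewrite exprD wT mulr1 sum_unity_roots ?mulr0 //; rewrite -/T; lia.
have key : \sum_(k : {ffun 'I_N -> 'I_T})
    (\prod_i w ^+ (k i * (T - m i))) * mpoly.meval (fun i => rho%:C%C * w ^+ k i) p =
    (T ^ N)%:R * (rho%:C%C ^+ mpoly.mdeg m * mpoly.mcoeff m p).
  under eq_bigr => k _ do rewrite mpoly.mevalE mulr_sumr.
  rewrite exchange_big /=.
  have term (m' : mpoly.multinom N) : m' \in mpoly.msupp p ->
     \sum_(k : {ffun 'I_N -> 'I_T}) (\prod_i w ^+ (k i * (T - m i))) *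
       (mpoly.mcoeff m' p * \prod_i (rho%:C%C * w ^+ k i) ^+ m' i) =
     mpoly.mcoeff m' p * \prod_i ((m' i == m i)%:R * (T%:R * rho%:C%C ^+ m' i)).
    move=> m'p; rewrite -(eq_bigr _ (fun i _ => rootsum m' i m'p)) bigA_distr_bigA.
    rewrite mulr_sumr; apply: eq_bigr => k _.
    by rewrite mulrCA -big_split.
  rewrite (eq_big_seq _ term) (bigD1_seq m) ?mpoly.msupp_uniq //= [X in _ + X]big1_seq ?addr0.
    under eq_bigr do rewrite eqxx mul1r.
    rewrite big_split /= prodr_const card_ord natrX mulrC -mulrA; congr (_ * (_ * _)).
    by rewrite mpoly.mdegE -prodrXr.
  move=> m' /andP [ne _].
  have [i ni] : exists i, m' i != m i.
    apply/existsP; apply: contraNT ne => /existsPn nm.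
    by apply/eqP/mpoly.mnmP => i; apply/eqP; rewrite -[_ == _]negbK nm.
  by rewrite (bigD1 i) //= (negPf ni) !mul0r mulr0.
have : nc ((T ^ N)%:R * (rho%:C%C ^+ mpoly.mdeg m * mpoly.mcoeff m p) : C) <= (T ^ N)%:R * M.
  rewrite -key; apply: le_trans (nc_sum _ _ _) _.
  apply: (@le_trans _ _ (\sum_(k : {ffun 'I_N -> 'I_T}) M)).
    apply: ler_sum => k _; rewrite ncM nc_prod big1 ?mul1r => [|i _].
      apply: HM => i; rewrite ncM ncR ?(ltW rho0) // ncX nw expr1n mulr1 //.
    by rewrite ncX nw expr1n.
  by rewrite sumr_const card_ffun !card_ord mulr_natl.
have -> : ((T ^ N)%:R : C) = ((T ^ N)%:R : R)%:C%C by rewrite rmorph_nat.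
rewrite !ncM ncX !ncR ?(ltW rho0) // ler_pM2l; last by rewrite ltr0n !expn_gt0.
by rewrite mulrC.
Qed.

End Cauchy.

(** * Power series and uniform limits *)

Section MultiIndexSums.
Variable N : nat.
Local Notation multi := (mpoly.multinom N).
Local Notation bmulti := (mpoly.bmultinom N).

Lemma sum_bmultinom_widen (V : nmodType) (F : multi -> V) k l : (k <= l)%N ->
  \sum_(al : bmulti l | (mpoly.mdeg al < k)%N) F al = \sum_(al : bmulti k) F al.
Proof.
move=> kl; have [->|k0] := posnP k.
  rewrite big_pred0 => [|al]; last by rewrite ltn0.
  by rewrite big1 // => al; have := mpoly.bmdeg al; rewrite ltn0.
have k00 : (mpoly.mdeg (mpoly.mnm0 : multi) < k)%N by rewrite mpoly.mdeg0.
have h1 (al : bmulti k) : (mpoly.mdeg al < l)%N.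
  exact: leq_trans (mpoly.bmdeg al) kl.
pose h (al : bmulti k) : bmulti l := mpoly.BMultinom (h1 al).
pose h' (al : bmulti l) : bmulti k := insubd (mpoly.BMultinom k00) (val al).
rewrite (reindex_onto h h') /=.
  apply: eq_bigl => al; rewrite (mpoly.bmdeg al) /=; apply/eqP/val_inj.
  by rewrite /h' /= val_insubd (mpoly.bmdeg al).
by move=> al alk; apply: val_inj; rewrite /= /h' val_insubd alk.
Qed.

Lemma sum_bmultinom_split (V : nmodType) (F : multi -> V) k l : (k <= l)%N ->
  \sum_(al : bmulti l) F al =
  \sum_(al : bmulti k) F al + \sum_(al : bmulti l | ~~ (mpoly.mdeg al < k)%N) F al.
Proof.
by move=> kl; rewrite (bigID (fun al : bmulti l => mpoly.mdeg al < k)%N) /=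
  sum_bmultinom_widen.
Qed.

Variable R : realType.
Local Notation C := R[i].

(** The sum is bounded by the [N]-th power of a geometric series. *)
Lemma sum_half_multinom k :
  \sum_(al : bmulti k) 2^-1 ^+ mpoly.mdeg al <= 2 ^+ N :> R.
Proof.
have lt_k (al : bmulti k) i : (al i < k)%N.
  apply: leq_ltn_trans (mpoly.bmdeg al).
  by rewrite mpoly.mdegE (bigD1 i) //= leq_addr.
pose h (al : bmulti k) : {ffun 'I_N -> 'I_k} := [ffun i => Ordinal (lt_k al i)].
pose G (be : {ffun 'I_N -> 'I_k}) : R := \prod_i 2^-1 ^+ be i.
have hG (al : bmulti k) : 2^-1 ^+ mpoly.mdeg al = G (h al).
  by rewrite mpoly.mdegE -prodrXr; apply: eq_bigr => i _; rewrite ffunE.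
have hinj : injective h.
  move=> al be /ffunP E; apply/val_inj/mpoly.mnmP => i.
  by have := E i; rewrite !ffunE => /(congr1 val).
rewrite (eq_bigr _ (fun al _ => hG al)).
pose T := [set al : bmulti k | true]%SET.
have -> : \sum_(al : bmulti k) G (h al) = \sum_(be in h @: T) G be.
  rewrite big_imset; last by move=> ? ? _ _; exact: hinj.
  by apply: eq_bigl => al; rewrite inE.
apply: (@le_trans _ _ (\sum_be G be)).
  rewrite [leRHS](bigID (mem (h @: T))) /= lerDl sumr_ge0 // => be _.
  by apply: prodr_ge0 => i _; rewrite exprn_ge0.
rewrite -(bigA_distr_bigA (fun _ (j : 'I_k) => 2^-1 ^+ j)) /=.
have geo : \sum_(j < k) 2^-1 ^+ j <= 2 :> R.
  have -> : \sum_(j < k) 2^-1 ^+ j = 2 - 2 * 2^-1 ^+ k :> R.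
    elim: (k) => [|k' IH]; first by rewrite big_ord0 expr0; lra.
    by rewrite big_ord_recr /= IH exprS; lra.
  have : 0 <= 2^-1 ^+ k :> R by rewrite exprn_ge0.
  by lra.
have -> : 2 ^+ N = \prod_(i < N) 2 :> R by rewrite prodr_const card_ord.
apply: ler_prod => i _.
by rewrite geo sumr_ge0 // => j _; rewrite exprn_ge0.
Qed.

Lemma nc_mmap1 (x : 'I_N -> C) r (al : multi) : polydisc r x ->
  nc (mpoly.mmap1 x al) <= r ^+ mpoly.mdeg al.
Proof.
move=> xr; rewrite nc_prod mpoly.mdegE -prodrXr; apply: ler_prod => i _.
rewrite ncX exprn_ge0 ?nc_ge0 //=; have := nc_ge0 (x i) => x0.
by apply: lerXn2r; rewrite ?nnegrE //; exact: le_trans (xr i).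
Qed.

End MultiIndexSums.

Section PowerSeries.
Variables (R : realType) (N : nat).
Local Notation C := R[i].
Local Notation multi := (mpoly.multinom N).
Local Notation bmulti := (mpoly.bmultinom N).
Implicit Types (c : multi -> C) (f : ('I_N -> C) -> C) (rho : R).

(** A series is bounded through its absolute sums at the radius [rho]; the
    convergence of the partial sums on the closed polydisc is only pointwise in
    [pseries], the uniformity being automatic ([pseries_part_sum]). *)
Definition abs_sum rho c k : R :=
  \sum_(al : bmulti k) nc (c al) * rho ^+ mpoly.mdeg al.
Definition part_sum c k (x : 'I_N -> C) : C :=
  \sum_(al : bmulti k) c al * mpoly.mmap1 x al.
Definition abs_summable rho c := exists A, forall k, abs_sum rho c k <= A.
Definition pseries rho f c := abs_summable rho c /\
  forall x, polydisc rho x -> forall e : R, 0 < e ->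
  exists k0, forall k, (k0 <= k)%N -> nc (f x - part_sum c k x) <= e.

Lemma part_sum_tail rho c k l x : 0 <= rho -> polydisc rho x -> (k <= l)%N ->
  nc (part_sum c k x - part_sum c l x) <= abs_sum rho c l - abs_sum rho c k.
Proof.
move=> rho0 xr kl; rewrite ncB.
rewrite /part_sum (sum_bmultinom_split (fun al => c al * mpoly.mmap1 x al) kl).
rewrite addrAC subrr add0r.
rewrite /abs_sum
  (sum_bmultinom_split (fun al => nc (c al) * rho ^+ mpoly.mdeg al) kl) addrAC subrr add0r.
apply: le_trans (nc_sum _ _ _) _; apply: ler_sum => al _.
by rewrite ncM ler_wpM2l ?nc_ge0 // nc_mmap1.
Qed.

Lemma abs_sum_mono rho c k l : 0 <= rho -> (k <= l)%N ->
  abs_sum rho c k <= abs_sum rho c l.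
Proof.
move=> rho0 kl; rewrite /abs_sum
  (sum_bmultinom_split (fun al => nc (c al) * rho ^+ mpoly.mdeg al) kl) lerDl.
by apply: sumr_ge0 => al _; rewrite mulr_ge0 ?nc_ge0 // exprn_ge0.
Qed.

Lemma abs_summable_tail rho c : 0 <= rho -> abs_summable rho c ->
  exists2 b : nat -> R, (forall e, 0 < e -> exists k, b k <= e) &
    forall k l, (k <= l)%N -> abs_sum rho c l - abs_sum rho c k <= b k.
Proof.
move=> rho0 [A HA]; pose S := range (abs_sum rho c).
have hS : has_sup S by split; [exists (abs_sum rho c 0%N); exists 0%N|exists A => _ [k _ <-]].
exists (fun k => sup S - abs_sum rho c k) => [e e0|k l kl].
  have [_ [k _ <-] hk] := sup_adherent e0 hS; exists k; lra.
by rewrite lerD2r; apply: sup_upper_bound => //; exists l.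
Qed.

Lemma polyfun_part_sum c k : polyfun (part_sum c k).
Proof.
by apply: polyfun_sum => al; apply: polyfunM; [exact: polyfun_const|exact: polyfun_mmap1].
Qed.

Lemma pseries_part_sum rho f c : 0 <= rho -> pseries rho f c ->
  forall e, 0 < e -> exists k0, forall k, (k0 <= k)%N ->
    forall x, polydisc rho x -> nc (f x - part_sum c k x) <= e.
Proof.
move=> rho0 [Ac Hf] e e0; have e2 : 0 < e / 2 by lra.
have [b b0 hb] := abs_summable_tail rho0 Ac; have [k0 hk0] := b0 _ e2.
exists k0 => k kk x xr; have [l hl] := Hf x xr _ e2.
pose l' := maxn k l; have := hl l' (leq_maxr _ _).
have := part_sum_tail c rho0 xr (leq_maxl k l : (k <= l')%N).
have := hb k0 l' (leq_trans kk (leq_maxl _ _)).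
have := abs_sum_mono c rho0 kk.
have := nc_dist (f x) (part_sum c l' x) (part_sum c k x).
by rewrite (ncB (part_sum c l' x)); lra.
Qed.

Lemma pseries_ulim rho f c : 0 <= rho -> pseries rho f c -> ulim rho f.
Proof.
move=> rho0 pf e e0; have [k hk] := pseries_part_sum rho0 pf e0.
by exists (part_sum c k); [exact: polyfun_part_sum|exact: hk].
Qed.

Lemma pseries_exists rho c : 0 <= rho -> abs_summable rho c ->
  exists f, pseries rho f c.
Proof.
move=> rho0 Ac; have [b b0 hb] := abs_summable_tail rho0 Ac.
have /choice [f hf] : forall x, exists l, polydisc rho x ->
    forall k, nc (part_sum c k x - l) <= 2 * b k.
  move=> x; have [xr|] := pselect (polydisc rho x); last by exists 0.
  have [k l kl|l hl] := @complex_Cauchy_limit R (fun k => part_sum c k x) b.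
    by apply: le_trans (part_sum_tail c rho0 xr kl) _; exact: hb.
  by exists l.
exists f; split=> // x xr e e0.
have [k0 hk0] := b0 (e / 4) (divr_gt0 e0 (ltr0n _ 4)).
exists k0 => k kk; have h1 := hf x xr k0.
have h2 := part_sum_tail c rho0 xr kk; have h3 := hb _ _ kk.
have := nc_dist (f x) (part_sum c k0 x) (part_sum c k x).
by rewrite (ncB (f x) (part_sum c k0 x)); lra.
Qed.

(** The Cauchy estimates show that the coefficients of approximating polynomials
    converge, to limits of size [O(rho^-|m|)], and bound the difference of the
    coefficients: half the radius makes all the sums geometric. *)
Theorem ulim_pseries rho f : 0 < rho -> ulim rho f -> exists c, pseries (rho / 2) f c.
Proof.
move=> rho0 uf.
have /choice [p hp] : forall n : nat, exists p : mpoly.mpoly N C,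
    forall x, polydisc rho x -> nc (f x - mpoly.meval x p) <= 2^-1 ^+ n.
  move=> n; have [P pP HP] := uf (2^-1 ^+ n) (exprn_gt0 _ (etrans (invr_gt0 2) (ltr0n R 2))).
  by have [p Ep] := polyfun_mpoly pP; exists p => x xr; rewrite -Ep; exact: HP.
have coefD n l m : (n <= l)%N -> nc (mpoly.mcoeff m (p n) - mpoly.mcoeff m (p l)) <=
    2 * 2^-1 ^+ n / rho ^+ mpoly.mdeg m.
  move=> nl; rewrite ler_pdivlMr ?exprn_gt0 // -raddfB; apply: Cauchy_estimate => // x xr.
  rewrite raddfB /=.
  have := nc_dist (mpoly.meval x (p n)) (f x) (mpoly.meval x (p l)).
  rewrite (ncB (mpoly.meval x (p n)) (f x)).
  have := hp n x xr; have := hp l x xr.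
  have : 2^-1 ^+ l <= 2^-1 ^+ n :> R by apply: ler_wiXn2l => //; lra.
  by lra.
have /choice [c hc] : forall m, exists l, forall n,
    nc (mpoly.mcoeff m (p n) - l) <= 2 * (2 * 2^-1 ^+ n / rho ^+ mpoly.mdeg m).
  by move=> m; apply: complex_Cauchy_limit => n l; exact: coefD.
have {}hc m n : nc (mpoly.mcoeff m (p n) - c m) * rho ^+ mpoly.mdeg m <= 4 * 2^-1 ^+ n.
  by rewrite -ler_pdivlMr ?exprn_gt0 //; have := hc m n; lra.
have [M M0 HM] := polyfun_bounded rho (polyfun_meval (p 0%N)).
have cM m : nc (c m) * rho ^+ mpoly.mdeg m <= M + 4.
  have h1 := Cauchy_estimate rho0 HM m; have h2 := hc m 0%N.
  have := ncD (c m - mpoly.mcoeff m (p 0%N)) (mpoly.mcoeff m (p 0%N)); rewrite subrK ncB.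
  have : 0 < rho ^+ mpoly.mdeg m by rewrite exprn_gt0.
  by rewrite expr0 in h2; nra.
have half m (z : R) : z * (rho / 2) ^+ m = z * rho ^+ m * 2^-1 ^+ m.
  by rewrite exprMn mulrA.
exists c; split.
  exists ((M + 4) * 2 ^+ N) => k.
  apply: (@le_trans _ _ (\sum_(al : bmulti k) (M + 4) * 2^-1 ^+ mpoly.mdeg al)).
    by apply: ler_sum => al _; rewrite half ler_wpM2r ?exprn_ge0.
  by rewrite -mulr_sumr ler_wpM2l ?sum_half_multinom //; lra.
move=> x xr e e0.
have [n hn] := @pow_half_small R (1 + 4 * 2 ^+ N) e e0.
exists (mpoly.mmeasure mpoly.mdeg (p n)) => k kk.
have xr' : polydisc rho x by move=> j; have := xr j; have := nc_ge0 (x j); lra.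
have E : mpoly.meval x (p n) = part_sum (fun m => mpoly.mcoeff m (p n)) k x.
  exact: mpoly.mmapE.
have h1 := hp n x xr'.
have h2 : nc (mpoly.meval x (p n) - part_sum c k x) <= 4 * 2^-1 ^+ n * 2 ^+ N.
  rewrite E /part_sum -sumrB; apply: le_trans (nc_sum _ _ _) _.
  apply: (@le_trans _ _ (\sum_(al : bmulti k) 4 * 2^-1 ^+ n * 2^-1 ^+ mpoly.mdeg al)).
    apply: ler_sum => al _; rewrite -mulrBl ncM.
    apply: (@le_trans _ _ (nc (mpoly.mcoeff al (p n) - c al) * (rho / 2) ^+ mpoly.mdeg al)).
      by rewrite ler_wpM2l ?nc_ge0 // nc_mmap1.
    by rewrite half ler_wpM2r ?exprn_ge0.
  rewrite -mulr_sumr ler_wpM2l ?sum_half_multinom // mulr_ge0 // exprn_ge0 //.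
have := nc_dist (f x) (mpoly.meval x (p n)) (part_sum c k x); lra.
Qed.

End PowerSeries.

(** * Analytic germs as uniform limits *)

(** The numerical field structure of [R[i]], named so that the topology of row
    vectors is derived from it. *)
Definition complex_field (R : realType) : numFieldType := R[i].

Section Interface.
Variables (R : realType) (N : nat).
Local Notation C := R[i].
Local Notation K := (complex_field R).
Local Notation multi := (mpoly.multinom N).
Local Notation bmulti := (mpoly.bmultinom N).
Implicit Types (c : multi -> C) (rho : R).

Lemma posC (e : C) : 0 < e -> exists2 r : R, 0 < r & e = r%:C%C.
Proof.
case: e => [x y]; rewrite ltcE /= => /andP [/eqP -> x0]; by exists x.
Qed.

(** Row vectors carry the topology of the germs, functions on ['I_N] are the
    points where polynomials are evaluated. *)
Definition on_fun (f : 'rV[K]_N -> K) (v : 'I_N -> C) : C := f (\row_i v i).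

Lemma on_funE (f : 'rV[K]_N -> K) x : f x = on_fun f (x 0).
Proof. by congr f; apply/rowP => i; rewrite mxE. Qed.

Lemma near_polydisc (P : 'rV[K]_N -> Prop) :
  (\forall x \near (0 : 'rV[K]_N), P x) <->
  exists2 r : R, 0 < r & forall x : 'rV[K]_N, polydisc r (x 0) -> P x.
Proof.
split=> [/nbhs_ballP [e e0 He]|[r r0 Hr]].
  have [r r0 re] := posC e0; exists (r / 2) => [|x xr]; first by lra.
  apply: He; split=> // i j; rewrite ord1 /ball /= /ball_ /= mxE sub0r normrN normC_nc re ltC.
  by have := xr j; lra.
apply/nbhs_ballP; exists (r%:C%C) => /=; first by rewrite ltC.
move=> x [_ xr]; apply: Hr => j; have := xr 0 j.
by rewrite /ball /= /ball_ /= mxE sub0r normrN normC_nc ltC => /ltW.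
Qed.

Lemma normr_term c (x : 'I_N -> C) (al : multi) :
  `|c al * mpoly.mmap1 x al| = (nc (c al) * nc (mpoly.mmap1 x al))%:C%C.
Proof. by rewrite normC_nc ncM. Qed.

(** Absolute convergence at the corner point [(rho, ..., rho)] bounds the series
    on the whole polydisc. *)
Lemma has_power_series_pseries (f : 'rV[K]_N -> K) c : has_power_series f c ->
  exists2 rho, 0 < rho & pseries rho (on_fun f) c.
Proof.
move=> /near_polydisc [rho rho0 H]; exists rho => //; split.
  have [|cv _] := H (\row_i rho%:C%C).
    by move=> j; rewrite mxE ncR // ltW.
  have {cv} [l /cvgrPdist_le hl] : exists l : K, (fun k => (\sum_(al : bmulti k)
      `|c al * monomial (\row_i rho%:C%C) al|) : K) @ \oo --> l.
    by exists (lim ((fun k => (\sum_(al : bmulti k)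
      `|c al * monomial (\row_i rho%:C%C) al|) : K) @ \oo)).
  have [K _ hK] := hl 1 ltr01.
  have E k : \sum_(al : bmulti k) `|c al * monomial (\row_i rho%:C%C) al| =
      (abs_sum rho c k)%:C%C.
    rewrite rmorph_sum; apply: eq_bigr => al _; rewrite normr_term; congr (_ * _)%:C%C.
    rewrite nc_prod mpoly.mdegE -prodrXr; apply: eq_bigr => i _.
    by rewrite mxE ncX ncR // ltW.
  exists (nc l + 1) => k.
  apply: le_trans (abs_sum_mono c (ltW rho0) (leq_addr K k)) _.
  have := hK (k + K)%N (leq_addl _ _); rewrite E normC_nc (_ : 1 = 1%:C%C) // leC => h.
  have := ncD (- (l - (abs_sum rho c (k + K))%:C%C)) l; rewrite ncN opprB subrK ncR.
    by lra.
  by apply: sumr_ge0 => al _; rewrite mulr_ge0 ?nc_ge0 // exprn_ge0 // ltW.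
move=> x xr e e0.
have [|_ /cvgrPdist_le hx] := H (\row_i x i).
  by move=> j; rewrite mxE.
have e0' : 0 < e%:C%C by rewrite ltC.
have [K _ hK] := hx _ e0'.
exists K => k kK; have := hK k kK; rewrite normC_nc leC.
have -> : part_sum c k x = \sum_(al : bmulti k) c al * monomial (\row_i x i : 'rV[complex_field R]_N) al.
  apply: eq_bigr => al _; rewrite /monomial; congr (c al * _).
  by apply: eq_bigr => i _; rewrite mxE.
exact.
Qed.

Lemma pseries_has_power_series (f : 'rV[K]_N -> K) c rho : 0 < rho ->
  pseries rho (on_fun f) c -> has_power_series f c.
Proof.
move=> rho0 [[A HA] Hf]; apply/near_polydisc; exists rho => // x xr; split; last first.
  apply/cvgrPdist_le => e /posC [r r0 ->].
  have [k0 hk0] := Hf _ xr _ r0; exists k0 => // k kk /=.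
  by rewrite normC_nc leC on_funE; exact: hk0.
pose t k : R := \sum_(al : bmulti k) nc (c al) * nc (mpoly.mmap1 (x 0) al).
have tmono k l : (k <= l)%N -> t k <= t l.
  move=> kl; rewrite /t
    (sum_bmultinom_split (fun al => nc (c al) * nc (mpoly.mmap1 (x 0) al)) kl) lerDl.
  by apply: sumr_ge0 => al _; rewrite mulr_ge0 ?nc_ge0.
have tA k : t k <= A.
  apply: le_trans (HA k); apply: ler_sum => al _.
  by rewrite ler_wpM2l ?nc_ge0 // nc_mmap1.
have hS : has_sup (range t).
  by split; [exists (t 0%N); exists 0%N|exists A => _ [k _ <-]].
apply: (cvgP ((sup (range t))%:C%C : K)).
apply/cvgrPdist_le => e /posC [r r0 ->].
have [_ [k0 _ <-] hk] := sup_adherent r0 hS.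
exists k0 => // k /= kk.
have -> : \sum_(al : bmulti k) `|c al * monomial x al| = (t k)%:C%C.
  by rewrite rmorph_sum; apply: eq_bigr => al _; rewrite normr_term.
rewrite -rmorphB normC_nc leC ncR.
  by have := tmono _ _ kk; lra.
by rewrite subr_ge0; apply: sup_upper_bound => //; exists k.
Qed.

Lemma ulim_analytic (f : 'rV[K]_N -> K) rho : 0 < rho -> ulim rho (on_fun f) ->
  analytic_germ f.
Proof.
move=> rho0 /ulim_pseries [//|c hc]; exists c.
by apply: (@pseries_has_power_series _ _ (rho / 2)); [lra|].
Qed.

End Interface.

Section Lipschitz.
Variables (R : realType) (N : nat).
Local Notation C := R[i].
Local Notation multi := (mpoly.multinom N).
Local Notation bmulti := (mpoly.bmultinom N).

(** The factor [r] on the left avoids the exponent [mdeg al - 1]. *)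
Lemma mmap1_lipschitz (x y : 'I_N -> C) (r d : R) (al : multi) :
  0 <= r -> 0 <= d -> polydisc r x -> polydisc r y ->
  (forall j, nc (x j - y j) <= d) ->
  nc (mpoly.mmap1 x al - mpoly.mmap1 y al) * r <=
    (mpoly.mdeg al)%:R * r ^+ mpoly.mdeg al * d.
Proof.
move=> r0 d0 xr yr xy.
pose rel (X Y : C) (k : nat) :=
  [/\ nc X <= r ^+ k, nc Y <= r ^+ k & nc (X - Y) * r <= k%:R * r ^+ k * d].
have rel1 : rel 1 1 0%N.
  by split; rewrite ?nc1 ?expr0 // subrr nc0 !mul0r.
have relM X Y k X' Y' k' : rel X Y k -> rel X' Y' k' ->
    rel (X * X') (Y * Y') (k + k')%N.
  move=> [hX hY hXY] [hX' hY' hXY']; split.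
  - by rewrite ncM exprD ler_pM ?nc_ge0.
  - by rewrite ncM exprD ler_pM ?nc_ge0.
  have -> : X * X' - Y * Y' = X * (X' - Y') + Y' * (X - Y) by ring.
  apply: (@le_trans _ _ (nc X * (nc (X' - Y') * r) + nc Y' * (nc (X - Y) * r))).
    rewrite !mulrA -mulrDl ler_wpM2r //; apply: le_trans (ncD _ _) _.
    by rewrite !ncM.
  have -> : (k + k')%:R * r ^+ (k + k') * d =
    r ^+ k * (k'%:R * r ^+ k' * d) + r ^+ k' * (k%:R * r ^+ k * d).
    by rewrite natrD exprD; ring.
  by apply: lerD; apply: ler_pM; rewrite ?nc_ge0 // mulr_ge0 ?nc_ge0.
have relv i : rel (x i) (y i) 1%N.
  split; rewrite ?expr1; [exact: xr|exact: yr|].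
  by rewrite mul1r mulrC ler_wpM2l.
have relX i k : rel (x i ^+ k) (y i ^+ k) k.
  elim: k => [|k IH]; first by rewrite !expr0.
  by rewrite !exprS -add1n; apply: relM.
suff [] : rel (mpoly.mmap1 x al) (mpoly.mmap1 y al) (mpoly.mdeg al) by [].
rewrite mpoly.mdegE /mpoly.mmap1.
by elim/big_rec3: _ => // i X Y k _ IH; apply: relM.
Qed.

(** The factor [|al|] of [mmap1_lipschitz] is absorbed by [4^-|al|]: this is the
    reason for the radius [rho / 4]. *)
Lemma pseries_lipschitz (rho : R) f (c : multi -> C) : 0 < rho -> pseries rho f c ->
  exists2 L, 0 <= L & forall x y d, polydisc (rho / 4) x -> polydisc (rho / 4) y ->
    0 <= d -> (forall j, nc (x j - y j) <= d) -> nc (f x - f y) <= L * d.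
Proof.
move=> rho0 pf; have [[A HA] Hf] := pf.
have A0 : 0 <= A.
  apply: le_trans (HA 0%N); apply: sumr_ge0 => al _.
  by rewrite mulr_ge0 ?nc_ge0 // exprn_ge0 // ltW.
exists (4 * A / rho) => [|x y d xr yr d0 xy].
  by rewrite divr_ge0 ?mulr_ge0 // ltW.
have xr' : polydisc rho x by move=> j; have := xr j; lra.
have yr' : polydisc rho y by move=> j; have := yr j; lra.
apply/ler_addgt0Pr => e e0.
have [k1 hk1] := Hf x xr' (e / 2) (divr_gt0 e0 (ltr0n _ 2)).
have [k2 hk2] := Hf y yr' (e / 2) (divr_gt0 e0 (ltr0n _ 2)).
pose k := maxn k1 k2.
have h1 := hk1 k (leq_maxl _ _); have h2 := hk2 k (leq_maxr _ _).
suff h3 : nc (part_sum c k x - part_sum c k y) <= 4 * A / rho * d.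
  have := nc_dist (f x) (part_sum c k x) (f y).
  have := nc_dist (part_sum c k x) (part_sum c k y) (f y).
  by rewrite (ncB (part_sum c k y)); lra.
have -> : 4 * A / rho * d = A * d / (rho / 4) by field; rewrite gt_eqF.
have r40 : 0 < rho / 4 by lra.
rewrite ler_pdivlMr // /part_sum -sumrB.
apply: (@le_trans _ _ (\sum_(al : bmulti k) nc (c al) * rho ^+ mpoly.mdeg al * d)).
  apply: le_trans (_ : (\sum_(al : bmulti k) nc (c al) *
     (nc (mpoly.mmap1 x al - mpoly.mmap1 y al) * (rho / 4))) <= _).
    have -> : \sum_(al : bmulti k) nc (c al) *
      (nc (mpoly.mmap1 x al - mpoly.mmap1 y al) * (rho / 4)) =
      (\sum_(al : bmulti k) nc (c al * mpoly.mmap1 x al - c al * mpoly.mmap1 y al)) *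
        (rho / 4).
      by rewrite mulr_suml; apply: eq_bigr => al _; rewrite mulrA -ncM mulrBr.
    by rewrite ler_wpM2r ?(ltW r40) // nc_sum.
  apply: ler_sum => al _; rewrite -mulrA ler_wpM2l ?nc_ge0 //.
  apply: le_trans (mmap1_lipschitz al (ltW r40) d0 xr yr xy) _.
  rewrite ler_wpM2r // exprMn mulrCA -[leRHS]mulr1 ler_wpM2l ?exprn_ge0 ?(ltW rho0) //.
  rewrite exprVn ler_pdivrMr ?exprn_gt0 // mul1r -natrX ler_nat ltnW // ltn_expl //.
by rewrite -mulr_suml; apply: ler_wpM2r => //; exact: HA.
Qed.

Lemma ulim_lipschitz (rho : R) (f : ('I_N -> C) -> C) : 0 < rho -> ulim rho f ->
  exists2 L, 0 <= L & forall x y d, polydisc (rho / 8) x -> polydisc (rho / 8) y ->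
    0 <= d -> (forall j, nc (x j - y j) <= d) -> nc (f x - f y) <= L * d.
Proof.
move=> rho0 /ulim_pseries [//|c /pseries_lipschitz [|L L0 HL]]; first by lra.
exists L => // x y d xr yr; apply: HL => j; [have := xr j|have := yr j]; lra.
Qed.

End Lipschitz.

(** * Division by powers of the variables *)

Section Division.
Variables (R : realType) (N : nat).
Local Notation C := R[i].
Local Notation multi := (mpoly.multinom N).
Local Notation bmulti := (mpoly.bmultinom N).

(** The exponent of [x_lam^s x^al]. *)
Definition shift s (lam : 'I_N) (al : multi) : multi :=
  mpoly.mnm_add al (mpoly.mnm_muln (mpoly.mnm1 lam) s).

Lemma shiftE s lam al i : shift s lam al i = (al i + (lam == i) * s)%N.
Proof. by rewrite mpoly.mnmDE mpoly.mulmnE mpoly.mnm1E. Qed.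

Lemma mdeg_shift s lam al : mpoly.mdeg (shift s lam al) = (mpoly.mdeg al + s)%N.
Proof. by rewrite /shift mpoly.mdegD mpoly.mdegMn mpoly.mdeg1 mul1n. Qed.

Lemma mmap1_shift s lam al (x : 'I_N -> C) :
  mpoly.mmap1 x (shift s lam al) = x lam ^+ s * mpoly.mmap1 x al.
Proof.
rewrite /mpoly.mmap1; under eq_bigr do rewrite shiftE exprD.
rewrite big_split /= mulrC; congr (_ * _).
rewrite (bigD1 lam) //= eqxx mul1n big1 ?mulr1 // => i ne.
by rewrite eq_sym (negPf ne) mul0n.
Qed.

Lemma sum_shift (V : nmodType) (F : multi -> V) s lam k :
  \sum_(al : bmulti k) F (shift s lam al) =
  \sum_(al : bmulti (k + s) | (s <= al lam)%N) F al.
Proof.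
have [->|k0] := posnP k.
  rewrite big1 => [|al]; last by have := mpoly.bmdeg al; rewrite ltn0.
  rewrite big_pred0 // => al; apply/negbTE; rewrite -ltnNge.
  apply: leq_ltn_trans (mpoly.bmdeg al).
  by rewrite mpoly.mdegE (bigD1 lam) //= leq_addr.
have k00 : (mpoly.mdeg (mpoly.mnm0 : multi) < k)%N by rewrite mpoly.mdeg0.
have h1 (al : bmulti k) : (mpoly.mdeg (shift s lam al) < k + s)%N.
  by rewrite mdeg_shift ltn_add2r; exact: mpoly.bmdeg.
pose h (al : bmulti k) : bmulti (k + s) := mpoly.BMultinom (h1 al).
pose unshift (al : multi) : multi := mpoly.mnm_sub al (mpoly.mnm_muln (mpoly.mnm1 lam) s).
pose h' (al : bmulti (k + s)) : bmulti k := insubd (mpoly.BMultinom k00) (unshift al).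
have unK (al : multi) : unshift (shift s lam al) = al.
  apply/mpoly.mnmP => i; rewrite mpoly.mnmBE shiftE mpoly.mulmnE mpoly.mnm1E.
  by rewrite addnK.
have shK (al : multi) : (s <= al lam)%N -> shift s lam (unshift al) = al.
  move=> le; apply/mpoly.mnmP => i; rewrite shiftE mpoly.mnmBE mpoly.mulmnE mpoly.mnm1E.
  by case: eqP => [<-|_]; rewrite ?mul1n ?mul0n ?subn0 ?addn0 // subnK.
rewrite [RHS](reindex_onto h h') /=; last first.
  move=> al le; apply: val_inj; rewrite /= /h' val_insubd.
  have -> : (mpoly.mdeg (unshift al) < k)%N.
    by rewrite -(ltn_add2r s) -(mdeg_shift s lam) shK //; exact: mpoly.bmdeg.
  exact: shK.
apply: eq_bigl => al; rewrite shiftE eqxx mul1n leq_addl /=; symmetry.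
apply/eqP/val_inj; rewrite /h' val_insubd /= unK.
by rewrite (mpoly.bmdeg al).
Qed.

Lemma pseries_at0 rho f (c : multi -> C) : 0 <= rho -> pseries rho f c ->
  f (fun=> 0) = c mpoly.mnm0.
Proof.
move=> rho0 [_ Hf]; apply: nc_small_eq => e e0.
have [|k0 hk0] := Hf (fun=> 0) _ e e0; first by move=> j; rewrite nc0.
have := hk0 k0.+1 (leqnSn _); congr (nc (_ - _) <= _); rewrite /part_sum.
have d0 : (mpoly.mdeg (mpoly.mnm0 : multi) < k0.+1)%N by rewrite mpoly.mdeg0.
rewrite (bigD1 (mpoly.BMultinom d0)) //= big1 => [|al ne].
  by rewrite mpoly.mmap11 mulr1 addr0.
have [i ai] : exists i, al i != 0%N.
  apply/existsP; apply: contraNT ne => /existsPn na; apply/eqP/val_inj/mpoly.mnmP => i.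
  by rewrite mpoly.mnm0E; apply/eqP; rewrite -[_ == _]negbK na.
by rewrite /mpoly.mmap1 (bigD1 i) //= expr0n (negPf ai) mul0r mulr0.
Qed.

(** A monomial of degree more than [N s] is divisible by some [x_lam^s];
    assigning it to the first such [lam] splits the series. *)
Theorem pseries_divide rho s f (c : multi -> C) : 0 < rho -> (0 < N)%N -> (0 < s)%N ->
  pseries rho f c -> (forall al, (mpoly.mdeg al <= N * s)%N -> c al = 0) ->
  exists e : 'I_N -> ('I_N -> C) -> C,
    [/\ forall lam, ulim rho (e lam), forall lam, e lam (fun=> 0) = 0 &
        forall x, polydisc rho x -> f x = \sum_lam x lam ^+ s * e lam x].
Proof.
move=> rho0 N0 s0 [[A HA] Hf] c0.
pose first lam (al : multi) := (s <= al lam)%N && [forall mu : 'I_N, (mu < lam)%N ==> (al mu < s)%N].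
pose cl lam (ga : multi) : C := let al := shift s lam ga in if first lam al then c al else 0.
have cl_sum lam : abs_summable rho (cl lam).
  exists (A / rho ^+ s) => l; rewrite ler_pdivlMr ?exprn_gt0 //.
  apply: le_trans (HA (l + s)%N); rewrite /abs_sum mulr_suml.
  apply: (@le_trans _ _ (\sum_(al : bmulti (l + s) | (s <= al lam)%N)
      nc (c al) * rho ^+ mpoly.mdeg al)).
    rewrite -(sum_shift (fun al => nc (c al) * rho ^+ mpoly.mdeg al)).
    apply: ler_sum => al _; rewrite mdeg_shift exprD mulrA.
    rewrite !ler_wpM2r ?exprn_ge0 ?(ltW rho0) // /cl.
    by case: ifP => // _; rewrite nc0 nc_ge0.
  rewrite [leRHS](bigID (fun al : bmulti (l + s) => s <= al lam)%N) /= lerDl.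
  by apply: sumr_ge0 => al _; rewrite mulr_ge0 ?nc_ge0 // exprn_ge0 // ltW.
have /choice [e he] : forall lam, exists f, pseries rho f (cl lam).
  by move=> lam; exact: pseries_exists (ltW rho0) (cl_sum lam).
exists e; split.
- by move=> lam; exact: pseries_ulim (ltW rho0) (he lam).
- move=> lam; rewrite (pseries_at0 (ltW rho0) (he lam)) /cl; case: ifP => // _.
  by rewrite c0 // mdeg_shift mpoly.mdeg0 add0n leq_pmull.
move=> x xr.
have split_sum k : part_sum c (k + s) x = \sum_lam x lam ^+ s * part_sum (cl lam) k x.
  have -> : \sum_lam x lam ^+ s * part_sum (cl lam) k x =
    \sum_lam \sum_(al : bmulti (k + s)) if first lam al then c al * mpoly.mmap1 x al else 0.
    apply: eq_bigr => lam _; rewrite mulr_sumr.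
    have E (al : bmulti k) : x lam ^+ s * (cl lam al * mpoly.mmap1 x al) =
        (fun al => if first lam al then c al * mpoly.mmap1 x al else 0) (shift s lam al).
      rewrite /cl /= mmap1_shift; case: ifP => _; last by rewrite mul0r mulr0.
      by rewrite mulrCA.
    rewrite (eq_bigr _ (fun al _ => E al)).
    rewrite (sum_shift (fun al => if first lam al then c al * mpoly.mmap1 x al else 0)).
    rewrite big_mkcond /=; apply: eq_bigr => al _; rewrite /first.
    by case: leqP.
  rewrite exchange_big; apply: eq_bigr => al _ /=.
  have [lts|] := boolP [forall i, (al i < s)%N].
    rewrite big1 => [|lam _].
      rewrite c0 ?mul0r // mpoly.mdegE.
      have -> : (N * s = \sum_(i < N) s)%N by rewrite sum_nat_const card_ord.
      by apply: leq_sum => i _; exact/ltnW/(forallP lts).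
    by rewrite /first leqNgt (forallP lts lam).
  case/forallPn => i0; rewrite -leqNgt => hi0.
  case: (@arg_minnP _ i0 (fun i : 'I_N => s <= al i)%N (fun i => i) hi0) => lam hlam lmin.
  have flam : first lam al.
    rewrite /first hlam; apply/forallP => mu; apply/implyP => lt.
    by rewrite ltnNge; apply/negP => /lmin; rewrite leqNgt lt.
  rewrite (bigD1 lam) //= flam big1 ?addr0 // => mu ne.
  case: ifP => // /andP [hmu /forallP fmu].
  have := fmu lam; have := lmin mu hmu; rewrite leq_eqVlt => /orP [/eqP E|lt].
    by case/eqP: ne; apply: val_inj.
  by rewrite lt /= ltnNge hlam.
apply: nc_small_eq => eps eps0.
pose B := \sum_(lam < N) nc (x lam) ^+ s.
have B0 : 0 <= B by apply: sumr_ge0 => i _; rewrite exprn_ge0 ?nc_ge0.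
pose d := eps / 2 / (B + 1).
have d0 : 0 < d by rewrite !divr_gt0 //; lra.
have /choice [k hk] : forall lam, exists k0, forall k, (k0 <= k)%N ->
    nc (e lam x - part_sum (cl lam) k x) <= d.
  by move=> lam; have [_ /(_ x xr d d0)] := he lam.
have [k1 hk1] := Hf x xr (eps / 2) (divr_gt0 eps0 (ltr0n _ 2)).
pose K := (k1 + \sum_lam k lam)%N.
have h1 := hk1 (K + s)%N (leq_trans (leq_addr _ _) (leq_addr _ _)).
rewrite split_sum in h1.
have h2 : nc (\sum_lam x lam ^+ s * part_sum (cl lam) K x - \sum_lam x lam ^+ s * e lam x) <= B * d.
  rewrite -sumrB mulr_suml; apply: le_trans (nc_sum _ _ _) _; apply: ler_sum => lam _.
  rewrite -mulrBr ncM ncX ler_wpM2l ?exprn_ge0 ?nc_ge0 // ncB; apply: hk.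
  by rewrite (leq_trans _ (leq_addl _ _)) // (bigD1 lam) //= leq_addr.
have h3 : B * d <= eps / 2.
  have -> : eps / 2 = (B + 1) * d by rewrite /d; field; rewrite gt_eqF //; lra.
  by rewrite ler_wpM2r ?(ltW d0) //; lra.
have := nc_dist (f x) (\sum_lam x lam ^+ s * part_sum (cl lam) K x) (\sum_lam x lam ^+ s * e lam x).
by lra.
Qed.

End Division.

(** * Inversion of uniform limits *)

Section Inverses.
Variables (R : realType) (N : nat).
Local Notation C := R[i].
Implicit Types (rho : R).

Lemma common_radius (I : finType) (P : I -> R -> Prop) rho0 :
  (forall i r r', r' <= r -> P i r -> P i r') -> 0 < rho0 ->
  (forall i, exists2 r, 0 < r & P i r) ->
  exists r, [/\ 0 < r, r <= rho0 & forall i, P i r].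
Proof.
move=> Pmono rho00 HP.
suff [r [r0 rr Hr]] : exists r, [/\ 0 < r, r <= rho0 & forall i, i \in enum I -> P i r].
  by exists r; split=> // i; apply: Hr; rewrite mem_enum.
elim: (enum I) => [|i s [r [r0 rr Hr]]]; first by exists rho0.
have [r' r'0 Pr'] := HP i; exists (Num.min r r'); split.
- by rewrite lt_min r0.
- by rewrite ge_min rr.
- move=> j; rewrite inE => /orP [/eqP ->|/Hr].
    by apply: Pmono Pr'; rewrite ge_min lexx orbT.
  by apply: Pmono; rewrite ge_min lexx.
Qed.

Lemma ulim_small rho (f : ('I_N -> C) -> C) eta : 0 < rho -> ulim rho f ->
  f (fun=> 0) = 0 -> 0 < eta ->
  exists2 r, 0 < r & forall x, polydisc r x -> nc (f x) <= eta.
Proof.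
move=> rho0 uf f0 eta0; have [L L0 HL] := ulim_lipschitz rho0 uf.
pose r := Num.min (rho / 8) (eta / (L + 1)).
have r0 : 0 < r by rewrite lt_min !divr_gt0 //; lra.
exists r => // x xr.
have r8 : r <= rho / 8 by rewrite ge_min lexx.
have rL : r * (L + 1) <= eta.
  by rewrite -ler_pdivlMr ?ge_min ?lexx ?orbT //; lra.
have := HL x (fun=> 0) r _ _ (ltW r0) _; rewrite f0 subr0 => h.
apply: (@le_trans _ _ (L * r)); last by nra.
apply: h => j; rewrite ?nc0 ?subr0 ?(xr j) //; last by rewrite divr_ge0 // ltW.
exact: le_trans (xr j) r8.
Qed.

(** The inverse [u] is the fixed point of [u = 1 + (1 - f) u], a contraction by
    the factor [1/2]. *)
Lemma ulim_recip rho (f : ('I_N -> C) -> C) : ulim rho f ->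
  (forall x, polydisc rho x -> nc (1 - f x) <= 2^-1) ->
  exists2 u, ulim rho u & forall x, polydisc rho x -> f x * u x = 1.
Proof.
move=> uf hf.
have [||||u [uu us fixu]] := @contraction_fixpoint R 'I_N unit rho 2
  (fun (_ : unit) x v => 1 + (1 - f x) * v tt).
- by [].
- by move=> x xr _; rewrite mulr0 addr0 nc1; lra.
- move=> x v w d xr vs ws d0 vw _.
  have -> : 1 + (1 - f x) * v tt - (1 + (1 - f x) * w tt) = (1 - f x) * (v tt - w tt).
    by ring.
  rewrite ncM [d / 2]mulrC; apply: ler_pM; rewrite ?nc_ge0 //; exact: hf.
- move=> u uu us _; apply: ulimD; first exact: ulim_const.
  by apply: ulimM => //; apply: ulimB => //; exact: ulim_const.
exists (u tt) => // x xr; have := fixu x xr tt => E.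
have -> : f x * u tt x = u tt x - (1 - f x) * u tt x by ring.
by rewrite {1}E addrK.
Qed.

Lemma ulim_prod rho (I : Type) (r : seq I) (P : pred I) (F : I -> ('I_N -> C) -> C) :
  (forall i, ulim rho (F i)) -> ulim rho (fun v => \prod_(i <- r | P i) F i v).
Proof.
move=> uF; apply: (@ulim_poly_comp R _ I rho (fun w => \prod_(i <- r | P i) w i) F) => //.
by apply: polyfun_prod => i; exact: polyfun_var.
Qed.

Lemma ulim_det p rho (B : ('I_N -> C) -> 'M[C]_p) :
  (forall i j, ulim rho (fun x => B x i j)) -> ulim rho (fun x => \det (B x)).
Proof.
move=> uB.
apply: ulim_sum => s; apply: ulimM; first exact: ulim_const.
by apply: ulim_prod => i; exact: uB.
Qed.

(** The adjugate matrix divided by the determinant, which is close to [1]. *)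
Lemma ulim_matrix_inverse p rho (B : ('I_N -> C) -> 'M[C]_p) : 0 < rho ->
  (forall i j, ulim rho (fun x => B x i j)) -> B (fun=> 0) = 1%:M ->
  exists r (B' : ('I_N -> C) -> 'M[C]_p), [/\ 0 < r, r <= rho,
    forall i j, ulim r (fun x => B' x i j) &
    forall x, polydisc r x -> B x *m B' x = 1%:M /\ B' x *m B x = 1%:M].
Proof.
move=> rho0 uB B0; pose f x := \det (B x).
have uf : ulim rho f by exact: ulim_det.
have u1f : ulim rho (fun x => 1 - f x) by apply: ulimB => //; exact: ulim_const.
have [||r r0 hr] := ulim_small rho0 u1f _ (_ : 0 < 2^-1).
- by rewrite /f B0 det1 subrr.
- by rewrite invr_gt0.
pose r' := Num.min r rho.
have r'0 : 0 < r' by rewrite lt_min r0.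
have r'r : r' <= r by rewrite ge_min lexx.
have r'rho : r' <= rho by rewrite ge_min lexx orbT.
have sub (x : 'I_N -> C) : polydisc r' x -> polydisc r x by move=> h j; exact: le_trans (h j) r'r.
have [u uu fu] := ulim_recip (ulim_mono r'rho uf) (fun x xr => hr x (sub x xr)).
exists r', (fun x => u x *: \adj (B x)); split=> //.
  move=> i j; apply: (ulim_ext (f := fun x => u x * cofactor (B x) j i)).
    by move=> x _; rewrite !mxE.
  apply: ulimM => //; apply: ulimM; first exact: ulim_const.
  apply: ulim_det => k l; apply: ulim_mono r'rho _.
  apply: (ulim_ext (f := fun x => B x (lift j k) (lift i l))) => // x _.
  by rewrite !mxE.
move=> x xr; rewrite -scalemxAr -scalemxAl mul_mx_adj mul_adj_mx.
by rewrite scale_scalar_mx mulrC fu.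
Qed.

(** The inverse [g] of the perturbation [x |-> x + phi x] of the identity is the
    fixed point of [g y = y - phi (g y)]. *)
Lemma ulim_inverse_map rho (phi : 'I_N -> ('I_N -> C) -> C) : 0 < rho ->
  (forall l, ulim rho (phi l)) -> (forall l, phi l (fun=> 0) = 0) ->
  (forall x y d, polydisc rho x -> polydisc rho y -> 0 <= d ->
     (forall j, nc (x j - y j) <= d) -> forall l, nc (phi l x - phi l y) <= d / 2) ->
  exists g : 'I_N -> ('I_N -> C) -> C, [/\ forall l, ulim (rho / 2) (g l),
    forall l, g l (fun=> 0) = 0,
    forall x, polydisc (rho / 3) x -> forall l, g l (fun j => x j + phi j x) = x l &
    forall y, polydisc (rho / 2) y -> forall l, g l y + phi l (fun j => g j y) = y l].
Proof.
move=> rho0 uphi phi0 lip.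
have [||||g [ug gs fixg]] := @contraction_fixpoint R 'I_N 'I_N (rho / 2) rho
  (fun l y v => y l - phi l v).
- exact: ltW.
- by move=> y yr l; rewrite phi0 subr0; exact: yr.
- move=> y v w d yr vs ws d0 vw l.
  have -> : y l - phi l v - (y l - phi l w) = phi l w - phi l v by ring.
  by rewrite ncB; exact: lip.
- move=> u uu us l; apply: ulimB; first exact: ulim_var.
  exact: (ulim_comp (uphi l) uu us).
have gh x : polydisc (rho / 3) x -> forall l, g l (fun j => x j + phi j x) = x l.
  move=> xr; set y := fun j => x j + phi j x.
  have xr' : polydisc rho x by move=> j; have := xr j; lra.
  have zr : polydisc rho (fun _ : 'I_N => 0 : C) by move=> j; rewrite nc0 ltW.
  have yr : polydisc (rho / 2) y.
    move=> j; have h := xr j; have := lip x (fun=> 0) (rho / 3) xr' zr _ _ j.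
    rewrite phi0 subr0 => {}h'; have := ncD (x j) (phi j x).
    have : nc (phi j x) <= rho / 3 / 2 by apply: h' => [|i]; rewrite ?subr0 //; lra.
    by lra.
  suff near_xg n l : nc (g l y - x l) <= 2 * rho * 2^-1 ^+ n.
    move=> l; apply: nc_small_eq => e e0.
    have [n hn] := @pow_half_small R (2 * rho) e e0.
    exact: le_trans (near_xg n l) hn.
  elim: n l => [|n IH] l.
    have := ncD (g l y) (- x l); rewrite ncN; have := gs y yr l; have := xr' l.
    by rewrite expr0; lra.
  rewrite (fixg y yr l) {1}/y.
  have -> : x l + phi l x - phi l (fun k => g k y) - x l = phi l x - phi l (fun k => g k y).
    by ring.
  have d0 : 0 <= 2 * rho * 2^-1 ^+ n by rewrite !mulr_ge0 ?exprn_ge0 // ltW.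
  rewrite ncB exprS; have := lip _ _ _ (gs y yr) xr' d0 IH l; lra.
exists g; split=> //.
  have E : (fun j => 0 + phi j (fun=> 0)) = (fun=> 0) :> ('I_N -> C).
    by apply/funext => j; rewrite phi0 addr0.
  move=> l; have := gh (fun=> 0) _ l; rewrite E; apply => j.
  by rewrite nc0 divr_ge0 // ltW.
by move=> y yr l; rewrite {1}(fixg y yr l) subrK.
Qed.

End Inverses.

(** * Second order expansion of the action *)

Section Taylor.
Variables (F : comNzRingType).

(** The difference quotients of the power map: [(x + p)^d = x^d + p dquot] and
    [dquot = d x^(d-1) + p dquot2]. *)
Definition dquot d (x p : F) : F := \sum_(i < d) (x + p) ^+ (d.-1 - i) * x ^+ i.
Definition dquot2 d (x p : F) : F := \sum_(i < d) dquot (d.-1 - i) x p * x ^+ i.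

Lemma dquotE d x p : (x + p) ^+ d = x ^+ d + p * dquot d x p.
Proof.
have := subrXX (x + p) x d; rewrite addrAC subrr add0r => E.
by rewrite /dquot -E [RHS]addrC subrK.
Qed.

Lemma dquot2E d x p : dquot d x p = d%:R * x ^+ d.-1 + p * dquot2 d x p.
Proof.
rewrite /dquot2 mulr_sumr; under [X in _ + X]eq_bigr do rewrite mulrA.
transitivity (\sum_(i < d) (x ^+ (d.-1 - i) * x ^+ i + p * dquot (d.-1 - i) x p * x ^+ i)).
  by apply: eq_bigr => i _; rewrite dquotE mulrDl.
rewrite big_split /=; congr (_ + _).
rewrite (eq_bigr (fun=> x ^+ d.-1)) => [|i _].
  by rewrite sumr_const card_ord mulr_natl.
by rewrite -exprD subnK //; case: d i => [[]|d] // i; rewrite -ltnS.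
Qed.

Variables (N m n d : nat) (A : 'I_N -> 'M[F]_(m, n)).
Definition Fmap (x : 'I_N -> F) : 'M[F]_(m, n) := \sum_l x l ^+ d *: A l.

(** Second order expansion, at the identity, of the action of the multipliers [1
    + be], [1 + al] and of the displacement [p]: the second summand is the
    tangent vector, and each term of the last one has two factors among [be],
    [al], [p]. *)
Lemma Fmap_expand (be : 'M[F]_m) (al : 'M[F]_n) (x p : 'I_N -> F) :
  (1%:M + be) *m Fmap (fun l => x l + p l) *m (1%:M + al) =
  Fmap x + (be *m Fmap x + Fmap x *m al + \sum_l (p l * (d%:R * x l ^+ d.-1)) *: A l) +
  (\sum_l (p l * (p l * dquot2 d (x l) (p l))) *: A l +
   \sum_l (p l * dquot d (x l) (p l)) *: (be *m A l + A l *m al) +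
   be *m (Fmap (fun l => x l + p l) *m al)).
Proof.
set F' := Fmap (fun l => x l + p l).
pose T := \sum_l (p l * dquot d (x l) (p l)) *: A l.
have EF' : F' = Fmap x + T.
  rewrite /F' /Fmap /T -big_split /=; apply: eq_bigr => l _.
  by rewrite dquotE scalerDl.
have ET : T = \sum_l (p l * (d%:R * x l ^+ d.-1)) *: A l +
              \sum_l (p l * (p l * dquot2 d (x l) (p l))) *: A l.
  rewrite /T -big_split /=; apply: eq_bigr => l _.
  by rewrite dquot2E mulrDr scalerDl.
have -> : \sum_l (p l * dquot d (x l) (p l)) *: (be *m A l + A l *m al) =
    be *m T + T *m al.
  rewrite /T mulmx_sumr mulmx_suml -big_split /=; apply: eq_bigr => l _.
  by rewrite scalerDr scalemxAr scalemxAl.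
rewrite mulmxDl mul1mx mulmxDr mulmx1 mulmxDl mulmxA.
move: (be *m F' *m al) => W.
have -> : be *m F' = be *m Fmap x + be *m T by rewrite EF' mulmxDr.
have -> : F' *m al = Fmap x *m al + T *m al by rewrite EF' mulmxDl.
have {1}-> : F' = Fmap x + (\sum_l (p l * (d%:R * x l ^+ d.-1)) *: A l +
    \sum_l (p l * (p l * dquot2 d (x l) (p l))) *: A l) by rewrite -ET.
move: (\sum_l _ *: _) (\sum_l _ *: _) (be *m T) (T *m al) (be *m _) (_ *m al) (Fmap x).
by move=> *; apply/matrixP => i j; rewrite !mxE; ring.
Qed.

End Taylor.

Section Tangent.
Variables (R : realType) (N m n d k : nat) (a : 'I_m * 'I_n * 'I_N -> R[i]).
Local Notation C := R[i].
Definition Amx l : 'M[C]_(m, n) := \matrix_(i, j) a (i, j, l).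

Lemma map_mx_tangent (B S : comNzRingType) (phi : {rmorphism B -> S})
    (be : 'M[B]_m) (al : 'M[B]_n) (L : 'M[B]_(m, n)) (psi X : 'I_N -> B)
    (A : 'I_N -> 'M[B]_(m, n)) :
  map_mx phi (be *m L + L *m al + \sum_l (psi l * X l) *: A l) =
  map_mx phi be *m map_mx phi L + map_mx phi L *m map_mx phi al +
  \sum_l (phi (psi l) * phi (X l)) *: map_mx phi (A l).
Proof.
rewrite map_mxD map_mxD !map_mxM; congr (_ + _).
apply/matrixP => i j; rewrite mxE !summxE raddf_sum; apply: eq_bigr => l _ /=.
by rewrite !mxE rmorphM rmorphM.
Qed.

(** The substitution [y_l = x_l^d] turns [y_l A_l] into [(x_l / d) dF/dx_l]. *)
Lemma tangent_functions (lam : 'I_N) (M : 'M[C]_(m, n)) : (0 < d)%N ->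
  GenericTangent.annihilator a ((mpoly.mpolyX C (mpoly.mnm1 lam)) ^+ k) ->
  exists (be : ('I_N -> C) -> 'M[C]_m) (al : ('I_N -> C) -> 'M[C]_n)
         (ph : 'I_N -> ('I_N -> C) -> C),
    [/\ forall i j, polyfun (fun x => be x i j),
        forall i j, polyfun (fun x => al x i j),
        forall l, polyfun (ph l) &
        forall x, x lam ^+ (d * k) *: M = be x *m Fmap d Amx x + Fmap d Amx x *m al x +
           \sum_l (ph l x * (d%:R * x l ^+ d.-1)) *: Amx l].
Proof.
move=> d0 /(_ (map_mx (@mpoly.mpolyC N C) M)) [be [al [psi E]]].
pose y (x : 'I_N -> C) l := x l ^+ d.
pose ev x : {rmorphism mpoly.mpoly N C -> C} := mpoly.meval (y x).
have pev p : polyfun (fun x => ev x p).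
  apply: (polyfun_comp (polyfun_meval p)) => l.
  exact/polyfunX/polyfun_var.
exists (fun x => map_mx (ev x) be), (fun x => map_mx (ev x) al),
  (fun l x => d%:R^-1 * x l * ev x (psi l)); split.
- by move=> i j; have := pev (be i j); congr polyfun; apply/funext => x; rewrite mxE.
- by move=> i j; have := pev (al i j); congr polyfun; apply/funext => x; rewrite mxE.
- move=> l; apply: polyfunM => //; apply: polyfunM; first exact: polyfun_const.
  exact: polyfun_var.
move=> x.
have coefE l : map_mx (ev x) (GenericTangent.coef_mx a l) = Amx l.
  by apply/matrixP => i j; rewrite !mxE /= mpoly.mevalC.
have linE : map_mx (ev x) (GenericTangent.linear_mx a) = Fmap d Amx x.
  rewrite /GenericTangent.linear_mx raddf_sum /=; apply: eq_bigr => l _.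
  by rewrite map_mxZ coefE /= mpoly.mevalXU.
have MpolyC : map_mx (ev x) (map_mx (@mpoly.mpolyC N C) M) = M.
  by apply/matrixP => i j; rewrite !mxE /= mpoly.mevalC.
have evX l : ev x (mpoly.mpolyX C (mpoly.mnm1 l)) = x l ^+ d.
  by rewrite /= mpoly.mevalXU.
have := congr1 (map_mx (ev x)) E.
rewrite (map_mx_tangent (ev x)) map_mxZ rmorphXn linE MpolyC evX -exprM => ->.
congr (_ + _); apply: eq_bigr => l _; rewrite coefE evX; congr (_ *: _).
rewrite -{1}(prednK d0) exprS.
have dn : d%:R != 0 :> C by rewrite pnatr_eq0 -lt0n.
by field.
Qed.

End Tangent.

Section Quadratic.
Variables (R : realType) (N : nat) (M : Type).
Local Notation C := R[i].
Implicit Types (f g h : ('I_N -> C) -> (M -> C) -> C).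

(** In [h x v], [x] is the point and [v] the unknown. The quadratic functions
    are those which satisfy the Lipschitz estimate of a product of two functions
    vanishing at [v = 0]: the constant tends to [0] with the size of [v]. *)
Definition joint h := polyfun (fun w : 'I_N + M -> C =>
  h (fun i => w (inl i)) (fun k => w (inr k))).
Definition vanishing h := joint h /\ forall x, h x (fun=> 0) = 0.
Definition quadratic h := vanishing h /\ exists2 K : R, 0 <= K & forall x v w s dd,
  polydisc 1 x -> 0 <= s -> s <= 1 -> polydisc s v -> polydisc s w -> 0 <= dd ->
  (forall k, nc (v k - w k) <= dd) -> nc (h x v - h x w) <= K * s * dd.

Lemma joint_x (p : ('I_N -> C) -> C) : polyfun p -> joint (fun x _ => p x).
Proof. by move=> pf; apply: (polyfun_comp pf) => i; exact: polyfun_var. Qed.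
Lemma joint_v k : joint (fun _ v => v k). Proof. exact: polyfun_var. Qed.
Lemma joint_const c : joint (fun _ _ => c). Proof. exact: polyfun_const. Qed.
Lemma jointD f g : joint f -> joint g -> joint (fun x v => f x v + g x v).
Proof. exact: polyfunD. Qed.
Lemma jointM f g : joint f -> joint g -> joint (fun x v => f x v * g x v).
Proof. exact: polyfunM. Qed.
Lemma jointX f k : joint f -> joint (fun x v => f x v ^+ k).
Proof. exact: polyfunX. Qed.
Lemma joint_sum (I : Type) (r : seq I) (P : pred I) F : (forall i, joint (F i)) ->
  joint (fun x v => \sum_(i <- r | P i) F i x v).
Proof. by move=> jF; apply: polyfun_sum => i; exact: jF. Qed.
Lemma eq_joint f g : (forall x v, f x v = g x v) -> joint f -> joint g.
Proof. by move=> E; congr polyfun; apply/funext => w; rewrite E. Qed.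

Lemma vanishingD f g : vanishing f -> vanishing g -> vanishing (fun x v => f x v + g x v).
Proof.
move=> [jf f0] [jg g0]; split; first exact: jointD.
by move=> x; rewrite f0 g0 addr0.
Qed.
Lemma vanishingMl f g : vanishing f -> joint g -> vanishing (fun x v => f x v * g x v).
Proof. by move=> [jf f0] jg; split; [exact: jointM|move=> x; rewrite f0 mul0r]. Qed.
Lemma vanishingMr f g : joint f -> vanishing g -> vanishing (fun x v => f x v * g x v).
Proof. by move=> jf [jg g0]; split; [exact: jointM|move=> x; rewrite g0 mulr0]. Qed.
Lemma vanishing_v k : vanishing (fun _ v => v k). Proof. by split; first exact: joint_v. Qed.
Lemma vanishing_sum (I : Type) (r : seq I) (P : pred I) F : (forall i, vanishing (F i)) ->
  vanishing (fun x v => \sum_(i <- r | P i) F i x v).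
Proof.
move=> vF; split; first by apply: joint_sum => i; have [] := vF i.
by move=> x; rewrite big1 // => i _; have [_ ->] := vF i.
Qed.
Lemma eq_vanishing f g : (forall x v, f x v = g x v) -> vanishing f -> vanishing g.
Proof. by move=> E [jf f0]; split; [exact: eq_joint jf|move=> x; rewrite -E]. Qed.

Lemma quadraticM f g : vanishing f -> vanishing g -> quadratic (fun x v => f x v * g x v).
Proof.
move=> vf vg; have [jf f0] := vf; have [jg g0] := vg; split.
  by apply: vanishingMl.
have [L L0 HL] := polyfun_lipschitz 1 jf; have [L' L'0 HL'] := polyfun_lipschitz 1 jg.
exists (2 * L * L'); first by rewrite !mulr_ge0.
move=> x v w s dd x1 s0 s1 vs ws dd0 vw.
have lip h H : (forall w1 w2 d, polydisc 1 w1 -> polydisc 1 w2 -> 0 <= d ->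
     (forall j, nc (w1 j - w2 j) <= d) ->
     nc (h (fun i => w1 (inl i)) (fun k => w1 (inr k)) -
         h (fun i => w2 (inl i)) (fun k => w2 (inr k))) <= H * d) ->
   forall v1 v2 d, polydisc s v1 -> polydisc s v2 -> 0 <= d ->
     (forall j, nc (v1 j - v2 j) <= d) -> nc (h x v1 - h x v2) <= H * d.
  move=> hyp v1 v2 d v1s v2s d0 v12.
  pose glue (v' : M -> C) (j : 'I_N + M) := match j with inl i => x i | inr k => v' k end.
  have glue1 v' : polydisc s v' -> polydisc 1 (glue v').
    by move=> v's [i|k] //=; apply: le_trans (v's k) s1.
  apply: (hyp (glue v1) (glue v2)) => //; try exact: glue1.
  by move=> [i|k] /=; rewrite ?subrr ?nc0.
have zs : polydisc s (fun _ : M => 0 : C) by move=> k; rewrite nc0.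
have fb v' : polydisc s v' -> nc (f x v') <= L * s.
  move=> v's; have := lip f L HL v' (fun=> 0) s v's zs s0; rewrite f0 subr0; apply.
  by move=> j; rewrite subr0.
have gb v' : polydisc s v' -> nc (g x v') <= L' * s.
  move=> v's; have := lip g L' HL' v' (fun=> 0) s v's zs s0; rewrite g0 subr0; apply.
  by move=> j; rewrite subr0.
have hf := lip f L HL v w dd vs ws dd0 vw; have hg := lip g L' HL' v w dd vs ws dd0 vw.
have -> : f x v * g x v - f x w * g x w =
   f x v * (g x v - g x w) + g x w * (f x v - f x w) by ring.
have -> : 2 * L * L' * s * dd = L * s * (L' * dd) + L' * s * (L * dd) by ring.
apply: le_trans (ncD _ _) _; rewrite !ncM.
by apply: lerD; apply: ler_pM; rewrite ?nc_ge0 //; [exact: fb|exact: gb].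
Qed.

Lemma quadraticD f g : quadratic f -> quadratic g -> quadratic (fun x v => f x v + g x v).
Proof.
move=> [vf [K K0 HK]] [vg [K' K'0 HK']]; split; first exact: vanishingD.
exists (K + K'); first exact: addr_ge0.
move=> x v w s dd x1 s0 s1 vs ws dd0 vw.
rewrite opprD addrACA; apply: le_trans (ncD _ _) _; rewrite !mulrDl.
by apply: lerD; [apply: HK|apply: HK'].
Qed.

Lemma quadratic_sum (I : Type) (r : seq I) F : (forall i, quadratic (F i)) ->
  quadratic (fun x v => \sum_(i <- r) F i x v).
Proof.
move=> qF; elim: r => [|i r IH].
  split; first by apply: vanishing_sum => i; have [] := qF i.
  by exists 0 => // x v w s dd _ _ _ _ _ _ _; rewrite !big_nil subrr nc0 !mul0r.
have := quadraticD (qF i) IH; congr quadratic.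
by apply/funext => x; apply/funext => v; rewrite big_cons.
Qed.

Lemma eq_quadratic f g : (forall x v, f x v = g x v) -> quadratic f -> quadratic g.
Proof. by move=> E; congr quadratic; apply/funext => x; apply/funext => v. Qed.

Lemma joint_ulim rho h (u : M -> ('I_N -> C) -> C) : joint h ->
  (forall k, ulim rho (u k)) -> ulim rho (fun x => h x (fun k => u k x)).
Proof.
move=> jh uu.
apply: (ulim_poly_comp (h := fun j : 'I_N + M => match j with
   inl i => fun x => x i | inr k => u k end) jh).
by case=> [i|k]; [exact: ulim_var|exact: uu].
Qed.

End Quadratic.

(** * Solution of the determinacy equation *)

Section Equation.
Variables (R : realType) (N m n d K : nat).
Local Notation C := R[i].
Local Notation T := ('I_N * 'I_m * 'I_n)%type.
Variables (A : 'I_N -> 'M[C]_(m, n)).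
Variables (BE : T -> ('I_N -> C) -> 'M[C]_m) (AL : T -> ('I_N -> C) -> 'M[C]_n)
          (PH : T -> 'I_N -> ('I_N -> C) -> C).
Hypotheses (pBE : forall t i j, polyfun (fun x => BE t x i j))
           (pAL : forall t i j, polyfun (fun x => AL t x i j))
           (pPH : forall t l, polyfun (PH t l)).
Hypothesis tangentE : forall (lam : 'I_N) i j x, x lam ^+ K *: delta_mx i j =
  BE (lam, i, j) x *m Fmap d A x + Fmap d A x *m AL (lam, i, j) x +
  \sum_l (PH (lam, i, j) l x * (d%:R * x l ^+ d.-1)) *: A l.

Local Notation M := ('I_N * T)%type.
Implicit Types (x : 'I_N -> C) (v : M -> C) (mu nu l : 'I_N).

(** The unknown has one coordinate [v (mu, (lam, i, j))] for each [mu] and each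
    tangent vector [x_lam^K E_ij]: the perturbations of the identity are
    [\sum_mu x_mu^K \sum_t v (mu, t)] times the data of the tangent vector [t].
    *)
Definition left_comp mu x v := \sum_(t : T) v (mu, t) *: BE t x.
Definition right_comp mu x v := \sum_(t : T) v (mu, t) *: AL t x.
Definition move_comp mu l x v := \sum_(t : T) v (mu, t) * PH t l x.
Definition left_pert x v := \sum_mu x mu ^+ K *: left_comp mu x v.
Definition right_pert x v := \sum_mu x mu ^+ K *: right_comp mu x v.
Definition displacement l x v := \sum_mu x mu ^+ K * move_comp mu l x v.
Definition displaced_map x v := Fmap d A (fun l => x l + displacement l x v).
Definition quot1 l x v := dquot d (x l) (displacement l x v).
Definition quot2 l x v := dquot2 d (x l) (displacement l x v).
(** The coefficient of [x_mu^K x_nu^K] in the second order terms of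
    [Fmap_expand]. *)
Definition quad_comp mu nu x v : 'M[C]_(m, n) :=
  \sum_l (move_comp mu l x v * (move_comp nu l x v * quot2 l x v)) *: A l +
  \sum_l (move_comp mu l x v * quot1 l x v) *: (left_comp nu x v *m A l + A l *m right_comp nu x v) +
  left_comp mu x v *m (displaced_map x v *m right_comp nu x v).

Lemma remainderE x v :
  \sum_l (displacement l x v * (displacement l x v * quot2 l x v)) *: A l +
  \sum_l (displacement l x v * quot1 l x v) *: (left_pert x v *m A l + A l *m right_pert x v) +
  left_pert x v *m (displaced_map x v *m right_pert x v) =
  \sum_mu \sum_nu (x mu ^+ K * x nu ^+ K) *: quad_comp mu nu x v.
Proof.
under [RHS]eq_bigr => mu _ do under eq_bigr => nu _ do rewrite /quad_comp !scalerDr.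
under [RHS]eq_bigr => mu _ do rewrite big_split big_split.
rewrite big_split big_split /=; congr (_ + _ + _).
- under [RHS]eq_bigr => mu _ do under eq_bigr => nu _ do rewrite scaler_sumr.
  under [RHS]eq_bigr => mu _ do rewrite exchange_big.
  rewrite [RHS]exchange_big; apply: eq_bigr => l _ /=.
  under [RHS]eq_bigr => mu _ do under eq_bigr => nu _ do rewrite scalerA.
  under [RHS]eq_bigr => mu _ do rewrite -scaler_suml.
  rewrite -scaler_suml; congr (_ *: _).
  rewrite {1}/displacement mulr_suml; apply: eq_bigr => mu _.
  rewrite {1}/displacement mulr_suml mulr_sumr; apply: eq_bigr => nu _; ring.
- under [RHS]eq_bigr => mu _ do under eq_bigr => nu _ do rewrite scaler_sumr.
  under [RHS]eq_bigr => mu _ do rewrite exchange_big.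
  rewrite [RHS]exchange_big; apply: eq_bigr => l _ /=.
  have -> : left_pert x v *m A l + A l *m right_pert x v =
      \sum_nu x nu ^+ K *: (left_comp nu x v *m A l + A l *m right_comp nu x v).
    rewrite /left_pert /right_pert mulmx_suml mulmx_sumr -big_split; apply: eq_bigr => nu _ /=.
    by rewrite -scalemxAl -scalemxAr scalerDr.
  rewrite {1}/displacement !mulr_suml scaler_suml; apply: eq_bigr => mu _.
  rewrite scaler_sumr; apply: eq_bigr => nu _; rewrite !scalerA; congr (_ *: _); ring.
rewrite {1}/left_pert mulmx_suml; apply: eq_bigr => mu _.
rewrite {1}/right_pert !mulmx_sumr; apply: eq_bigr => nu _.
by rewrite -!scalemxAr -scalemxAl scalerA mulrC.
Qed.

Definition unknown_mx mu lam v : 'M[C]_(m, n) := \matrix_(i, j) v (mu, (lam, i, j)).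

(** Each [t = (lam, i, j)] contributes [x_mu^K v (mu, t)] times its tangent
    vector, which is [x_lam^K E_ij]. *)
Lemma linear_partE x v :
  left_pert x v *m Fmap d A x + Fmap d A x *m right_pert x v +
    \sum_l (displacement l x v * (d%:R * x l ^+ d.-1)) *: A l =
  \sum_mu \sum_lam (x mu ^+ K * x lam ^+ K) *: unknown_mx mu lam v.
Proof.
set Fx := Fmap d A x.
transitivity (\sum_mu x mu ^+ K *: \sum_(t : T) v (mu, t) *:
   (BE t x *m Fx + Fx *m AL t x + \sum_l (PH t l x * (d%:R * x l ^+ d.-1)) *: A l)).
  rewrite /left_pert /right_pert mulmx_suml mulmx_sumr -big_split /=.
  have -> : \sum_l (displacement l x v * (d%:R * x l ^+ d.-1)) *: A l =
    \sum_mu x mu ^+ K *: \sum_(t : T) v (mu, t) *: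
      \sum_l (PH t l x * (d%:R * x l ^+ d.-1)) *: A l.
    under [RHS]eq_bigr => mu _ do
      (under eq_bigr => t _ do rewrite scaler_sumr; rewrite exchange_big scaler_sumr).
    rewrite [RHS]exchange_big; apply: eq_bigr => l _ /=.
    rewrite /displacement mulr_suml scaler_suml; apply: eq_bigr => mu _.
    rewrite /move_comp -mulrA mulr_suml mulr_sumr scaler_suml scaler_sumr; apply: eq_bigr => t _.
    by rewrite !scalerA -!mulrA.
  rewrite -big_split; apply: eq_bigr => mu _ /=.
  rewrite -scalemxAl -scalemxAr -!scalerDr /left_comp /right_comp; congr (_ *: _).
  rewrite mulmx_suml mulmx_sumr -!big_split; apply: eq_bigr => t _ /=.
  by rewrite -scalemxAl -scalemxAr -!scalerDr.
apply: eq_bigr => mu _.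
transitivity (x mu ^+ K *: \sum_(lam < N) x lam ^+ K *: unknown_mx mu lam v).
  congr (_ *: _).
  transitivity (\sum_(t : T) (v (mu, t) * x t.1.1 ^+ K) *: delta_mx t.1.2 t.2 : 'M[C]_(m, n)).
    by apply: eq_bigr => -[[lam i] j] _ /=; rewrite -tangentE scalerA.
  transitivity (\sum_(lam < N) \sum_(i < m) \sum_(j < n)
      (v (mu, (lam, i, j)) * x lam ^+ K) *: delta_mx i j : 'M[C]_(m, n)).
    by rewrite pair_bigA /= pair_bigA /=; apply: eq_bigr => -[[lam i] j].
  apply: eq_bigr => lam _; rewrite [unknown_mx _ _ _]matrix_sum_delta scaler_sumr.
  apply: eq_bigr => i _; rewrite scaler_sumr; apply: eq_bigr => j _.
  by rewrite scalerA mxE mulrC.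
by rewrite scaler_sumr; apply: eq_bigr => lam _; rewrite scalerA.
Qed.

Lemma vanishing_left_comp mu i j : vanishing (fun x v => left_comp mu x v i j).
Proof.
apply: (@eq_vanishing _ _ _ (fun x v => \sum_(t : T) v (mu, t) * BE t x i j)).
  by move=> x v; rewrite summxE; apply: eq_bigr => t _; rewrite mxE.
apply: vanishing_sum => t; apply: vanishingMl; [exact: vanishing_v|exact/joint_x].
Qed.
Lemma vanishing_right_comp mu i j : vanishing (fun x v => right_comp mu x v i j).
Proof.
apply: (@eq_vanishing _ _ _ (fun x v => \sum_(t : T) v (mu, t) * AL t x i j)).
  by move=> x v; rewrite summxE; apply: eq_bigr => t _; rewrite mxE.
apply: vanishing_sum => t; apply: vanishingMl; [exact: vanishing_v|exact/joint_x].
Qed.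
Lemma vanishing_move_comp mu l : vanishing (move_comp mu l).
Proof. by apply: vanishing_sum => t; apply: vanishingMl; [exact: vanishing_v|exact/joint_x]. Qed.

Lemma joint_var l : joint (fun x (v : M -> C) => x l).
Proof. exact/joint_x/polyfun_var. Qed.

Lemma joint_displacement l : joint (displacement l).
Proof.
apply: joint_sum => mu; apply: jointM; first exact/jointX/joint_var.
by have [] := vanishing_move_comp mu l.
Qed.

Lemma joint_dquot k l : joint (fun x v => dquot k (x l) (displacement l x v)).
Proof.
apply: joint_sum => i; apply: jointM; apply: jointX; last exact: joint_var.
by apply: jointD; [exact: joint_var|exact: joint_displacement].
Qed.

Lemma joint_quot2 l : joint (quot2 l).
Proof.
apply: joint_sum => i; apply: jointM; first exact: joint_dquot.
exact/jointX/joint_var.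
Qed.

Lemma joint_displaced_map i j : joint (fun x v => displaced_map x v i j).
Proof.
apply: (@eq_joint _ _ _ (fun x v => \sum_l (x l + displacement l x v) ^+ d * A l i j)).
  by move=> x v; rewrite summxE; apply: eq_bigr => l _; rewrite mxE.
apply: joint_sum => l; apply: jointM; last exact: joint_const.
by apply: jointX; apply: jointD; [exact: joint_var|exact: joint_displacement].
Qed.

Lemma quadratic_quad_comp mu nu i j : quadratic (fun x v => quad_comp mu nu x v i j).
Proof.
apply: (@eq_quadratic _ _ _ (fun x v =>
  \sum_l move_comp mu l x v * (move_comp nu l x v * (quot2 l x v * A l i j)) +
  \sum_l move_comp mu l x v * (quot1 l x v * (\sum_k left_comp nu x v i k * A l k j +
                                     \sum_k A l i k * right_comp nu x v k j)) +
  \sum_k left_comp mu x v i k * (\sum_k' displaced_map x v k k' * right_comp nu x v k' j))).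
  move=> x v; rewrite /quad_comp mxE mxE !summxE mxE; congr (_ + _ + _).
  - by apply: eq_bigr => l _; rewrite mxE !mulrA.
  - by apply: eq_bigr => l _; rewrite mxE mxE !mxE !mulrA.
  - by apply: eq_bigr => k _; rewrite [(displaced_map x v *m _) _ _]mxE.
apply: quadraticD; first apply: quadraticD.
- apply: quadratic_sum => l; apply: quadraticM; first exact: vanishing_move_comp.
  apply: vanishingMl; first exact: vanishing_move_comp.
  by apply: jointM; [exact: joint_quot2|exact: joint_const].
- apply: quadratic_sum => l; apply: quadraticM; first exact: vanishing_move_comp.
  apply: vanishingMr; first exact: joint_dquot.
  apply: vanishingD; apply: vanishing_sum => k.
    by apply: vanishingMl; [exact: vanishing_left_comp|exact: joint_const].
  by apply: vanishingMr; [exact: joint_const|exact: vanishing_right_comp].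
- apply: quadratic_sum => k; apply: quadraticM; first exact: vanishing_left_comp.
  by apply: vanishing_sum => k'; apply: vanishingMr; [exact: joint_displaced_map|exact: vanishing_right_comp].
Qed.

(** Comparing the coefficients of [x_mu^K x_lam^K] reduces the equation to
    [unknown_mx mu lam v = delta_(lam mu) e_lam - quad_comp mu lam x v]. The
    right-hand side is a contraction on small unknowns because [quad_comp] is
    quadratic, and it is small at [v = 0] because [e] vanishes at [0]. *)
Theorem solve_equation rho (e : 'I_N -> 'I_m -> 'I_n -> ('I_N -> C) -> C) :
  0 < rho -> (forall lam i j, ulim rho (e lam i j)) ->
  (forall lam i j, e lam i j (fun=> 0) = 0) ->
  exists r (u : M -> ('I_N -> C) -> C), [/\ 0 < r, r <= rho,
    forall k, ulim r (u k), forall k, u k (fun=> 0) = 0 &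
    forall x, polydisc r x -> let v := fun k => u k x in
      (1%:M + left_pert x v) *m displaced_map x v *m (1%:M + right_pert x v) =
      Fmap d A x + \sum_lam x lam ^+ (2 * K) *: \matrix_(i, j) e lam i j x].
Proof.
move=> rho0 ue e0.
have := quadratic_quad_comp; have := remainderE; move: quad_comp => Q remQ quadQ.
have /choice [Kq hKq] : forall q : 'I_N * 'I_N * 'I_m * 'I_n, exists K0 : R, 0 <= K0 /\
   forall x v w s dd, polydisc 1 x -> 0 <= s -> s <= 1 -> polydisc s v -> polydisc s w ->
   0 <= dd -> (forall k, nc (v k - w k) <= dd) ->
   nc (Q q.1.1.1 q.1.1.2 x v q.1.2 q.2 - Q q.1.1.1 q.1.1.2 x w q.1.2 q.2) <= K0 * s * dd.
  move=> [[[mu nu] i] j] /=; have [_ [K0 K00 HK]] := quadQ mu nu i j.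
  by exists K0.
pose K0 := \sum_q Kq q.
have K00 : 0 <= K0 by apply: sumr_ge0 => q _; have [] := hKq q.
have KqK0 q : Kq q <= K0.
  rewrite /K0 (bigD1 q) //= lerDl; apply: sumr_ge0 => q' _; have [] := hKq q'; by [].
pose s : R := Num.min 1 (2 * (K0 + 1))^-1.
have s0 : 0 < s by rewrite lt_min ltr01 invr_gt0; lra.
have s1 : s <= 1 by rewrite ge_min lexx.
have sK : K0 * s <= 2^-1.
  have : s * (2 * (K0 + 1)) <= 1.
    by rewrite -ler_pdivlMr ?mul1r ?ge_min ?lexx ?orbT //; lra.
  by nra.
have rho1 : 0 < Num.min rho 1 by rewrite lt_min rho0 ltr01.
have [||r [r0 rr hr]] := @common_radius R _ (fun (q : 'I_N * 'I_m * 'I_n) r =>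
   forall x, polydisc r x -> nc (e q.1.1 q.1.2 q.2 x) <= s / 2) _ _ rho1.
- by move=> q r r' le H x xr; apply: H => j; exact: le_trans (xr j) le.
- by move=> [[lam i] j] /=; apply: ulim_small (ue lam i j) (e0 lam i j) _ => //; lra.
have rrho : r <= rho by move: rr; rewrite le_min => /andP [].
have r1 : r <= 1 by move: rr; rewrite le_min => /andP [].
have Q0 mu nu i j x : Q mu nu x (fun=> 0) i j = 0.
  by have [[_ H] _] := quadQ mu nu i j; exact: H.
have ncb (b : bool) (z : C) t : 0 <= t -> nc z <= t -> nc (b%:R * z) <= t.
  by case: b => t0 zt; rewrite ?mul1r ?mul0r ?nc0.
pose Phi (k : M) (x : 'I_N -> C) (v : M -> C) : C :=
  let: (mu, (lam, i, j)) := k in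
  (lam == mu)%:R * e lam i j x - Q mu lam x v i j.
have [||||u [uu us fixu]] := @contraction_fixpoint R 'I_N M r s Phi.
- exact: ltW.
- move=> x xr [mu [[lam i] j]] /=; rewrite Q0 subr0; apply: ncb.
    by rewrite divr_ge0 // ltW.
  exact: (hr (lam, i, j)).
- move=> x v w dd xr vs ws dd0 vw [mu [[lam i] j]] /=.
  have opp_sub (z q q' : C) : z - q - (z - q') = - (q - q') by ring.
  rewrite opp_sub.
  rewrite ncN; have x1 : polydisc 1 x by move=> l; exact: le_trans (xr l) r1.
  have [Kq0 HK] := hKq (mu, lam, i, j).
  have := HK x v w s dd x1 (ltW s0) s1 vs ws dd0 vw => /= h.
  apply: le_trans h _; rewrite [dd / 2]mulrC ler_wpM2r //; apply: le_trans sK.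
  by rewrite ler_wpM2r ?(ltW s0).
- move=> u uu us [mu [[lam i] j]] /=; apply: ulimB.
    by apply: ulimM; [exact: ulim_const|exact: ulim_mono rrho (ue lam i j)].
  by have [[jq _] _] := quadQ mu lam i j; exact: (joint_ulim jq uu).
have z0 : polydisc r (fun _ : 'I_N => 0 : C) by move=> j; rewrite nc0 ltW.
exists r, u; split=> //.
  (* at x = 0, where e vanishes, v = 0 is the only fixed point *)
  suff near0 p k : nc (u k (fun=> 0)) <= s * 2^-1 ^+ p.
    move=> k; apply: nc_small_eq => eps eps0; rewrite subr0.
    have [p hp] := @pow_half_small R s eps eps0; exact: le_trans (near0 p k) hp.
  elim: p k => [|p IH] k; first by rewrite mulr1; exact: us _ z0 k.
  rewrite (fixu _ z0); case: k => mu [[lam i] j] /=; rewrite e0 mulr0 sub0r ncN.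
  set w := (fun k' : M => u k' (fun=> 0)).
  have x1 : polydisc 1 (fun _ : 'I_N => 0 : C) by move=> l; rewrite nc0.
  have [Kq0 HK] := hKq (mu, lam, i, j).
  have zs : polydisc s (fun _ : M => 0 : C) by move=> k; rewrite nc0 ltW.
  have p0 : 0 <= s * 2^-1 ^+ p by rewrite mulr_ge0 ?exprn_ge0 // ltW.
  have := HK (fun=> 0) w (fun=> 0) s _ x1 (ltW s0) s1 (us _ z0) zs p0 => /=; rewrite Q0 subr0 => h.
  apply: le_trans (h _) _; first by move=> k; rewrite subr0; exact: IH.
  rewrite exprS [leRHS]mulrCA ler_wpM2r //; apply: le_trans sK.
  by rewrite ler_wpM2r ?(ltW s0).
move=> x xr v; rewrite Fmap_expand remQ linear_partE -addrA -big_split.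
congr (_ + _); apply: eq_bigr => mu _ /=; rewrite -big_split /=.
have VQ lam : unknown_mx mu lam v + Q mu lam x v = (lam == mu)%:R *: \matrix_(i, j) e lam i j x.
  apply/matrixP => i j; rewrite mxE [unknown_mx _ _ _ _ _]mxE {1}/v (fixu x xr) /= subrK.
  by rewrite !mxE.
rewrite (bigD1 mu) //= big1 ?addr0 => [|lam ne].
  by rewrite -scalerDr mul2n -addnn exprD VQ eqxx scale1r.
by rewrite -scalerDr VQ (negPf ne) scale0r scaler0.
Qed.

End Equation.

(** * Finite determinacy *)

Section Determinacy.
Variables (R : realType) (N m n : nat).
Local Notation C := R[i].
Local Notation K := (complex_field R).
Local Notation multi := (mpoly.multinom N).

Lemma pseriesB rho rho' f g (c c' : multi -> C) : 0 < rho -> 0 < rho' ->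
  pseries rho f c -> pseries rho' g c' ->
  pseries (Num.min rho rho') (fun x => f x - g x) (fun al => c al - c' al).
Proof.
move=> rho0 rho'0 [[A HA] Hf] [[A' HA'] Hg]; split.
  exists (A + A') => k; apply: le_trans (lerD (HA k) (HA' k)).
  rewrite /abs_sum -big_split; apply: ler_sum => al _ /=.
  have r0 : 0 <= Num.min rho rho' by rewrite le_min !ltW.
  apply: (@le_trans _ _ ((nc (c al) + nc (c' al)) * Num.min rho rho' ^+ mpoly.mdeg al)).
    rewrite ler_wpM2r ?exprn_ge0 //; apply: le_trans (ncD _ _) _.
    by rewrite ncN.
  by rewrite mulrDl; apply: lerD; rewrite ler_wpM2l ?nc_ge0 //; apply: lerXn2r;
     rewrite ?nnegrE ?(ltW rho0) ?(ltW rho'0) // ge_min lexx ?orbT.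
move=> x xr e e0.
have xr1 : polydisc rho x by move=> j; apply: le_trans (xr j) _; rewrite ge_min lexx.
have xr2 : polydisc rho' x by move=> j; apply: le_trans (xr j) _; rewrite ge_min lexx orbT.
have e2 : 0 < e / 2 by lra.
have [k1 h1] := Hf x xr1 _ e2; have [k2 h2] := Hg x xr2 _ e2.
exists (maxn k1 k2) => k; rewrite geq_max => /andP [/h1 {}h1 /h2 {}h2].
have -> : part_sum (fun al => c al - c' al) k x = part_sum c k x - part_sum c' k x.
  by rewrite /part_sum -sumrB; apply: eq_bigr => al _; rewrite mulrBl.
have -> : f x - g x - (part_sum c k x - part_sum c' k x) =
  (f x - part_sum c k x) - (g x - part_sum c' k x) by ring.
by apply: le_trans (ncD _ _) _; rewrite ncN; lra.
Qed.

(** A function which vanishes to order two at [0] is [1/2]-Lipschitz near [0].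
    *)
Lemma small_perturbation rho (G : 'I_N -> 'I_N -> ('I_N -> C) -> C) : 0 < rho ->
  (forall l mu, ulim rho (G l mu)) -> (forall l mu, G l mu (fun=> 0) = 0) ->
  exists r, [/\ 0 < r, r <= rho &
    forall x y d, polydisc r x -> polydisc r y -> 0 <= d ->
     (forall j, nc (x j - y j) <= d) -> forall l,
     nc (\sum_mu x mu * G l mu x - \sum_mu y mu * G l mu y) <= d / 2].
Proof.
move=> rho0 uG G0.
have /choice [L hL] : forall q : 'I_N * 'I_N, exists L : R, 0 <= L /\
    forall x y d, polydisc (rho / 8) x -> polydisc (rho / 8) y ->
    0 <= d -> (forall j, nc (x j - y j) <= d) -> nc (G q.1 q.2 x - G q.1 q.2 y) <= L * d.
  by move=> q; have [L L0 HL] := ulim_lipschitz rho0 (uG q.1 q.2); exists L.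
pose S := \sum_l \sum_mu L (l, mu).
have S0 : 0 <= S.
  by apply: sumr_ge0 => l _; apply: sumr_ge0 => mu _; have [] := hL (l, mu).
pose r := Num.min (rho / 8) (4 * (S + 1))^-1.
have r0 : 0 < r by rewrite lt_min divr_gt0 ?invr_gt0 //=; lra.
have r8 : r <= rho / 8 by rewrite ge_min lexx.
have rS : r * (4 * (S + 1)) <= 1.
  by rewrite -ler_pdivlMr ?mul1r ?ge_min ?lexx ?orbT //; lra.
exists r; split=> //; first by lra.
move=> x y d xr yr d0 xy l.
have x8 : polydisc (rho / 8) x by move=> j; exact: le_trans (xr j) r8.
have y8 : polydisc (rho / 8) y by move=> j; exact: le_trans (yr j) r8.
have z8 : polydisc (rho / 8) (fun _ : 'I_N => 0 : C) by move=> j; rewrite nc0; lra.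
have h1 mu : nc (x mu * G l mu x - y mu * G l mu y) <= L (l, mu) * (2 * r * d).
  have [L0 HL] := hL (l, mu).
  have -> : x mu * G l mu x - y mu * G l mu y =
    (x mu - y mu) * G l mu x + y mu * (G l mu x - G l mu y) by ring.
  have g1 : nc (G l mu x) <= L (l, mu) * r.
    have := HL x (fun=> 0) r x8 z8 (ltW r0); rewrite /= G0 subr0; apply => j.
    by rewrite subr0; exact: xr.
  have g2 := HL x y d x8 y8 d0 xy.
  have -> : L (l, mu) * (2 * r * d) = d * (L (l, mu) * r) + r * (L (l, mu) * d) by ring.
  apply: le_trans (ncD _ _) _; rewrite !ncM.
  by apply: lerD; apply: ler_pM; rewrite ?nc_ge0 //.
rewrite -sumrB; apply: le_trans (nc_sum _ _ _) _.
apply: (@le_trans _ _ (\sum_mu L (l, mu) * (2 * r * d))).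
  by apply: ler_sum => mu _; exact: h1.
rewrite -mulr_suml.
have LS : \sum_mu L (l, mu) <= S.
  rewrite /S [leRHS](bigD1 l) //= lerDl.
  by apply: sumr_ge0 => l' _; apply: sumr_ge0 => mu _; have [] := hL (l', mu).
apply: (@le_trans _ _ (S * (2 * r * d))).
  by rewrite ler_wpM2r // !mulr_ge0 // ltW.
have : S * (2 * r) <= 2^-1 by nra.
move=> h; have := ler_wpM2r d0 h; lra.
Qed.

Lemma on_fun0 (f : ('I_N -> C) -> C) : on_fun (fun x : 'rV[K]_N => f (x 0)) = f.
Proof.
apply/funext => v; rewrite /on_fun; congr f; apply/funext => i.
by rewrite mxE.
Qed.

Lemma analytic_of_ulim p q rho (B : ('I_N -> C) -> 'M[C]_(p, q)) : 0 < rho ->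
  (forall i j, ulim rho (fun x => B x i j)) ->
  analytic_mx_germ (fun x : 'rV[K]_N => B (x 0) : 'M[K]_(p, q)).
Proof.
move=> rho0 uB i j; apply: (ulim_analytic rho0).
have -> : on_fun (fun x : 'rV[K]_N => B (x 0) i j) = (fun x => B x i j).
  exact: (on_fun0 (fun x => B x i j)).
exact: uB.
Qed.

Variables (d k : nat) (a : 'I_m * 'I_n * 'I_N -> C).
Hypotheses (N_gt0 : (0 < N)%N) (d_gt0 : (0 < d)%N) (k_gt1 : (1 < k)%N).
Hypothesis annih : forall lam,
  GenericTangent.annihilator a ((mpoly.mpolyX C (mpoly.mnm1 lam)) ^+ k).

Lemma L_E (x : 'rV[K]_N) : @L_ K N m n d a x = Fmap d (Amx a) (x 0).
Proof.
apply/matrixP => i j; rewrite mxE summxE; apply: eq_bigr => l _.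
by rewrite !mxE mulrC.
Qed.

Lemma polyfun_Fmap i j : polyfun (fun x => Fmap d (Amx a) x i j).
Proof.
have -> : (fun x => Fmap d (Amx a) x i j) = (fun x => \sum_l x l ^+ d * Amx a l i j).
  by apply/funext => x; rewrite summxE; apply: eq_bigr => l _; rewrite mxE.
apply: polyfun_sum => l; apply: polyfunM; last exact: polyfun_const.
exact/polyfunX/polyfun_var.
Qed.

Let kk := (d * k)%N.
Let kk_gt1 : (1 < kk)%N.
Proof. by rewrite /kk (leq_trans k_gt1) // leq_pmull. Qed.

(** All the terms of [G - F] have degree more than [2 N K], so that
    [pseries_divide] applies to each entry. *)
Lemma difference_expansion (G : 'rV[K]_N -> 'M[K]_(m, n)) :
  same_jet (N * (2 * kk)) G (@L_ K N m n d a) ->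
  exists rho (e : 'I_N -> 'I_m -> 'I_n -> ('I_N -> C) -> C), [/\ 0 < rho,
    forall lam i j, ulim rho (e lam i j), forall lam i j, e lam i j (fun=> 0) = 0 &
    forall x : 'rV[K]_N, polydisc rho (x 0) ->
      G x = Fmap d (Amx a) (x 0) + \sum_lam x 0 lam ^+ (2 * kk) *: \matrix_(i, j) e lam i j (x 0)].
Proof.
move=> jet.
have [||r [r0 _ hr]] := @common_radius R _ (fun (q : 'I_m * 'I_n) r =>
   exists e : 'I_N -> ('I_N -> C) -> C, [/\ forall lam, ulim r (e lam),
     forall lam, e lam (fun=> 0) = 0 &
     forall x, polydisc r x -> on_fun (fun y => G y q.1 q.2) x -
        on_fun (fun y => @L_ K N m n d a y q.1 q.2) x =
       \sum_lam x lam ^+ (2 * kk) * e lam x]) 1 _ ltr01.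
- move=> q r r' le [e [ue e0 He]]; exists e; split=> //.
    by move=> lam; exact: ulim_mono le (ue lam).
  by move=> x xr; apply: He => j; exact: le_trans (xr j) le.
- move=> [i j] /=; have [c [c' [hG hL cc']]] := jet i j.
  have [r r0 pG] := has_power_series_pseries hG.
  have [r' r'0 pL] := has_power_series_pseries hL.
  have rr0 : 0 < Num.min r r' by rewrite lt_min r0.
  exists (Num.min r r') => //.
  apply: (pseries_divide rr0 N_gt0 _ (pseriesB r0 r'0 pG pL)).
    by rewrite muln_gt0 (ltnW kk_gt1).
  by move=> al /cc' ->; rewrite subrr.
have /choice [e he] := hr.
exists r, (fun lam i j => e (i, j) lam); split=> //.
- by move=> lam i j; have [] := he (i, j).
- by move=> lam i j; have [] := he (i, j).
move=> x xr; apply/matrixP => i j; rewrite mxE [X in _ + X]summxE.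
have [_ _ /(_ _ xr)] := he (i, j); rewrite -!on_funE => /eqP.
rewrite subr_eq => /eqP /= E; apply: etrans E _; rewrite addrC; congr (_ + _); last by rewrite L_E.
by apply: eq_bigr => lam _; rewrite !mxE.
Qed.

(** The solution of [solve_equation] transforms [F] into [G]. Its displacement
    has a factor [x_mu^K] with [K > 1], hence order at least two, so that it is
    a diffeomorphism tangent to the identity. *)
Theorem determined_L : determined (N * (2 * kk)) (@L_ K N m n d a).
Proof.
split.
  have := analytic_of_ulim ltr01 (fun i j => ulim_poly 1 (polyfun_Fmap i j)).
  by congr analytic_mx_germ; apply/funext => x; rewrite L_E.
move=> G anG /difference_expansion [rho [e [rho0 ue e0 GE]]].
have tf (t : 'I_N * 'I_m * 'I_n) :=
  tangent_functions (delta_mx t.1.2 t.2 : 'M[C]_(m, n)) d_gt0 (annih t.1.1).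
have /choice [BE /choice [AL /choice [PH hT]]] := tf.
have pBE t i j : polyfun (fun x => BE t x i j) by have [] := hT t.
have pAL t i j : polyfun (fun x => AL t x i j) by have [] := hT t.
have pPH t l : polyfun (PH t l) by have [] := hT t.
have kk0 : (0 < kk)%N := ltnW kk_gt1.
have tanE (lam : 'I_N) i j x : x lam ^+ kk *: delta_mx i j =
    BE (lam, i, j) x *m Fmap d (Amx a) x + Fmap d (Amx a) x *m AL (lam, i, j) x +
    \sum_l (PH (lam, i, j) l x * (d%:R * x l ^+ d.-1)) *: Amx a l.
  by have [_ _ _ H] := hT (lam, i, j); exact: H.
have [r [u [r0 rrho uu u0 Eq]]] :=
  @solve_equation R N m n d kk (Amx a) BE AL PH pBE pAL pPH tanE rho e rho0 ue e0.
pose v x := fun q => u q x.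
pose al x := right_pert kk AL x (v x); pose be x := left_pert kk BE x (v x).
pose ph l x := displacement kk PH l x (v x).
have zeroX p : (0 < p)%N -> 0 ^+ p = 0 :> C by move=> p0; rewrite expr0n eqn0Ngt p0.
have uX l p : ulim r (fun x : 'I_N -> C => x l ^+ p).
  exact/ulim_poly/polyfunX/polyfun_var.
have ual i j : ulim r (fun x => (1%:M + al x) i j).
  apply: (ulim_ext (f := fun x => (1%:M : 'M[C]_n) i j +
      \sum_mu x mu ^+ kk * right_comp AL mu x (v x) i j)).
    move=> x _; rewrite [RHS]mxE summxE; congr (_ + _).
    by apply: eq_bigr => mu _; rewrite mxE.
  apply: ulimD; first exact: ulim_const.
  apply: ulim_sum => mu; apply: ulimM; first exact: uX.
  by have [j0 _] := vanishing_right_comp pAL mu i j; exact: (joint_ulim j0 uu).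
have ube i j : ulim r (fun x => (1%:M + be x) i j).
  apply: (ulim_ext (f := fun x => (1%:M : 'M[C]_m) i j +
      \sum_mu x mu ^+ kk * left_comp BE mu x (v x) i j)).
    move=> x _; rewrite [RHS]mxE summxE; congr (_ + _).
    by apply: eq_bigr => mu _; rewrite mxE.
  apply: ulimD; first exact: ulim_const.
  apply: ulim_sum => mu; apply: ulimM; first exact: uX.
  by have [j0 _] := vanishing_left_comp pBE mu i j; exact: (joint_ulim j0 uu).
have al0 : 1%:M + al (fun=> 0) = 1%:M.
  rewrite /al /right_pert big1 ?addr0 // => mu _; rewrite zeroX // scale0r //.
have be0 : 1%:M + be (fun=> 0) = 1%:M.
  rewrite /be /left_pert big1 ?addr0 // => mu _; rewrite zeroX // scale0r //.
pose Gp l mu x := x mu ^+ kk.-1 * move_comp PH mu l x (v x).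
have uGp l mu : ulim r (Gp l mu).
  apply: ulimM; first exact: uX.
  by have [j0 _] := vanishing_move_comp pPH mu l; exact: (joint_ulim j0 uu).
have Gp0 l mu : Gp l mu (fun=> 0) = 0.
  by rewrite /Gp zeroX ?mul0r // -subn1 subn_gt0.
have phE l x : ph l x = \sum_mu x mu * Gp l mu x.
  by apply: eq_bigr => mu _; rewrite /Gp mulrA -exprS prednK.
have uph l : ulim r (ph l).
  exact: (joint_ulim (joint_displacement kk pPH l) uu).
have ph0 l : ph l (fun=> 0) = 0.
  by rewrite phE big1 // => mu _; rewrite mul0r.
have [rd [rd0 rdr lip]] := small_perturbation r0 uGp Gp0.
have lip_ph x y d' : polydisc rd x -> polydisc rd y -> 0 <= d' ->
   (forall j, nc (x j - y j) <= d') -> forall l, nc (ph l x - ph l y) <= d' / 2.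
  by move=> xr yr d0 xy l; rewrite !phE; exact: lip.
have [g [ug g0 gh hg]] := ulim_inverse_map rd0 (fun l => ulim_mono rdr (uph l)) ph0 lip_ph.
have [ra [Ai [ra0 rar uAi hAi]]] := ulim_matrix_inverse r0 ual al0.
have [rb [Bi [rb0 rbr uBi hBi]]] := ulim_matrix_inverse r0 ube be0.
exists (fun x => \row_l (x 0 l + ph l (x 0))), (fun x => 1%:M + al (x 0)),
  (fun x => Bi (x 0)); split.
- split.
  + apply: (analytic_of_ulim (B := fun x => \row_l (x l + ph l x)) r0) => i l.
    apply: (ulim_ext (f := fun x => x l + ph l x)) => [x _|]; first by rewrite mxE.
    by apply: ulimD => //; exact: ulim_var.
  + apply/rowP => l; rewrite !mxE.
    have -> : (0 : 'rV[K]_N) 0 = (fun=> 0) by apply/funext => j; rewrite mxE.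
    by rewrite ph0 addr0.
  exists (fun y => \row_l g l (y 0)); split.
  + apply: (analytic_of_ulim (rho := rd / 2) (B := fun x => \row_l g l x)); first by lra.
    move=> i l; apply: (ulim_ext (f := g l)) => [x _|//]; first by rewrite mxE.
  + apply/rowP => l; rewrite !mxE.
    have -> : (0 : 'rV[K]_N) 0 = (fun=> 0) by apply/funext => j; rewrite mxE.
    exact: g0.
  + apply/near_polydisc; exists (rd / 3); first by lra.
    move=> x xr; split; apply/rowP => l; rewrite !mxE.
      rewrite -[RHS](gh _ xr l); congr (g l _); apply/funext => j.
      by rewrite mxE.
    have xr2 : polydisc (rd / 2) (x 0) by move=> j; have := xr j; lra.
    rewrite -[RHS](hg _ xr2 l); congr (_ + ph l _); apply/funext => j.
    by rewrite mxE.
- split; first exact: (analytic_of_ulim r0 ual).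
  exists (fun x => Ai (x 0)); split; first exact: (analytic_of_ulim ra0 uAi).
  by apply/near_polydisc; exists ra => // x xr; exact: hAi.
- split; first exact: (analytic_of_ulim rb0 uBi).
  exists (fun x => 1%:M + be (x 0)); split; first exact: (analytic_of_ulim r0 ube).
  by apply/near_polydisc; exists rb => // x xr; have [] := hBi _ xr.
apply/near_polydisc; exists rb => // x xr.
have xr' : polydisc r (x 0) by move=> j; exact: le_trans (xr j) rbr.
have [B1 B2] := hBi _ xr.
have -> : invmx (Bi (x 0)) = 1%:M + be (x 0).
  have Bu : Bi (x 0) \in unitmx by case: (mulmx1_unit B1).
  by rewrite -[RHS](mulKmx Bu) B2 mulmx1.
have xrho : polydisc rho (x 0) by move=> j; exact: le_trans (xr' j) rrho.
rewrite GE // -(Eq _ xr'); congr (_ *m _ *m _).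
rewrite L_E; congr (Fmap d _ _); apply/funext => l.
by rewrite mxE.
Qed.
End Determinacy.

(** * Null sets from finite covers *)

Section Covers.
Variables (R : realType) (J : finType) (j0 : J).
Local Notation box := ((J -> R) * (J -> R))%type.

Definition vol (B : box) : R := \prod_j (B.2 j - B.1 j).
Definition inbox (B : box) (v : J -> R) := forall j, B.1 j <= v j <= B.2 j.
(** A box of volume zero, which can be added to any cover. *)
Definition point_box : box := (fun=> 0, fun=> 0).
Definition covered (Z : set (J -> R)) (eps : R) := exists s : seq box,
  [/\ forall i j, (nth point_box s i).1 j <= (nth point_box s i).2 j,
      forall v, Z v -> exists2 i, (i < size s)%N & inbox (nth point_box s i) v &
      \sum_(B <- s) vol B <= eps].

Lemma vol_point_box : vol point_box = 0.
Proof. by rewrite /vol (bigD1 j0) //= subrr mul0r. Qed.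

(** The [b]-th set is covered within [eps / 2^(b+1)], and the covers are
    concatenated; a point box in each cover makes the concatenation infinite, so
    that it provides a sequence of boxes. *)
Lemma real_null_countable_union (Z : nat -> set (J -> R)) :
  (forall b eps, 0 < eps -> covered (Z b) eps) ->
  real_null_set (\bigcup_b Z b).
Proof.
move=> cov eps eps0.
have /choice [fam hfam] : forall b, exists s : seq box, [/\ (0 < size s)%N,
    forall i j, (nth point_box s i).1 j <= (nth point_box s i).2 j,
    forall v, Z b v -> exists2 i, (i < size s)%N & inbox (nth point_box s i) v &
    \sum_(B <- s) vol B <= eps * 2^-1 ^+ b.+1].
  move=> b; have e0 : 0 < eps * 2^-1 ^+ b.+1 by rewrite mulr_gt0 ?exprn_gt0 ?invr_gt0.
  have [s [h1 h2 h3]] := cov b _ e0; exists (point_box :: s); split=> //.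
  - by move=> [|i] j //=.
  - by move=> v /h2 [i si vi]; exists i.+1.
  - by rewrite big_cons vol_point_box add0r.
pose S B := flatten [seq fam b | b <- iota 0 B].
have SS B : S B.+1 = S B ++ fam B.
  by rewrite /S -addn1 iotaD map_cat flatten_cat /= cats0.
have sizeS B : (B <= size (S B))%N.
  elim: B => // B IH; rewrite SS size_cat -addn1 leq_add //.
  by have [] := hfam B.
have nthS B B' i : (i < size (S B))%N -> (B <= B')%N ->
    nth point_box (S B') i = nth point_box (S B) i.
  move=> iS /subnKC <-; elim: (B' - B)%N => [|d IH]; first by rewrite addn0.
  rewrite addnS SS nth_cat IH; case: ltnP => // le.
  have sub : forall d, (size (S B) <= size (S (B + d)))%N.
    by elim=> [|d' IH']; rewrite ?addn0 // addnS SS size_cat (leq_trans IH') ?leq_addr.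
  by have := leq_trans iS (sub d); rewrite ltnNge le.
have okS B i j : (nth point_box (S B) i).1 j <= (nth point_box (S B) i).2 j.
  elim: B i => [|B IH] i; first by rewrite nth_nil.
  by rewrite SS nth_cat; case: ltnP => _ //; have [_ h _ _] := hfam B; exact: h.
have volS B : \sum_(x <- S B) vol x <= eps - eps * 2^-1 ^+ B.
  elim: B => [|B IH]; first by rewrite big_nil expr0 mulr1 subrr.
  rewrite SS big_cat /=; have [_ _ _ h] := hfam B.
  by move: h; rewrite exprS => h; lra.
pose bx i := nth point_box (S i.+1) i.
have vol0 i : 0 <= vol (bx i).
  by apply: prodr_ge0 => j _; rewrite subr_ge0; exact: okS.
exists (fun i => (bx i).1), (fun i => (bx i).2); split.
- by move=> i j; exact: okS.
- move=> v [b _ Zv]; have [_ _ h _] := hfam b; have [i ib vi] := h v Zv.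
  exists (size (S b) + i)%N => //=.
  have lt : (size (S b) + i < size (S b.+1))%N by rewrite SS size_cat ltn_add2l.
  have -> : bx (size (S b) + i) = nth point_box (fam b) i.
    rewrite /bx -(nthS _ (maxn b.+1 (size (S b) + i).+1)) ?leq_maxr ?sizeS //.
    by rewrite (nthS b.+1) ?leq_maxl // SS nth_cat ltnNge leq_addr /= addKn.
  exact: vi.
apply: lime_le.
  by apply: is_cvg_nneseries => i _ _; rewrite lee_fin; exact: vol0.
apply: nearW => L; rewrite sumEFin lee_fin.
have -> : \sum_(0 <= i < L) \prod_(j : J) ((bx i).2 j - (bx i).1 j) =
    \sum_(0 <= i < L) vol (nth point_box (S L) i).
  rewrite big_nat_cond [RHS]big_nat_cond; apply: eq_bigr => i /andP [/andP [_ iL] _].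
  by rewrite -/(vol (bx i)) /bx (nthS i.+1 L) // sizeS.
have volpos i : 0 <= vol (nth point_box (S L) i).
  by apply: prodr_ge0 => j _; rewrite subr_ge0; exact: okS.
apply: (@le_trans _ _ (\sum_(0 <= i < size (S L)) vol (nth point_box (S L) i))).
  rewrite [leRHS](big_cat_nat (leq0n L) (sizeS L)) /= lerDl.
  by apply: sumr_ge0 => i _.
rewrite -(big_nth point_box xpredT vol); apply: le_trans (volS L) _.
by rewrite lerBlDr lerDl mulr_ge0 ?exprn_ge0 // ltW.
Qed.

End Covers.

(** * Zeros of a nonzero polynomial form a null set *)

Lemma base_digits_inj s q (u v : 'I_q -> nat) :
  (forall i, u i < s)%N -> (forall i, v i < s)%N ->
  (\sum_i u i * s ^ i = \sum_i v i * s ^ i)%N -> u =1 v.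
Proof.
elim: q u v => [|q IH] u v us vs; first by move=> _ [].
have E (w : 'I_q.+1 -> nat) : (\sum_i w i * s ^ i =
    w ord0 + s * \sum_(i < q) w (lift ord0 i) * s ^ i)%N.
  rewrite big_ord_recl expn0 muln1 big_distrr /=; congr (_ + _)%N.
  by apply: eq_bigr => i _; rewrite /= /bump leq0n add1n expnS mulnCA.
rewrite !E => Euv.
have E0 : u ord0 = v ord0.
  have := congr1 (modn^~ s) Euv.
  by rewrite ![(_ + s * _)%N]addnC ![(s * _)%N]mulnC !modnMDl !modn_small.
have s0 : (0 < s)%N by apply: leq_ltn_trans (us ord0).
move: Euv; rewrite E0 => /eqP; rewrite eqn_add2l eqn_pmul2l // => /eqP.
move=> /(IH (fun i => u (lift ord0 i)) (fun i => v (lift ord0 i))) H.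
move=> i; case: (unliftP ord0 i) => [j ->|-> //].
by apply: H.
Qed.

Section Kronecker.
Variables (F : fieldType) (q : nat) (delta : mpoly.mpoly q F).
Hypothesis delta0 : delta != 0.
Let s := mpoly.mmeasure mpoly.mdeg delta.
Let s_gt0 : (0 < s)%N.
Proof. by rewrite lt0n mpoly.mmeasure_poly_eq0. Qed.
Let W (al : mpoly.multinom q) := (\sum_i al i * s ^ i)%N.

(** The restriction of [delta] to the curve [t |-> a + (t, t^s, t^(s^2), ...)],
    as in Kronecker's substitution. *)
Definition along_curve (a : 'I_q -> F) : {poly F} :=
  \sum_(al <- mpoly.msupp delta) mpoly.mcoeff al delta *:
    \prod_i ((a i)%:P + 'X^(s ^ i)) ^+ al i.

Lemma along_curveE a t :
  (along_curve a).[t] = mpoly.meval (fun i => a i + t ^+ (s ^ i)) delta.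
Proof.
rewrite /along_curve horner_sum mpoly.mevalE; apply: eq_bigr => al _.
rewrite hornerZ horner_prod; congr (_ * _); apply: eq_bigr => i _.
by rewrite horner_exp !hornerE.
Qed.

Let monic_of (p : {poly F}) k := p \is monic /\ size p = k.+1.
Let monic_ofM p k p' k' : monic_of p k -> monic_of p' k' -> monic_of (p * p') (k + k').
Proof.
move=> [mp sp] [mp' sp']; split; first by rewrite monicMr.
by rewrite size_monicM ?monic_neq0 // sp sp' addnS.
Qed.
Let monic_of1 : monic_of 1 0. Proof. by split; [exact: monic1|rewrite size_poly1]. Qed.

Let monic_of_prod a (al : mpoly.multinom q) :
  monic_of (\prod_(i < q) ((a i)%:P + 'X^(s ^ i)) ^+ al i) (W al).
Proof.
rewrite /W; elim/big_rec2: _ => // i k p _ IH; apply: monic_ofM => //.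
have m1 : monic_of ((a i)%:P + 'X^(s ^ i)) (s ^ i).
  have si : (0 < s ^ i)%N by rewrite expn_gt0 s_gt0.
  by rewrite addrC; split; [exact: monicXnaddC|exact: size_XnaddC].
elim: (al i) => [|k' IHk]; first by rewrite expr0 mul0n.
by rewrite exprS mulSn; apply: monic_ofM.
Qed.

(** The monomials of [delta] have exponents less than [s], hence distinct
    degrees along the curve: the one of largest degree gives the leading term,
    whatever the origin [a]. *)
Lemma along_curve_lead : exists (c : F) (D : nat), c != 0 /\
  forall a, size (along_curve a) = D.+1 /\ lead_coef (along_curve a) = c.
Proof.
have lts al i : al \in mpoly.msupp delta -> (al i < s)%N.
  move=> /mpoly.msize_mdeg_lt; apply: leq_ltn_trans.
  by rewrite mpoly.mdegE (bigD1 i) //= leq_addr.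
have [al0 al0s alm] : exists2 al0, al0 \in mpoly.msupp delta &
    forall al, al \in mpoly.msupp delta -> al != al0 -> (W al < W al0)%N.
  have sn : mpoly.msupp delta != [::] by rewrite mpoly.msupp_eq0.
  have : exists2 al0, al0 \in mpoly.msupp delta &
      forall al, al \in mpoly.msupp delta -> (W al <= W al0)%N.
    case: (mpoly.msupp delta) sn => // b l _.
    elim: l b => [|c l IH] b; first by exists b; rewrite ?mem_head // => al; rewrite inE => /eqP ->.
    have [al0 al0s H] := IH c; have [le|lt] := leqP (W al0) (W b).
      exists b; rewrite ?mem_head // => al; rewrite inE => /orP [/eqP -> //|/H h].
      exact: leq_trans h le.
    exists al0; first by rewrite inE al0s orbT.
    by move=> al; rewrite inE => /orP [/eqP ->|/H //]; exact: ltnW.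
  case=> al0 al0s H; exists al0 => // al als ne.
  rewrite ltn_neqAle H // andbT; apply: contra ne => /eqP E.
  apply/eqP/mpoly.mnmP; apply: (base_digits_inj _ _ E) => i; exact: lts.
exists (mpoly.mcoeff al0 delta), (W al0); split; first by rewrite -mpoly.mcoeff_msupp.
move=> a; rewrite /along_curve (bigD1_seq al0) ?mpoly.msupp_uniq //=.
set p := _ *: _; set r := \sum_(al <- _ | _) _.
have c0 : mpoly.mcoeff al0 delta != 0 by rewrite -mpoly.mcoeff_msupp.
have [mp sp] := monic_of_prod a al0.
have szp : size p = (W al0).+1 by rewrite size_scale.
have szr : (size r <= W al0)%N.
  rewrite /r big_seq_cond; elim/big_ind: _ => [|x y|al /andP [als ne]].
  - by rewrite size_poly0.
  - by move=> hx hy; rewrite (leq_trans (size_polyD _ _)) // geq_max hx.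
  - rewrite (leq_trans (size_scale_leq _ _)) //.
    by have [_ ->] := monic_of_prod a al; exact: alm.
rewrite size_polyDl ?szp ?ltnS //; split=> //.
by rewrite lead_coefDl ?szp ?ltnS // lead_coefZ (monicP mp) mulr1.
Qed.

End Kronecker.

Section FewSmallValues.
Variable R : realType.
Local Notation C := R[i].

(** A polynomial is small only near its roots, and each root is near one of the
    separated points [t i] at most. *)
Lemma few_small_values (p : {poly C}) (D T : nat) (t : 'I_T -> C) (h eta : R) :
  size p = D.+1 -> 0 < h -> (forall i j, i != j -> h <= nc (t i - t j)) ->
  eta < nc (lead_coef p) * (h / 3) ^+ D ->
  (#|[set i | (nc p.[t i] <= eta)%R]%SET| <= D)%N.
Proof.
move=> sp h0 sep eta_lt; set Bad := [set i | _]%SET.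
have [r pE] := closed_field_poly_normal p.
have p0 : lead_coef p != 0 by rewrite lead_coef_eq0 -size_poly_eq0 sp.
have sr : size r = D.
  have := sp; rewrite pE size_scale // size_prod_XsubC => -[] //.
have near_root i : i \in Bad -> exists k : 'I_D, nc (t i - nth 0 r k) < h / 3.
  rewrite inE => small; apply: contrapT => /forallNP far.
  suff : nc (lead_coef p) * (h / 3) ^+ D <= nc p.[t i].
    by move=> le; have := lt_le_trans eta_lt le; rewrite ltNge small.
  rewrite {2}pE hornerZ horner_prod ncM ler_wpM2l ?nc_ge0 // nc_prod.
  rewrite (big_nth 0) big_mkord sr -[D in leLHS]card_ord -prodr_const.
  apply: ler_prod => k _; rewrite divr_ge0 ?(ltW h0) //= !hornerE.
  by rewrite leNgt; apply/negP; exact: far.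
have [k hk] : exists k : 'I_T -> nat, forall i, i \in Bad -> (k i < D)%N /\
    nc (t i - nth 0 r (k i)) < h / 3.
  have /choice [k hk] : forall i, exists k, i \in Bad -> (k < D)%N /\
      nc (t i - nth 0 r k) < h / 3; last by exists k.
    move=> i; have [/near_root [k hk]|_] := boolP (i \in Bad); last by exists 0%N.
    by exists (val k) => _; split; [exact: ltn_ord|exact: hk].
have kinj : {in Bad &, injective k}.
  move=> i j iB jB kij; apply/eqP; apply: contraT => ne.
  have [_ hi] := hk i iB; have [_ hj] := hk j jB; rewrite -kij in hj.
  have := sep i j ne; have := nc_dist (t i) (nth 0 r (k i)) (t j).
  by rewrite (ncB (nth 0 r (k i))); lra.
rewrite cardE -(size_map k) -[D](size_iota 0).
apply: uniq_leq_size.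
  rewrite map_inj_in_uniq ?enum_uniq // => i j; rewrite !mem_enum; exact: kinj.
by apply/allP; rewrite all_map; apply/allP => i; rewrite mem_enum /= mem_iota => /hk [].
Qed.

End FewSmallValues.

Lemma scaled_power (F : numFieldType) (i T c a b : nat) : (0 < T)%N -> (0 < c)%N ->
  (i ^ a * T ^ b * c)%:R / (T ^ (a + b) * c)%:R = (i%:R / T%:R) ^+ a :> F.
Proof.
move=> T0 c0; have T1 : T%:R != 0 :> F by rewrite pnatr_eq0 -lt0n.
have c1 : c%:R != 0 :> F by rewrite pnatr_eq0 -lt0n.
rewrite expnD !natrM !natrX expr_div_n -!mulf_div !divff ?expf_neq0 // !mulr1 //.
Qed.

Section PolynomialZeros.
Variables (R : realType) (I : finType) (i0 : I).
Local Notation C := R[i].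
Local Notation q := #|I|.
Local Notation J := (I + I)%type.
Variable delta : mpoly.mpoly q C.
Hypothesis delta0 : delta != 0.

Definition to_complex (v : J -> R) (i : I) : C := Complex (v (inl i)) (v (inr i)).
Definition zero_fun (a : I -> C) : C := mpoly.meval (fun k => a (enum_val k)) delta.

Lemma polyfun_zero_fun : polyfun zero_fun.
Proof.
apply: (polyfun_comp (polyfun_meval delta)) => k; exact: polyfun_var.
Qed.

Lemma nc_to_complex (v w : J -> R) i (e : R) : (forall j, `|v j - w j| <= e) ->
  nc (to_complex v i - to_complex w i) <= 2 * e.
Proof.
move=> vw; apply: le_trans (nc_ReIm _) _.
by rewrite /to_complex /=; have := vw (inl i); have := vw (inr i); lra.
Qed.

(** The cube is divided into cells of side [1/M]. The corner of a cell that
    meets the zero set is a grid point where [delta] is small. For a fixed grid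
    point [k'], only [D] of the [T] values [i / T] make [delta] small at the
    point of the curve through [k'] with that parameter ([few_small_values]).
    Counting the pairs (bad cell, parameter), each determined by the parameter
    and the origin of the curve that passes through the cell's corner at this
    parameter, shows that the proportion of bad cells is [O(D / T)]. The mesh is
    a fraction of the powers of [1/T] so that the translations along the curve
    preserve the grid. *)
Lemma bounded_zeros_covered (b : nat) (eps : R) : 0 < eps ->
  covered [set v : J -> R | (forall j, - b%:R <= v j < b%:R) /\ zero_fun (to_complex v) = 0] eps.
Proof.
move=> eps0.
have [c [D [c0 hcurve]]] := along_curve_lead delta0.
set s := mpoly.mmeasure mpoly.mdeg delta in hcurve.
pose e0 := #|{: J}|.
pose V : R := D%:R * (2 * b%:R + 2) ^+ e0.
have V0 : 0 <= V by rewrite mulr_ge0 ?exprn_ge0 // addr_ge0 ?mulr_ge0.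
have [T T0 VT] : exists2 T : nat, (0 < T)%N & V / T%:R <= eps.
  exists (Num.bound (V / eps)).+1 => //.
  rewrite ler_pdivrMr ?ltr0n // -ler_pdivrMl // mulrC ltW //.
  apply: lt_le_trans (archi_boundP _) _; first by rewrite divr_ge0 // ltW.
  by rewrite ler_nat.
pose W := (\sum_(i < q) s ^ i)%N.
have sW (i : 'I_q) : (s ^ i <= W)%N by rewrite /W (bigD1 i) //= leq_addr.
pose h : R := T%:R^-1.
have h0 : 0 < h by rewrite invr_gt0 ltr0n.
have [Lc Lc0 hL] := polyfun_lipschitz (2 * (b%:R + 1)) polyfun_zero_fun.
have nc0' : 0 < nc c.
  by rewrite lt_neqAle nc_ge0 andbT eq_sym; apply: contra c0 => /eqP /nc_eq0 ->.
pose eta0 := nc c * (h / 3) ^+ D.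
have eta00 : 0 < eta0 by rewrite mulr_gt0 ?exprn_gt0 ?divr_gt0.
have [M' M'0 M'_gt] : exists2 M' : nat, (0 < M')%N & 2 * Lc / eta0 < M'%:R.
  exists (Num.bound (2 * Lc / eta0)).+1 => //.
  have q0 : 0 <= 2 * Lc / eta0 by rewrite divr_ge0 ?(ltW eta00) ?mulr_ge0.
  by apply: lt_le_trans (archi_boundP q0) _; rewrite ler_nat.
have [M MN] : exists M, M = (T ^ W * M')%N by exists (T ^ W * M')%N.
have M0 : (0 < M)%N by rewrite MN muln_gt0 expn_gt0 T0.
have MR : 0 < M%:R :> R by rewrite ltr0n.
pose eta := Lc * (2 / M%:R).
have eta_lt : eta < eta0.
  rewrite /eta mulrA [Lc * 2]mulrC ltr_pdivrMr // -ltr_pdivrMl // [eta0^-1 * _]mulrC.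
  apply: lt_le_trans M'_gt _; rewrite ler_nat MN leq_pmull //.
  by rewrite expn_gt0 T0.
pose grid := {ffun J -> 'I_(2 * b * M)}; pose grid' := {ffun J -> 'I_((2 * b + 2) * M)}.
pose pt (k : grid) : J -> R := fun j => (k j)%:R / M%:R - b%:R.
pose pt' (k : grid') : J -> R := fun j => (k j)%:R / M%:R - (b%:R + 1).
pose bx (k : grid) : (J -> R) * (J -> R) := (pt k, fun j => pt k j + M%:R^-1).
pose Bad := [set k : grid | `[< exists v, [/\ inbox (bx k) v,
   (forall j, - b%:R <= v j < b%:R) & zero_fun (to_complex v) = 0] >]]%SET.
have pt_bound k j : - b%:R <= pt k j <= b%:R.
  have k0 : 0 <= (k j)%:R / M%:R :> R by rewrite divr_ge0.
  have k2 : (k j)%:R / M%:R <= 2 * b%:R :> R.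
    by rewrite ler_pdivrMr // -!natrM ler_nat ltnW // ltn_ord.
  by rewrite /pt; move: k0 k2; lra.
have Bad_small k : k \in Bad -> nc (zero_fun (to_complex (pt k))) <= eta.
  rewrite inE => /asboolP [v [vk vb fv]].
  have := hL (to_complex (pt k)) (to_complex v) (2 / M%:R); rewrite fv subr0; apply.
  - move=> i; rewrite -[to_complex _ _]subr0.
    have -> : (0 : C) = to_complex (fun=> 0) i by [].
    apply: nc_to_complex => j; rewrite subr0 ler_norml; have := pt_bound k j; lra.
  - move=> i; rewrite -[to_complex _ _]subr0.
    have -> : (0 : C) = to_complex (fun=> 0) i by [].
    by apply: nc_to_complex => j; rewrite subr0 ler_norml; have := vb j; lra.
  - by rewrite divr_ge0.
  - move=> i; apply: nc_to_complex => j; have := vk j; rewrite /bx /= ler_norml.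
    by lra.
(* the translation vector, in units of the mesh 1/M *)
pose tau (i : 'I_T) (j : J) : nat := if j is inl x
  then (i ^ (s ^ enum_rank x) * T ^ (W - s ^ enum_rank x) * M')%N else 0%N.
have tau_le i j : (tau i j <= M)%N.
  case: j => [x|x] //=; rewrite MN leq_mul2r; apply/orP; right.
  rewrite -{2}(subnKC (sW (enum_rank x))) expnD leq_mul2r; apply/orP; right.
  by rewrite leq_exp2r ?(ltnW (ltn_ord i)) // expn_gt0 lt0n mpoly.mmeasure_poly_eq0 delta0.
have tauE (i : 'I_T) x : (tau i (inl x))%:R / M%:R = (i%:R / T%:R) ^+ (s ^ enum_rank x) :> R.
  by rewrite /= MN -{2}(subnKC (sW (enum_rank x))) scaled_power.
have mv_lt (k : grid) (i : 'I_T) j : (k j + M - tau i j < (2 * b + 2) * M)%N.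
  apply: leq_ltn_trans (leq_subr _ _) _.
  by rewrite mulnDl -addSn leq_add // leq_pmull.
pose mv (k : grid) (i : 'I_T) : grid' := [ffun j => Ordinal (mv_lt k i j)].
pose t (i : 'I_T) : C := (i%:R / T%:R)%:C%C.
pose small (k' : grid') := [set i : 'I_T |
  (nc (along_curve delta (fun n => to_complex (pt' k') (enum_val n))).[t i] <= eta)%R]%SET.
have small_le k' : (#|small k'| <= D)%N.
  have [sz ld] := hcurve (fun n => to_complex (pt' k') (enum_val n)).
  apply: (few_small_values sz h0); last by rewrite ld.
  move=> i j ne; rewrite /t -rmorphB /=.
  rewrite (_ : nc _ = `|i%:R / T%:R - j%:R / T%:R|); last first.
    by rewrite /nc /= expr0n addr0 sqrtr_sqr.
  rewrite -mulrBl normrM (ger0_norm (ltW h0)) -[leLHS]mul1r ler_wpM2r ?(ltW h0) //.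
  have : i != j :> nat by [].
  rewrite neq_ltn => /orP [lt|lt]; [rewrite distrC|]; rewrite ger0_norm ?subr_ge0 ?ler_nat ?(ltnW lt) //;
    by rewrite lerBrDr nat1r ler_nat.
have mvE k (i : 'I_T) : (along_curve delta (fun n => to_complex (pt' (mv k i)) (enum_val n))).[t i] =
    zero_fun (to_complex (pt k)).
  rewrite along_curveE /zero_fun; apply: mpoly.meval_eq => n.
  have rw j : pt' (mv k i) j = pt k j - (tau i j)%:R / M%:R.
    rewrite /pt' /pt ffunE /= natrB ?natrD; last exact: leq_trans (tau_le i j) (leq_addl _ _).
    by field; rewrite gt_eqF.
  rewrite /to_complex !rw tauE enum_valK /= mul0r subr0 /t -rmorphXn /=.
  by apply/eqP; rewrite eq_complex /= addr0 subrK !eqxx.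
have count : (#|Bad| * T <= #|{: grid'}| * D)%N.
  pose h2 (p : grid * 'I_T) := (mv p.1 p.2, p.2).
  have -> : (#|Bad| * T = #|h2 @: finset.setX Bad [set: 'I_T]%SET|)%N.
    rewrite card_in_imset ?cardsX; last first.
      move=> [k i] [k1 i1] _ _ [] E Ei; rewrite -Ei in E *; congr (_, _).
      apply/ffunP => j; apply: val_inj.
      have := congr1 (fun f : grid' => val (f j)) E; rewrite !ffunE /=.
      have le x : (tau i j <= x + M)%N by rewrite (leq_trans (tau_le i j)) ?leq_addl.
      by move/(congr1 (addn (tau i j))); rewrite !subnKC //; exact: addIn.
    by rewrite cardsT card_ord.
  apply: (@leq_trans #|[set p : grid' * 'I_T | p.2 \in small p.1]%SET|).
    apply/subset_leq_card/fintype.subsetP => p /imsetP [[k i] /finset.setXP [kB _] ->].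
    by rewrite !inE /= mvE; exact: Bad_small.
  have -> : (#|[set p : grid' * 'I_T | p.2 \in small p.1]%SET| = \sum_(k' : grid') #|small k'|)%N.
    rewrite -sum1_card (eq_bigl (fun p : grid' * 'I_T => p.2 \in small p.1)); last by move=> p; rewrite inE.
    rewrite -(pair_big_dep xpredT (fun k' i => i \in small k') (fun _ _ => 1%N)) /=.
    by apply: eq_bigr => k' _; rewrite sum1_card.
  by rewrite -sum_nat_const; apply: leq_sum.
exists [seq bx k | k <- enum Bad]; split.
- move=> i j; have [lt|ge] := ltnP i (size (enum Bad)); last by rewrite nth_default ?size_map.
  case: (enum Bad) lt => // k l lt; rewrite (nth_map k) // /bx /= lerDl invr_ge0 ltW //.
- move=> v [vb fv].
  have vpos j : 0 <= (v j + b%:R) * M%:R by rewrite mulr_ge0 //; have := vb j; lra.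
  have klt j : (Num.truncn ((v j + b%:R) * M%:R) < 2 * b * M)%N.
    rewrite -(ltr_nat R); have /andP [le _] := truncn_itv (vpos j).
    apply: le_lt_trans le _; rewrite !natrM ltr_pM2r //; have := vb j; lra.
  pose k : grid := [ffun j => Ordinal (klt j)].
  have vk : inbox (bx k) v.
    move=> j; rewrite /bx /pt /= ffunE /=; have /andP [le lt] := truncn_itv (vpos j).
    rewrite -ler_pdivrMr // in le; rewrite -ltr_pdivlMr // -natr1 mulrDl mul1r in lt.
    apply/andP; split; lra.
  have kB : k \in Bad by rewrite inE; apply/asboolP; exists v.
  exists (index k (enum Bad)); first by rewrite size_map index_mem mem_enum.
  by rewrite (nth_map k) ?index_mem ?mem_enum // nth_index ?mem_enum.
rewrite big_map (eq_bigr (fun=> M%:R^-1 ^+ e0)); last first.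
  move=> k _; rewrite /vol /bx /=.
  by under eq_bigr do rewrite addrAC subrr add0r; rewrite prodr_const.
rewrite big_const_seq count_predT iter_addr addr0 -cardE.
apply: le_trans VT; rewrite ler_pdivlMr ?ltr0n // -[X in X * _]mulr_natr -mulrA -natrM.
apply: (@le_trans _ _ (M%:R^-1 ^+ e0 * (#|{: grid'}| * D)%:R)).
  by rewrite ler_wpM2l ?exprn_ge0 ?invr_ge0 // ler_nat count.
rewrite card_ffun card_ord /V -/e0 natrM natrX natrM natrD natrM exprMn exprVn.
by rewrite mulrA [_^-1 * _]mulrC mulfK ?expf_neq0 ?gt_eqF // mulrC.
Qed.

Lemma complex_null_zeros : complex_null_set [set a | zero_fun a = 0].
Proof.
move=> eps /(real_null_countable_union (inl i0) bounded_zeros_covered) [lo [hi [h1 h2 h3]]].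
exists lo, hi; split=> // v v0; apply: h2.
exists (\sum_j (Num.bound `|v j|))%N => //; split=> // j.
have lt : `|v j| < (\sum_j Num.bound `|v j|)%:R.
  apply: lt_le_trans (archi_boundP (normr_ge0 _)) _.
  by rewrite ler_nat (bigD1 j) //= leq_addr.
by move: lt; rewrite ltr_norml => /andP [lo_lt hi_lt]; rewrite (ltW lo_lt).
Qed.

End PolynomialZeros.

(** * Generic finite determinacy *)

Theorem proposition3p2 (R : realType) (N m n d : nat)
    (N_gt0 : (0 < N)%N) (m_gt0 : (0 < m)%N) (n_gt0 : (0 < n)%N)
    (d_gt0 : (0 < d)%N) :
  exists Z : set ('I_m * 'I_n * 'I_N -> R[i]),
    complex_null_set Z /\
    forall a : 'I_m * 'I_n * 'I_N -> R[i],
      ~ Z a -> finitely_determined (L_ d a).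
Proof.
have [delta delta0 generic] := GenericTangent.generic_annihilator R[i] N m n.
pose q0 : 'I_m * 'I_n * 'I_N := (Ordinal m_gt0, Ordinal n_gt0, Ordinal N_gt0).
exists [set a | zero_fun delta a = 0]; split.
  exact: complex_null_zeros q0 _ delta0.
move=> a /eqP /generic [k annih].
exists (N * (2 * (d * k.+2)))%N.
have annih' lam : GenericTangent.annihilator a (mpoly.mpolyX R[i] (mpoly.mnm1 lam) ^+ k.+2).
  by move=> M; rewrite -addn2 exprD -scalerA; exact: annih.
by have := determined_L N_gt0 d_gt0 _ annih'; apply.
Qed.
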